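(* Let $\{y_t\}$ be generated by the ARMA model with parameter $\boldsymbol\eta_0$ and parameter set $\Pi$ described in the context. Assume the $\varepsilon_t$, $t\ge1$, are i.i.d. random variables with $\mathrm E(\varepsilon_t)=0$ and $\mathrm E(\varepsilon_t^2)=\sigma^2$. Assume that there exist positive constants $\alpha_1,\xi,M_1$ such that for any $0<s_2-s_1\le\xi$, $$\sup_{1\le m\le t<\infty,\ \|\mathbf v\|=1}|F_{t,m,\mathbf v}(s_2)-F_{t,m,\mathbf v}(s_1)|\le M_1(s_2-s_1)^{\alpha_1},$$ where $\mathbf v\in\mathbb R^m$ and $F_{t,m,\mathbf v}$ denotes the distribution function of $\mathbf v^{\mathrm T}(\varepsilon_t,\dots,\varepsilon_{t+1-m})^{\mathrm T}$. Assume further that $\mathrm E|\varepsilon_1|^{q_1}<\infty$ for some $q_1>18$. Let $\hat{\boldsymbol\eta}_n=\arg\min_{\boldsymbol\eta\in\Pi}\sum_{t=1}^n(y_t-g_t(\boldsymbol\eta))^2$. Then $$\lim_{n\to\infty}n\bigl[\mathrm E\{y_{n+1}-g_{n+1}(\hat{\boldsymbol\eta}_n)\}^2-\sigma^2\bigr]=\bar p\,\sigma^2,$$ where $\bar p=p_1+p_2$.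
   Context: ARMA setting. Let $p_1,p_2\ge0$ be integers with $\bar p=p_1+p_2\ge1$. The observations satisfy $y_t=g_t(\boldsymbol\eta_0)+\varepsilon_t$, $t\ge1$, where $\boldsymbol\eta_0=(\alpha_{0,1},\dots,\alpha_{0,p_1},\beta_{0,1},\dots,\beta_{0,p_2})^{\mathrm T}$ is an unknown coefficient vector, $$g_t(\boldsymbol\eta_0)=\alpha_{0,1}y_{t-1}+\cdots+\alpha_{0,p_1}y_{t-p_1}-\beta_{0,1}\varepsilon_{t-1}-\cdots-\beta_{0,p_2}\varepsilon_{t-p_2},$$ with initial conditions $y_t=\varepsilon_t=0$ for all $t\le0$. For a general $\boldsymbol\eta=(\alpha_1,\dots,\alpha_{p_1},\beta_1,\dots,\beta_{p_2})^{\mathrm T}$, define $\varepsilon_t(\boldsymbol\eta)=0$ for $t\le0$ and recursively for $t\ge1$ $$\varepsilon_t(\boldsymbol\eta)=y_t-g_t(\boldsymbol\eta)=y_t-\alpha_1y_{t-1}-\cdots-\alpha_{p_1}y_{t-p_1}+\beta_1\varepsilon_{t-1}(\boldsymbol\eta)+\cdots+\beta_{p_2}\varepsilon_{t-p_2}(\boldsymbol\eta),$$ so that $\varepsilon_t(\boldsymbol\eta_0)=\varepsilon_t$; this also defines $g_t(\boldsymbol\eta)$. $\Pi\subset\mathbb R^{p_1+p_2}$ is a compact set that contains $\boldsymbol\eta_0$ as an interior point and all of whose elements $\boldsymbol\eta$ satisfy: with $A_{1,\boldsymbol\eta}(z)=1-\sum_{j=1}^{p_1}\alpha_jz^j$ and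 $A_{2,\boldsymbol\eta}(z)=1-\sum_{j=1}^{p_2}\beta_jz^j$, (1) $A_{1,\boldsymbol\eta}(z)\ne0$ and $A_{2,\boldsymbol\eta}(z)\neq0$ for all $|z|\le1$; (2) $A_{1,\boldsymbol\eta}$ and $A_{2,\boldsymbol\eta}$ have no common zeros; (3) $|\alpha_{p_1}|+|\beta_{p_2}|>0$ (a term with index $0$ is omitted). $\|\cdot\|$ is the Euclidean norm. *)

(* Defs.v *)
From HB Require Import structures.
From mathcomp Require Import all_boot all_order all_algebra.
From mathcomp Require Import complex.
From mathcomp Require Import all_classical all_reals all_analysis.
From mathcomp Require Import measurable_realfun.
Set Implicit Arguments.
Unset Strict Implicit.
Unset Printing Implicit Defensive.
Import Order.TTheory GRing.Theory Num.Theory.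
Import numFieldNormedType.Exports.
Local Open Scope classical_set_scope.
Local Open Scope ring_scope.

(* Processes are indexed by nat and vanish at 0.  Subtraction on nat is
   truncated, so a value at t - j with j >= t is the value at 0: this is the
   convention that y_t = eps_t = 0 for all t <= 0. *)

Definition alpha (R : realType) (p1 p2 : nat) (eta : 'rV[R]_(p1 + p2))
  (j : 'I_p1) : R := eta ord0 (lshift p2 j).

Definition beta (R : realType) (p1 p2 : nat) (eta : 'rV[R]_(p1 + p2))
  (j : 'I_p2) : R := eta ord0 (rshift p1 j).

(* The summation index j : 'I_p1 stands for the lag j.+1. *)
Definition arma_reg (R : realType) (p1 p2 : nat) (eta : 'rV[R]_(p1 + p2))
    (y e : nat -> R) (t : nat) : R :=
  \sum_(j < p1) alpha eta j * y (t - j.+1)%N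
  - \sum_(j < p2) beta eta j * e (t - j.+1)%N.

(* resid_hist eta y t agrees with eps_s(eta) for s <= t and is 0 for s > t. *)
Fixpoint resid_hist (R : realType) (p1 p2 : nat) (eta : 'rV[R]_(p1 + p2))
    (y : nat -> R) (t : nat) : nat -> R :=
  if t is t'.+1 then
    let h := resid_hist eta y t' in
    fun s => if s == t'.+1 then y t'.+1 - arma_reg eta y h t'.+1 else h s
  else fun=> 0.

Definition resid (R : realType) (p1 p2 : nat) (eta : 'rV[R]_(p1 + p2))
  (y : nat -> R) (t : nat) : R := resid_hist eta y t t.

Definition arma_g (R : realType) (p1 p2 : nat) (eta : 'rV[R]_(p1 + p2))
  (y : nat -> R) (t : nat) : R := arma_reg eta y (resid eta y) t.

Lemma resid0 (R : realType) (p1 p2 : nat) (eta : 'rV[R]_(p1 + p2))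
  (y : nat -> R) : resid eta y 0 = 0.
Proof. by []. Qed.

Lemma resid_histE (R : realType) (p1 p2 : nat) (eta : 'rV[R]_(p1 + p2))
  (y : nat -> R) (t s : nat) : (s <= t)%N -> resid_hist eta y t s = resid eta y s.
Proof.
elim: t s => [|t IH] s; first by rewrite leqn0 => /eqP->.
rewrite leq_eqVlt => /predU1P[->//|]; rewrite ltnS => st /=.
by rewrite ltn_eqF ?ltnS// IH.
Qed.

Lemma residS (R : realType) (p1 p2 : nat) (eta : 'rV[R]_(p1 + p2))
  (y : nat -> R) (t : nat) : resid eta y t.+1 = y t.+1 - arma_g eta y t.+1.
Proof.
rewrite {1}/resid /= eqxx /arma_g /arma_reg; congr (_ - (_ - _)).
apply: eq_bigr => j _; rewrite resid_histE//.
by rewrite subSS leq_subr.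
Qed.

Lemma resid_innovation (R : realType) (p1 p2 : nat) (eta : 'rV[R]_(p1 + p2))
    (y e : nat -> R) (e0 : e 0%N = 0)
    (ye : forall t, y t.+1 = arma_reg eta y e t.+1 + e t.+1) :
  forall t, resid eta y t = e t.
Proof.
elim/ltn_ind => -[|t] IH; first by rewrite resid0 e0.
suff -> : resid eta y t.+1 = y t.+1 - arma_reg eta y e t.+1.
  by rewrite ye addrC addKr.
rewrite residS /arma_g /arma_reg; congr (_ - (_ - _)).
by apply: eq_bigr => j _; rewrite IH// subSS ltnS leq_subr.
Qed.

Definition ar_poly (R : realType) (p1 p2 : nat) (eta : 'rV[R]_(p1 + p2)) :
  {poly R} := 1 - \sum_(j < p1) alpha eta j *: 'X^(j.+1).

Definition ma_poly (R : realType) (p1 p2 : nat) (eta : 'rV[R]_(p1 + p2)) :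
  {poly R} := 1 - \sum_(j < p2) beta eta j *: 'X^(j.+1).

Definition complex_poly (R : realType) (p : {poly R}) : {poly R[i]} :=
  map_poly (real_complex R) p.

(* Each sum in the last condition has at most one term, the one of index p1
   (resp. p2); it is empty when p1 = 0 (resp. p2 = 0). *)
Definition arma_admissible (R : realType) (p1 p2 : nat)
    (eta : 'rV[R]_(p1 + p2)) : Prop :=
  [/\ forall z : R[i], `|z| <= 1 ->
        (complex_poly (ar_poly eta)).[z] <> 0 /\
        (complex_poly (ma_poly eta)).[z] <> 0,
      forall z : R[i], ~ ((complex_poly (ar_poly eta)).[z] = 0 /\
                          (complex_poly (ma_poly eta)).[z] = 0)
    & 0 < \sum_(j < p1 | j.+1 == p1) `|alpha eta j|
          + \sum_(j < p2 | j.+1 == p2) `|beta eta j| ].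

(* The library norm on 'rV[R]_m is the sup norm. *)
Definition enorm (R : realType) (m : nat) (v : 'rV[R]_m) : R :=
  Num.sqrt (\sum_(i < m) v ord0 i ^+ 2).

Definition mutually_independent (d : measure_display) (T : measurableType d)
    (R : realType) (P : probability T R) (X : nat -> {RV P >-> R}) : Prop :=
  forall (s : seq nat) (B : nat -> set R), uniq s ->
    (forall i, measurable (B i)) ->
    P (\bigcap_(i in [set` s]) (X i @^-1` B i)) =
    (\prod_(i <- s) P (X i @^-1` B i))%E.

Definition identically_distributed (d : measure_display)
    (T : measurableType d) (R : realType) (P : probability T R)
    (X : nat -> {RV P >-> R}) : Prop :=
  forall (i j : nat) (B : set R), measurable B ->
    distribution P (X i) B = distribution P (X j) B.

Definition iid (d : measure_display) (T : measurableType d) (R : realType)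
    (P : probability T R) (X : nat -> {RV P >-> R}) : Prop :=
  mutually_independent X /\ identically_distributed X.

(* The distribution function of v^T (eps_t, ..., eps_{t+1-m})^T. *)
Definition lincomb_cdf (d : measure_display) (T : measurableType d)
    (R : realType) (P : probability T R) (eps : nat -> {RV P >-> R})
    (t m : nat) (v : 'rV[R]_m) (s : R) : \bar R :=
  cdf (\sum_(i < m) scale_mfun (v ord0 i) (eps (t - i)%N)
       : {RV P >-> R}) s.

Lemma lincomb_cdfE (d : measure_display) (T : measurableType d)
    (R : realType) (P : probability T R) (eps : nat -> {RV P >-> R})
    (t m : nat) (v : 'rV[R]_m) (s : R) :
  lincomb_cdf eps t v s =
  P [set w | \sum_(i < m) v ord0 i * eps (t - i)%N w <= s].
Proof.
rewrite /lincomb_cdf /cdf /distribution /pushforward; congr (P _).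
apply/seteqP; split => w /=; rewrite in_itv/= mfun_sum;
  by under eq_bigr do rewrite /= mulrC.
Qed.

Definition is_argmin (R : realType) (U : Type) (D : set U) (f : U -> R)
  (x : U) : Prop := D x /\ forall z, D z -> f x <= f z.

(* The sigma-algebra generated by y_1, ..., y_n. *)
Definition past (T : Type) (R : realType) (y : nat -> T -> R) (n : nat) :
    set (set T) :=
  <<s [set A | exists t (B : set R),
         [/\ (1 <= t <= n)%N, measurable B & A = y t @^-1` B]] >>.

(* etahat is a least squares estimator of the parameter over Pi: for every
   n >= 1, etahat n minimises the sum of squares along every sample path and is
   a measurable function of the observations y_1, ..., y_n.  The minimiser need
   not be unique; any such selection is allowed. *)
Definition least_squares_estimator (T : Type) (R : realType) (p1 p2 : nat)
    (Pi : set 'rV[R]_(p1 + p2)) (y : nat -> T -> R)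
    (etahat : nat -> T -> 'rV[R]_(p1 + p2)) : Prop :=
  forall n, (0 < n)%N ->
    (forall w, is_argmin Pi
       (fun eta => \sum_(1 <= t < n.+1) (y t w - arma_g eta (y ^~ w) t) ^+ 2)
       (etahat n w)) /\
    (forall (i : 'I_(p1 + p2)) (B : set R), measurable B ->
       past y n ((fun w => etahat n w ord0 i) @^-1` B)).

(* Main.v *)
Require Import Defs.
From HB Require Import structures.
From mathcomp Require Import all_boot all_order all_algebra.
From mathcomp Require Import complex.
From mathcomp Require Import all_classical all_reals all_analysis.
From mathcomp Require Import measurable_realfun.
From mathcomp Require Import ring lra zify.
Set Implicit Arguments.
Unset Strict Implicit.
Unset Printing Implicit Defensive.
Import Order.TTheory GRing.Theory Num.Theory.
Import numFieldNormedType.Exports.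
Local Open Scope classical_set_scope.
Local Open Scope ring_scope.

(** Write theta = eta - eta0 and treat sequences as formal power series.  The
    residual eps_t(eta) is eps_t + (d * eps)_t with
    d = N(theta) / (A_{1,eta0} A_{2,eta}), where
    N(theta) = A_{1,eta} A_{2,eta0} - A_{1,eta0} A_{2,eta} is linear in theta,
    and injective because A_{1,eta0} and A_{2,eta0} are coprime.  Over the
    compact set Pi the coefficients d_m are O(|theta| rho^m), and they agree with
    the linear filter f_theta = N(theta) / (A_{1,eta0} A_{2,eta0}) up to
    O(|theta|^2 rho^m).  So the sum of squares is, up to cubic terms, a quadratic
    form in theta whose random part only involves the sample autocovariances of
    eps; their deviations are collected in one weighted sum K with bounded fourth
    moment.

    If K <= tau sqrt n, comparing the least squares estimator with the minimiser
    theta* of the quadratic form gives n |theta^ - theta*|^2 = O(K^3 / sqrt n).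
    If K > tau sqrt n, the boundedness of Pi is enough, since 1 can be traded for
    powers of K / (tau sqrt n); no negative moment of the information matrix is
    needed.  Either way the prediction errors of theta^ and theta*, scaled by
    sqrt n, differ in L^2 by O(n^{-1/4}).

    The error of theta* is X^T Phi^-1 M with X the gradient at time n+1 and M the
    score of the first n observations.  Keeping in X the last l innovations and in
    M only the earlier ones makes them independent, at L^2 cost O(l^{-1/2}) when
    l^2 <= n, and the second moment becomes
    sigma^2 tr(Phi^-1 Phi Phi^-1 Phi) = (p1 + p2) sigma^2. *)

(** * Formal power series and geometric decay *)

(** The comparison of the two estimators is deterministic: it holds path by path, with constants
    free of n and of the path, and probability enters only through E(K^3 Z^2), where Z is the
    weighted size of the past innovations. The weights rho^i rho^j in K let it dominate the
    deviation of the quadratic form for all geometrically decaying filters at once, so no supremum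
    over Pi and no maximal inequality is needed. Eighth moments arise twice: the fourth moment of K
    involves (eps_s eps_t)^4, and E(K^3 Z^2) is split by K^3 Z^2 <= K^4 + Z^8. Because the estimator
    is a function of the past, the cross term with eps_{n+1} vanishes and only n times the mean
    square prediction error remains. The case sigma = 0 is split off, since the quadratic form then
    degenerates. *)

Definition fps (R : Type) : Type := nat -> R.

(** Only the additive structure of functions is inherited; the product will be convolution instead
    of the pointwise one. *)
HB.instance Definition _ (R : nzRingType) := GRing.Zmodule.on (fps R).

Section FpsRing.
Variable R : comNzRingType.
Implicit Types a b c : fps R.

Definition fps1 : fps R := fun t => (t == 0%N)%:R.
Definition fpsM a b : fps R := fun t => \sum_(i < t.+1) a i * b (t - i)%N.

(** Truncation to polynomials lets the ring laws of series be read off from those of [{poly R}]. *)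
Lemma fpsM_poly a b n t : (t < n)%N ->
  fpsM a b t = ((\poly_(i < n) a i) * (\poly_(i < n) b i))`_t.
Proof.
move=> tn; rewrite coefM; apply: eq_bigr => i _.
rewrite !coef_poly (leq_ltn_trans _ tn) ?leq_ord//.
by rewrite (leq_ltn_trans _ tn) ?leq_subr.
Qed.

Lemma fpsMC : commutative fpsM.
Proof.
by move=> a b; apply/funext => t; rewrite !(@fpsM_poly _ _ t.+1)// mulrC.
Qed.

Lemma fpsMA : associative fpsM.
Proof.
move=> a b c; apply/funext => t; transitivity
  (\poly_(i < t.+1) a i * (\poly_(i < t.+1) b i * \poly_(i < t.+1) c i))`_t.
- rewrite coefM; apply: eq_bigr => i _; rewrite coef_poly ltn_ord.
  by rewrite -fpsM_poly// ltnS leq_subr.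
- rewrite mulrA coefM; apply: eq_bigr => i _.
  by rewrite coef_poly ltnS leq_subr -fpsM_poly.
Qed.

Lemma fps1M : left_id fps1 fpsM.
Proof.
move=> a; apply/funext => t; rewrite /fpsM big_ord_recl big1 ?addr0.
  by rewrite /fps1 eqxx mul1r subn0.
by move=> i _; rewrite /fps1 mul0r.
Qed.

Lemma fpsMDl : left_distributive fpsM +%R.
Proof.
move=> a b c; apply/funext => t; rewrite /fpsM/= [RHS]/GRing.add/= -big_split/=.
by apply: eq_bigr => i _; rewrite -mulrDl.
Qed.

Lemma fps1_neq0 : fps1 != 0.
Proof. by apply/eqP => /(congr1 (@^~ 0%N))/eqP; rewrite /fps1 eqxx oner_eq0. Qed.

HB.instance Definition _ := GRing.Zmodule_isComNzRing.Build (fps R)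
  fpsMA fpsMC fps1M fpsMDl fps1_neq0.

Lemma fpsME a b t : (a * b) t = \sum_(i < t.+1) a i * b (t - i)%N.
Proof. by []. Qed.
Lemma fpsDE a b t : (a + b) t = a t + b t. Proof. by []. Qed.
Lemma fpsNE a t : (- a) t = - a t. Proof. by []. Qed.
Lemma fpsBE a b t : (a - b) t = a t - b t. Proof. by []. Qed.
Lemma fps1E t : (1 : fps R) t = (t == 0%N)%:R. Proof. by []. Qed.
Lemma fps0E t : (0 : fps R) t = 0. Proof. by []. Qed.
Lemma fps_sumE I (r : seq I) (Q : pred I) (F : I -> fps R) t :
  (\sum_(i <- r | Q i) F i) t = \sum_(i <- r | Q i) F i t.
Proof. by elim/big_rec2: _ => // i y1 y2 _ <-. Qed.

Definition fps_of_poly (p : {poly R}) : fps R := fun i => p`_i.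

Lemma fps_of_poly_is_zmod_morphism : zmod_morphism fps_of_poly.
Proof. by move=> p q; apply/funext => i; rewrite /fps_of_poly coefB. Qed.
Lemma fps_of_poly_is_monoid_morphism : monoid_morphism fps_of_poly.
Proof.
split; first by apply/funext => i; rewrite /fps_of_poly coef1.
by move=> p q; apply/funext => i; rewrite /fps_of_poly coefM.
Qed.
HB.instance Definition _ := GRing.isZmodMorphism.Build _ _ fps_of_poly
  fps_of_poly_is_zmod_morphism.
HB.instance Definition _ := GRing.isMonoidMorphism.Build _ _ fps_of_poly
  fps_of_poly_is_monoid_morphism.

(* The t-th coefficient of the geometric series of 1 - a only involves the
   first t + 1 powers when a has constant term 1. *)
Definition fps_inv a : fps R := fun t => (\sum_(k < t.+1) (1 - a) ^+ k) t.

Lemma fps_expr_coef_lt a k t : a 0%N = 0 -> (t < k)%N -> (a ^+ k) t = 0.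
Proof.
move=> a0; elim: k t => // k IH t tk; rewrite exprS fpsME big_ord_recl a0 mul0r add0r.
rewrite big1// => i _; rewrite IH ?mulr0//= /bump/= add1n.
by case: t tk i => [|t] tk i; [case: i|rewrite subSS (leq_ltn_trans (leq_subr _ _))].
Qed.

Lemma fps_mul_inv a : a 0%N = 1 -> a * fps_inv a = 1.
Proof.
move=> a0; apply/funext => t.
(* All the coefficients of the inverse up to order t may be computed with the same t + 1 powers,
   since the additional powers vanish at these orders. The geometric sum then telescopes. *)
transitivity ((a * \sum_(k < t.+1) (1 - a) ^+ k) t).
  rewrite !fpsME; apply: eq_bigr => i _; congr (_ * _); rewrite /fps_inv.
  rewrite !fps_sumE -!(big_mkord xpredT (fun k => ((1 - a) ^+ k) _)).
  rewrite [RHS](big_cat_nat (n := (t - i).+1))//= ?ltnS ?leq_subr//.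
  rewrite [X in _ = _ + X]big1_seq ?addr0// => k /[!mem_index_iota]/andP[_ /andP[tk _]].
  by rewrite fps_expr_coef_lt// fpsBE a0 fps1E eqxx subrr.
have -> : a * \sum_(k < t.+1) (1 - a) ^+ k = 1 - (1 - a) ^+ t.+1.
  apply: oppr_inj; rewrite opprB subrX1 -mulNr; congr (_ * _); ring.
by rewrite fpsBE fps_expr_coef_lt ?subr0// fpsBE a0 fps1E eqxx subrr.
Qed.

End FpsRing.

(** * Weighted l1 norms of power series *)

Section WeightedSums.
Variable R : numFieldType.
Implicit Types (a b : fps R) (w : R).

(** A weighted l1 norm, truncated so that it is always finite; a bound uniform in n with w > 1 means
    geometric decay of the coefficients. *)
Definition wsum w n a : R := \sum_(i < n) `|a i| * w ^+ i.

Lemma wsum_ge0 w n a : 0 <= w -> 0 <= wsum w n a.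
Proof. by move=> w0; apply: sumr_ge0 => i _; rewrite mulr_ge0 ?exprn_ge0. Qed.

Lemma wsumS w n a : wsum w n.+1 a = `|a 0%N| + w * wsum w n (fun i => a i.+1).
Proof.
rewrite /wsum big_ord_recl expr0 mulr1 mulr_sumr; congr (_ + _).
by apply: eq_bigr => i _; rewrite /= /bump/= add1n exprS; ring.
Qed.

Lemma wsumD w n a b : 0 <= w -> wsum w n (a + b) <= wsum w n a + wsum w n b.
Proof.
move=> w0; rewrite /wsum -big_split/=; apply: ler_sum => i _.
by rewrite -mulrDl ler_wpM2r ?exprn_ge0// fpsDE ler_normD.
Qed.

Lemma wsumN w n a : wsum w n (- a) = wsum w n a.
Proof. by apply: eq_bigr => i _; rewrite fpsNE normrN. Qed.

Lemma wsum1 w n : 0 <= w -> wsum w n 1 <= 1.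
Proof.
move=> w0; case: n => [|n]; first by rewrite /wsum big_ord0.
rewrite /wsum big_ord_recl big1 => [|i _]; last by rewrite fps1E normr0 mul0r.
by rewrite fps1E eqxx normr1 expr0 mulr1 addr0.
Qed.

Lemma wsum_leq w m n a : 0 <= w -> (m <= n)%N -> wsum w m a <= wsum w n a.
Proof.
move=> w0 mn; rewrite /wsum -!(big_mkord xpredT (fun i => `|a i| * w ^+ i)).
rewrite (big_cat_nat (n := m) (p := n))//= lerDl.
by apply: sumr_ge0 => i _; rewrite mulr_ge0 ?exprn_ge0.
Qed.

Lemma wsum_lew w w' n a : 0 <= w -> w <= w' -> wsum w n a <= wsum w' n a.
Proof.
move=> w0 ww'; apply: ler_sum => i _; rewrite ler_wpM2l//.
by apply: lerXn2r; rewrite ?nnegrE ?(le_trans w0).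
Qed.

(** The pairs (i, j) with i + j < n lie in the square i, j < n, and the omitted terms are
    nonnegative. *)
Lemma conv_sum_le (x y : fps R) n : (forall i, 0 <= x i) -> (forall i, 0 <= y i) ->
  \sum_(t < n) (x * y) t <= (\sum_(i < n) x i) * (\sum_(j < n) y j).
Proof.
move=> x0 y0; rewrite mulr_suml.
under eq_bigr => t _ do rewrite fpsME (big_ord_widen n (fun i => x i * y (t - i)%N))//.
under eq_bigr => t _ do rewrite big_mkcond/=.
rewrite exchange_big/=; apply: ler_sum => i _.
rewrite -big_mkcond/= -mulr_sumr ler_wpM2l//.
rewrite -(big_mkord (fun t => (i < t.+1)%N) (fun t => y (t - i)%N)).
rewrite (big_cat_nat (n := i))//=; last by rewrite ltnW.
rewrite big_nat_cond big_pred0 ?add0r; last first.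
  by move=> t; rewrite ltnS; case: ltngtP; rewrite ?andbF.
rewrite -{1}[i : nat]add0n big_addn.
under eq_bigl do rewrite ltnS leq_addl.
under eq_bigr do rewrite addnK.
rewrite -(big_mkord xpredT y).
rewrite [leRHS](big_cat_nat (n := (n - i)%N))//= ?leq_subr// lerDl.
by apply: sumr_ge0.
Qed.

(** The Banach algebra inequality: it holds because the weight splits as w^t = w^i w^(t - i). *)
Lemma wsumM w n a b : 0 <= w -> wsum w n (a * b) <= wsum w n a * wsum w n b.
Proof.
move=> w0; apply: (le_trans _ (@conv_sum_le (fun i => `|a i| * w ^+ i)
  (fun i => `|b i| * w ^+ i) n _ _)); try by move=> i; rewrite mulr_ge0 ?exprn_ge0.
apply: ler_sum => t _; rewrite !fpsME.
apply: (@le_trans _ _ (\sum_(i < t.+1) `|a i * b (t - i)%N| * w ^+ t)).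
  by rewrite -mulr_suml ler_wpM2r ?exprn_ge0// ler_norm_sum.
apply: ler_sum => i _; rewrite normrM mulrACA -exprD subnKC ?lexx//.
by rewrite -ltnS.
Qed.

Definition weight k : R := 1 + k.+1%:R^-1.
(* One parameter serves as bound and as rate.  The condition gets weaker as k
   grows, so local bounds on Pi become a uniform one by compactness. *)
Definition geo k a := forall n, wsum (weight k) n a <= k%:R.

Lemma weight_gt1 k : 1 < weight k.
Proof. by rewrite ltrDl invr_gt0. Qed.
Lemma weight_ge0 k : 0 <= weight k.
Proof. by rewrite ltW// (lt_trans ltr01)// weight_gt1. Qed.
Lemma weight_le j k : (j <= k)%N -> weight k <= weight j.
Proof. by move=> jk; rewrite lerD2l lef_pV2 ?posrE ?ltr0n// ler_nat ltnS. Qed.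

Lemma geo_le j k a : (j <= k)%N -> geo j a -> geo k a.
Proof.
move=> jk ga n; apply: (@le_trans _ _ j%:R); last by rewrite ler_nat.
by apply: le_trans (ga n); rewrite wsum_lew ?weight_ge0 ?weight_le.
Qed.

(** The new index dominates j and k, which settles the rate, and j * k, which settles the bound. *)
Lemma geoM j k a b : geo j a -> geo k b -> geo (j + k + j * k) (a * b).
Proof.
move=> ga gb n; apply: (le_trans (wsumM _ _ _ (weight_ge0 _))).
have ga' := @geo_le _ (j + k + j * k) _ _ ga.
have gb' := @geo_le _ (j + k + j * k) _ _ gb.
apply: (@le_trans _ _ (j%:R * k%:R)); last by rewrite -natrM ler_nat leq_addl.
apply: ler_pM; rewrite ?wsum_ge0 ?weight_ge0//.
  by apply: le_trans (ga n); rewrite wsum_lew ?weight_ge0 ?weight_le// -addnA leq_addr.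
apply: le_trans (gb n); rewrite wsum_lew ?weight_ge0 ?weight_le//.
by rewrite addnAC leq_addl.
Qed.

Lemma geo1 : geo 1 1.
Proof. by move=> n; rewrite wsum1 ?weight_ge0. Qed.

(** The hypothesis says (1 + [weight k] * k) / |q| <= k, so the bound k reproduces itself when the
    first coefficient is peeled off. *)
Lemma geo_geometric (q : R) k : 0 < `|q| -> 1 <= (`|q| - weight k) * k%:R ->
  geo k (fun i => q ^- i.+1).
Proof.
move=> q0 hk; elim=> [|n IH]; first by rewrite /wsum big_ord0.
rewrite wsumS.
have -> : wsum (weight k) n (fun i => q ^- i.+2) =
    `|q|^-1 * wsum (weight k) n (fun i => q ^- i.+1).
  rewrite /wsum mulr_sumr; apply: eq_bigr => i _.
  by rewrite mulrA !normrV ?unitfE ?expf_neq0 -?normr_gt0// !normrX exprS invfM.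
apply: (@le_trans _ _ (`|q|^-1 * (1 + weight k * k%:R))).
  rewrite mulrDr mulr1 expr1 normrV ?unitfE -?normr_gt0// lerD2l mulrCA.
  by rewrite ler_pM2l ?invr_gt0// ler_wpM2l ?weight_ge0.
rewrite mulrC ler_pdivrMr// -lerBrDr -mulrC -mulrBl//.
Qed.

End WeightedSums.

(** * Inverting polynomials without zeros in the closed unit disc *)

Section Complex.
Variable R : realType.
Implicit Types (z : R[i]) (p : {poly R}).

Lemma real_natr_bound (x : R) : exists k : nat, x <= k%:R.
Proof.
exists (Num.truncn `|x|).+1; apply: (le_trans (ler_norm _)).
by apply: ltW; rewrite truncnS_gt.
Qed.

Lemma complex_natr_bound z : exists k : nat, `|z| <= k%:R.
Proof.
have [k hk] := real_natr_bound (complex.Re `|z|).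
exists k; rewrite -(RRe_real (normr_real z)).
by rewrite -(rmorph_nat (real_complex R)) lecR.
Qed.

Lemma geo_inv_XsubC z : 1 < `|z| ->
  exists k (g : fps R[i]), geo k g /\ fps_of_poly ('X - z%:P) * g = 1.
Proof.
move=> z1; have d0 : 0 < `|z| - 1 by rewrite subr_gt0.
(* Half of the gap |z| - 1 absorbs 1 / (k + 1), the excess of the weight over 1; the other half,
   multiplied by k, still reaches 1. *)
have [k hk] := complex_natr_bound (2%:R / (`|z| - 1)).
have z0 : 0 < `|z| by rewrite (lt_trans ltr01).
have zn0 : z != 0 by rewrite -normr_gt0.
have hk' : 2%:R / (`|z| - 1) <= k%:R.
  by apply: le_trans hk; rewrite real_ler_norm// ger0_real// ltW// divr_gt0.
have k0 : (0 < k)%N.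
  by rewrite -(@ltr0n R[i]) (lt_le_trans _ hk')// divr_gt0.
exists k, (- (fun i => z ^- i.+1) : fps _); split.
  move=> n; rewrite wsumN; move: n; apply: geo_geometric => //.
  have ik : k.+1%:R^-1 <= (`|z| - 1) / 2%:R.
    rewrite -[leRHS]invrK lef_pV2 ?posrE ?ltr0n ?invr_gt0 ?divr_gt0//.
    by rewrite invf_div (le_trans hk')// ler_nat.
  apply: (@le_trans _ _ ((`|z| - 1) / 2%:R * k%:R)).
    by rewrite mulrC -ler_pdivrMr ?divr_gt0// mul1r invf_div.
  rewrite ler_wpM2r// /weight opprD addrA lerBrDr -lerBrDl.
  by apply: (le_trans ik); rewrite [X in _ <= X - _]splitr addrK.
apply/funext => t; rewrite fpsME.
case: t => [|t].
  rewrite big_ord_recl big_ord0 addr0 /fps_of_poly coefB coefX coefC/= sub0r.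
  by rewrite fpsNE mulrNN expr1 mulfV.
rewrite 2!big_ord_recl big1 ?addr0; last first.
  move=> i _; rewrite /fps_of_poly coefB coefX coefC/=.
  by rewrite subr0 mul0r.
rewrite /fps_of_poly !coefB !coefX !coefC/= sub0r subr0 mul1r !fpsNE fps1E/=.
rewrite /bump/= subn0 subn1/= mulrNN [z ^+ t.+2]exprS invfM mulrA mulfV// mul1r.
by rewrite subrr.
Qed.

Lemma geo_inv_prod_XsubC (s : seq R[i]) : all (fun z => 1 < `|z|) s ->
  exists k (g : fps R[i]), geo k g /\
    fps_of_poly (\prod_(z <- s) ('X - z%:P)) * g = 1.
Proof.
elim: s => [_|z s IH /=/andP[z1 /IH[k [g [gk gs]]]]].
  by exists 1%N, 1; rewrite big_nil rmorph1 mulr1; split=> //; exact: geo1.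
have [j [h [hj hz]]] := geo_inv_XsubC z1.
exists (j + k + j * k)%N, (h * g); split; first exact: geoM.
by rewrite big_cons rmorphM mulrACA hz gs mulr1.
Qed.

(** Over [R[i]] the polynomial splits into linear factors with roots outside the closed disc, each
    inverted by a geometric series. Uniqueness of the inverse identifies the product with the
    complexified real series, and moduli are preserved. *)
Lemma geo_inv_poly p : p`_0 = 1 ->
  (forall z, `|z| <= 1 -> (map_poly (real_complex R) p).[z] <> 0) ->
  exists k, geo k (fps_inv (fps_of_poly p)).
Proof.
move=> p0 proots; set q := map_poly _ p in proots.
have [s qs] := closed_field_poly_normal q.
have s1 : all (fun z => 1 < `|z|) s.
  apply/allP => z zs; rewrite real_ltNge ?normr_real//; apply/negP => z1.
  apply: (proots z z1); apply/eqP; rewrite -[_ == _]/(root q z) qs.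
  by rewrite rootZ ?root_prod_XsubC// lead_coef_eq0 map_poly_eq0; apply: contra_eq_neq p0 => ->; rewrite coef0 eq_sym oner_eq0.
have [k [g [gk gs]]] := geo_inv_prod_XsubC s1.
set c := lead_coef q in qs.
have c0 : c != 0.
  by rewrite lead_coef_eq0 map_poly_eq0; apply: contra_eq_neq p0 => ->; rewrite coef0 eq_sym oner_eq0.
have [m hm] := complex_natr_bound c^-1.
have gq : fps_of_poly q * (fps_of_poly (c^-1)%:P * g) = 1.
  have qc : q * (c^-1)%:P = \prod_(z <- s) ('X - z%:P).
    by rewrite {1}qs mulrC mul_polyC scalerA mulVf// scale1r.
  by rewrite mulrA -rmorphM qc.
pose u : fps R[i] := fun i => (fps_inv (fps_of_poly p) i)%:C%C.
have uq : fps_of_poly q * u = 1.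
  apply/funext => t; rewrite fpsME.
  have := congr1 (fun a : fps R => (a t)%:C%C) (fps_mul_inv (a := fps_of_poly p) p0).
  rewrite fpsME rmorph_sum/= fps1E => h.
  transitivity ((1 : fps R) t)%:C%C; last by rewrite fps1E; case: t {h} => //=.
  rewrite -h; apply: eq_bigr => i _; rewrite rmorphM; congr (_ * _).
  by rewrite /fps_of_poly/q coef_map.
have ug : u = fps_of_poly (c^-1)%:P * g.
  by rewrite -[RHS]mulr1 -uq mulrCA mulrA gq mul1r.
have gc : geo m (fps_of_poly (c^-1)%:P).
  move=> n; case: n => [|n]; first by rewrite /wsum big_ord0.
  rewrite /wsum big_ord_recl big1 => [|i _].
    by rewrite expr0 mulr1 addr0 /fps_of_poly coefC.
  by rewrite /fps_of_poly coefC normr0 mul0r.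
have gu := geoM gc gk; rewrite -ug in gu.
exists (m + k + m * k)%N => n.
have := gu n; rewrite -(rmorph_nat (real_complex R)).
suff -> : wsum (weight R[i] (m + k + m * k)) n u =
   (wsum (weight R (m + k + m * k)) n (fps_inv (fps_of_poly p)))%:C%C.
  by rewrite lecR.
rewrite /wsum rmorph_sum; apply: eq_bigr => i _; rewrite rmorphM rmorphXn /u.
rewrite normc_def/= expr0n addr0 sqrtr_sqr.
by rewrite /weight rmorphD rmorph1 fmorphV rmorph_nat.
Qed.

End Complex.

(** * The filters of the ARMA model *)

Section WeightedReal.
Variable R : realType.
Implicit Types (a b : fps R) (w : R).

Lemma wsum_sum w n I (r : seq I) (F : I -> fps R) : 0 <= w ->
  wsum w n (\sum_(i <- r) F i) <= \sum_(i <- r) wsum w n (F i).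
Proof.
move=> w0; elim: r => [|i r IH].
  rewrite !big_nil /wsum big1// => i _.
  by rewrite fps0E normr0 mul0r.
by rewrite !big_cons (le_trans (wsumD _ _ _ w0))// lerD2l.
Qed.

Lemma wsum_lag w n m (c : 'I_m -> R) B : 1 <= w -> (forall j, `|c j| <= B) ->
  wsum w n (fps_of_poly (\sum_(j < m) c j *: 'X^(j.+1))) <= m%:R * w ^+ m * B.
Proof.
move=> w1 cB; have w0 : 0 <= w by rewrite (le_trans ler01).
rewrite rmorph_sum/=; apply: (le_trans (wsum_sum _ _ _ w0)).
have -> : m%:R * w ^+ m * B = \sum_(j < m) (w ^+ m * B).
  by rewrite sumr_const card_ord -[RHS]mulr_natl mulrA.
apply: ler_sum => j _; apply: (@le_trans _ _ (w ^+ j.+1 * `|c j|)); last first.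
  by apply: ler_pM; rewrite ?exprn_ge0// ler_weXn2l.
rewrite /wsum (eq_bigr (fun i : 'I_n => (nat_of_ord i == j.+1)%:R * (w ^+ j.+1 * `|c j|))); last first.
  move=> i _; rewrite /fps_of_poly coefZ coefXn.
  by case: eqP => [->|_]; rewrite ?mulr1 ?mul1r 1?mulrC// mulr0 normr0 mulr0 mul0r.
rewrite -mulr_suml ler_piMl ?mulr_ge0 ?exprn_ge0//.
have [jn|jn] := ltnP j.+1 n.
  rewrite (bigD1 (Ordinal jn))//= eqxx big1 ?addr0// => i /eqP ij.
  by case: eqP => // h; case: ij; apply: val_inj.
by rewrite big1// => i _; case: eqP => // h; move: jn; rewrite -h leqNgt ltn_ord.
Qed.

Lemma wsum_coef w n a m : 0 < w -> (m < n)%N -> `|a m| * w ^+ m <= wsum w n a.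
Proof.
move=> w0 mn; rewrite /wsum (bigD1 (Ordinal mn))//= lerDl.
by apply: sumr_ge0 => i _; rewrite mulr_ge0 ?exprn_ge0// ltW.
Qed.

(** By the resolvent identity b^-1 = a^-1 + a^-1 (a - b) b^-1, the truncated norm x of b^-1
    satisfies x <= k + x / 2; being finite, x can be absorbed on the left. *)
Lemma geo_inv_perturb k a b : a 0%N = 1 -> b 0%N = 1 -> geo k (fps_inv a) ->
  (forall n, wsum (weight R k) n (a - b) * (2 * k%:R) <= 1) ->
  geo (2 * k) (fps_inv b).
Proof.
move=> a0 b0 ga hab n.
apply: (@le_trans _ _ (wsum (weight R k) n (fps_inv b))).
  by apply: wsum_lew; rewrite ?weight_ge0// weight_le// leq_pmull.
set x := wsum _ n (fps_inv b).
have w0 : 0 <= weight R k := weight_ge0 _ k.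
have x0 : 0 <= x by apply: wsum_ge0.
have xe : x <= k%:R + k%:R * (wsum (weight R k) n (a - b) * x).
  rewrite {1}/x.
  have -> : fps_inv b = fps_inv a + fps_inv a * ((a - b) * fps_inv b).
    have ia := fps_mul_inv a0; have ib := fps_mul_inv b0.
    transitivity (fps_inv b * (a * fps_inv a)); first by rewrite ia mulr1.
    by rewrite -[in X in _ = X + _](mulr1 (fps_inv a)) -ib; ring.
  apply: (le_trans (wsumD _ _ _ w0)); apply: lerD; first exact: ga.
  apply: (le_trans (wsumM _ _ _ w0)); apply: ler_pM; rewrite ?wsum_ge0//.
  exact: wsumM.
have := hab n; set y := wsum _ n (a - b) in xe *; rewrite natrM => hy.
have : x * (y * (2 * k%:R)) <= x by rewrite ler_piMr.
by lra.
Qed.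

End WeightedReal.

Section Arma.
Variables (R : realType) (p1 p2 : nat).
Implicit Types eta theta : 'rV[R]_(p1 + p2).

Definition lag1 theta : {poly R} := \sum_(j < p1) alpha theta j *: 'X^(j.+1).
Definition lag2 theta : {poly R} := \sum_(j < p2) beta theta j *: 'X^(j.+1).

Lemma lag1_linear : linear lag1.
Proof.
move=> c u v; rewrite /lag1 scaler_sumr -big_split/=; apply: eq_bigr => j _.
by rewrite /alpha !mxE scalerDl scalerA.
Qed.
Lemma lag2_linear : linear lag2.
Proof.
move=> c u v; rewrite /lag2 scaler_sumr -big_split/=; apply: eq_bigr => j _.
by rewrite /beta !mxE scalerDl scalerA.
Qed.
HB.instance Definition _ := GRing.isLinear.Build _ _ _ _ lag1 lag1_linear.
HB.instance Definition _ := GRing.isLinear.Build _ _ _ _ lag2 lag2_linear.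

Definition arS eta : fps R := fps_of_poly (ar_poly eta).
Definition maS eta : fps R := fps_of_poly (ma_poly eta).

Lemma ar_polyE eta : ar_poly eta = 1 - lag1 eta. Proof. by []. Qed.
Lemma ma_polyE eta : ma_poly eta = 1 - lag2 eta. Proof. by []. Qed.

Lemma coef0_lag1 theta : (lag1 theta)`_0 = 0.
Proof. by rewrite coef_sum big1// => j _; rewrite coefZ coefXn mulr0. Qed.
Lemma coef0_lag2 theta : (lag2 theta)`_0 = 0.
Proof. by rewrite coef_sum big1// => j _; rewrite coefZ coefXn mulr0. Qed.
Lemma coef0_ar eta : (ar_poly eta)`_0 = 1.
Proof. by rewrite coefB coef1 coef0_lag1 subr0. Qed.
Lemma coef0_ma eta : (ma_poly eta)`_0 = 1.
Proof. by rewrite coefB coef1 coef0_lag2 subr0. Qed.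

Lemma ler_mx_norm_coef theta i : `|theta ord0 i| <= `|theta|.
Proof. by rewrite [leRHS]/Num.norm/= mx_normrE (le_bigmax _ (fun ij => `|theta ij.1 ij.2|) (ord0, i)). Qed.

Lemma wsum_lag1 w n theta : 1 <= w ->
  wsum w n (fps_of_poly (lag1 theta)) <= p1%:R * w ^+ p1 * `|theta|.
Proof. by move=> w1; apply: wsum_lag => // j; exact: ler_mx_norm_coef. Qed.
Lemma wsum_lag2 w n theta : 1 <= w ->
  wsum w n (fps_of_poly (lag2 theta)) <= p2%:R * w ^+ p2 * `|theta|.
Proof. by move=> w1; apply: wsum_lag => // j; exact: ler_mx_norm_coef. Qed.

(** Near each point of Pi one index works by perturbation, and so does every larger one;
    compactness, in its near-covering form along [\oo], yields a common index. *)
Lemma geo_inv_ma_uniform (Pi : set 'rV[R]_(p1 + p2)) : compact Pi ->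
  (forall eta, Pi eta -> arma_admissible eta) ->
  exists k, forall eta, Pi eta -> geo k (fps_inv (maS eta)).
Proof.
move=> /compact_near_coveringP cPi adm.
have := cPi nat \oo (fun k eta => geo k (fps_inv (maS eta))) _.
case=> [eta /adm[roots _ _]|N _ hN]; last first.
  by exists N => eta; apply: hN => /=.
have [k hk] := geo_inv_poly (coef0_ma eta) (fun z hz => (roots z hz).2).
pose w : R := weight R k.
have w1 : 1 <= w by rewrite ltW// weight_gt1.
(* The radius [B^-1] makes the perturbation condition hold; the added 1 keeps B positive even if p2
   = 0. *)
pose B : R := p2%:R * w ^+ p2 * (2 * k%:R) + 1.
have B0 : 0 < B.
  by rewrite ltr_wpDl// !mulr_ge0// exprn_ge0// (le_trans ler01).
exists (ball eta B^-1, [set j | (2 * k <= j)%N]).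
  split; first by apply: nbhsx_ballx; rewrite invr_gt0.
  by exists (2 * k)%N.
move=> [eta' j]/= [hb kj]; apply: (geo_le kj).
apply: geo_inv_perturb hk _ => [||n]; [exact: coef0_ma|exact: coef0_ma|].
have -> : maS eta - maS eta' = fps_of_poly (lag2 (eta' - eta)).
  by rewrite -rmorphB; congr fps_of_poly; rewrite !ma_polyE raddfB/=; ring.
have : `|eta' - eta| < B^-1 by rewrite distrC; move: hb; rewrite -ball_normE.
move=> /ltW hd; apply: (@le_trans _ _ (p2%:R * w ^+ p2 * B^-1 * (2 * k%:R))).
  rewrite ler_wpM2r ?mulr_ge0//; apply: (le_trans (wsum_lag2 _ _ w1)).
  by rewrite ler_wpM2l// mulr_ge0// exprn_ge0// (le_trans ler01).
by rewrite mulrAC ler_pdivrMr// mul1r /B lerDl.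
Qed.

End Arma.

(** * The linear map N and its injectivity *)

Section Sylvester.
Variables (R : realType) (p1 p2 : nat).
Implicit Types eta theta : 'rV[R]_(p1 + p2).

Lemma coef_lag m (c : 'I_m -> R) (j : 'I_m) :
  (\sum_(i < m) c i *: 'X^(i.+1) : {poly R})`_(j.+1) = c j.
Proof.
rewrite coef_sum (bigD1 j)//= coefZ coefXn eqxx mulr1 big1 ?addr0// => i /eqP ij.
rewrite coefZ coefXn; case: eqP => [[h]|_]; last by rewrite mulr0.
by case: ij; apply: val_inj.
Qed.

Lemma size_lag m (c : 'I_m -> R) :
  (size (\sum_(i < m) c i *: 'X^(i.+1) : {poly R})%R <= m.+1)%N.
Proof.
apply: (leq_trans (poly.size_sum _ _ _)); apply/bigmax_leqP => i _.
by rewrite (leq_trans (size_scale_leq _ _))// size_polyXn ltnS.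
Qed.

Variable eta0 : 'rV[R]_(p1 + p2).

(** The N(theta) of the header after cancellation (see [sylvE]), so that linearity is visible. Up to
    sign and a shift its matrix is the Sylvester matrix of the two polynomials. *)
Definition sylv theta : {poly R} :=
  ar_poly eta0 * lag2 theta - ma_poly eta0 * lag1 theta.

Lemma sylv_linear : linear sylv.
Proof. by move=> c u v; rewrite /sylv !linearP/= -!mul_polyC; ring. Qed.
HB.instance Definition _ := GRing.isLinear.Build _ _ _ _ sylv sylv_linear.

Lemma coef0_sylv theta : (sylv theta)`_0 = 0.
Proof. by rewrite coefB !coef0M coef0_lag1 coef0_lag2 !mulr0 subr0. Qed.

Lemma sylvE eta : ar_poly eta * ma_poly eta0 - ar_poly eta0 * ma_poly eta =
  sylv (eta - eta0).
Proof. by rewrite /sylv !ar_polyE !ma_polyE !raddfB/=; ring. Qed.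

Hypothesis adm : arma_admissible eta0.

Lemma coprime_ar_ma : coprimep (ar_poly eta0) (ma_poly eta0).
Proof.
case: adm => _ hcop _; rewrite -(coprimep_map (real_complex R)).
apply: Pdiv.ClosedField.root_coprimep => z /eqP hz; apply/eqP => hz'.
exact: (hcop z).
Qed.

(** If A1 lag2 = A2 lag1, coprimality yields a common cofactor h with lag1 = h A1 and lag2 = h A2;
    it remains to exclude h != 0 by degrees. *)
Lemma sylv_inj theta : sylv theta = 0 -> theta = 0.
Proof.
move=> /eqP; rewrite subr_eq0 => /eqP hab.
have A0 : ar_poly eta0 != 0.
  by apply: contra_eq_neq (coef0_ar eta0) => ->; rewrite coef0 eq_sym oner_eq0.
have B0 : ma_poly eta0 != 0.
  by apply: contra_eq_neq (coef0_ma eta0) => ->; rewrite coef0 eq_sym oner_eq0.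
have : ar_poly eta0 %| ma_poly eta0 * lag1 theta by rewrite -hab dvdp_mulr.
rewrite Gauss_dvdpr ?coprime_ar_ma// => /dvdpP[h hh].
have hb : lag2 theta = h * ma_poly eta0.
  by apply: (mulfI A0); rewrite hab hh; ring.
have h0 : h`_0 = 0.
  by have := coef0_lag1 theta; rewrite hh coef0M coef0_ar mulr1.
have [hz|hn0] := eqVneq h 0.
  apply/rowP => i; rewrite mxE -(splitK i); case: (fintype.split i) => j /=.
    have := coef_lag (alpha theta) j.
    by rewrite -/(lag1 theta) hh hz mul0r coef0 => /esym.
  have := coef_lag (beta theta) j.
  by rewrite -/(lag2 theta) hb hz mul0r coef0 => /esym.
(* A nonzero h without constant term has degree at least 1. This forces deg A1 < p1 and deg A2 < p2,
   so both top coefficients vanish, against the third clause of [arma_admissible]. *)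
have sh : (1 < size h)%N.
  rewrite ltnNge; apply/negP => /size1_polyC hc.
  by move: hn0; rewrite hc h0 eqxx.
have s1 : (size (ar_poly eta0) <= p1)%N.
  have := size_lag (alpha theta); rewrite -/(lag1 theta) hh size_mul//.
  by case: (size h) sh => [|[|k]]//= _; rewrite !addSn ltnS; apply: leq_trans; rewrite leq_addl.
have s2 : (size (ma_poly eta0) <= p2)%N.
  have := size_lag (beta theta); rewrite -/(lag2 theta) hb size_mul//.
  by case: (size h) sh => [|[|k]]//= _; rewrite !addSn ltnS; apply: leq_trans; rewrite leq_addl.
case: adm => _ _; rewrite !big1 ?addr0 ?ltxx// => j /eqP jp.
  have : (ma_poly eta0)`_(j.+1) = 0 by rewrite nth_default// jp.
  rewrite ma_polyE coefB coef1/= coef_lag sub0r => /eqP.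
  by rewrite oppr_eq0 => /eqP ->; rewrite normr0.
have : (ar_poly eta0)`_(j.+1) = 0 by rewrite nth_default// jp.
rewrite ar_polyE coefB coef1/= coef_lag sub0r => /eqP.
by rewrite oppr_eq0 => /eqP ->; rewrite normr0.
Qed.

Lemma size_sylv theta : (size (sylv theta) <= (p1 + p2).+1)%N.
Proof.
apply: (leq_trans (size_polyD _ _)); rewrite size_polyN geq_max.
have s1 eta : (size (ar_poly eta) <= p1.+1)%N.
  rewrite ar_polyE (leq_trans (size_polyD _ _))// size_polyN geq_max size_poly1.
  exact: size_lag.
have s2 eta : (size (ma_poly eta) <= p2.+1)%N.
  rewrite ma_polyE (leq_trans (size_polyD _ _))// size_polyN geq_max size_poly1.
  exact: size_lag.
apply/andP; split; apply: (leq_trans (size_polyMleq _ _)).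
  apply: (@leq_trans (p1.+1 + p2.+1).-1); last by rewrite addSn addnS.
  by rewrite -!subn1 leq_sub2r// leq_add// size_lag.
apply: (@leq_trans (p2.+1 + p1.+1).-1); last by rewrite addSn addnS addnC.
by rewrite -!subn1 leq_sub2r// leq_add// size_lag.
Qed.

(** Injectivity provides B with [A *m B = 1], which recovers theta from the coefficients; the
    constant bounds the entries of B, and the added 1 makes it positive. *)
Lemma sylv_lower_bound : exists2 C : R, 0 < C & forall theta X,
  (forall m, (m < (p1 + p2).+1)%N -> `|(sylv theta)`_m| <= X) ->
  `|theta| <= C * X.
Proof.
pose A : 'M[R]_(p1 + p2, (p1 + p2).+1) := \matrix_(i, k) (sylv (delta_mx 0 i))`_k.
have Acoef theta k : (theta *m A) 0 k = (sylv theta)`_k.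
  rewrite mxE {2}(row_sum_delta theta) linear_sum/= coef_sum.
  by apply: eq_bigr => i _; rewrite linearZ/= coefZ mxE.
have /row_freeP[B AB] : row_free A.
  apply: inj_row_free => v vA; apply: sylv_inj; apply/polyP => k; rewrite coef0.
  have [kp|kp] := ltnP k (p1 + p2).+1.
    by rewrite -[k]/(val (Ordinal kp)) -Acoef vA mxE.
  by rewrite nth_default// (leq_trans (size_sylv v)).
exists ((p1 + p2).+1%:R * `|B| + 1) => [|theta X hX].
  by rewrite ltr_wpDl// mulr_ge0.
have X0 : 0 <= X by apply: (le_trans _ (hX 0%N _)).
rewrite [leLHS]/Num.norm/= mx_normrE; apply: bigmax_le => [|[i j] _]/=.
  by rewrite mulr_ge0// addr_ge0// mulr_ge0.
rewrite (ord1 i) -[theta]mulmx1 -AB mulmxA mxE.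
apply: (le_trans (ler_norm_sum _ _ _)).
apply: (@le_trans _ _ (\sum_(k < (p1 + p2).+1) (`|B| * X))).
  apply: ler_sum => k _; rewrite Acoef normrM mulrC; apply: ler_pM => //.
    by rewrite [leRHS]/Num.norm/= mx_normrE (le_bigmax _ (fun ij => `|B ij.1 ij.2|) (k, j)).
  exact: hX.
by rewrite sumr_const card_ord -[leLHS]mulr_natl mulrA mulrDl mul1r lerDl.
Qed.

End Sylvester.

Section Filter.
Variables (R : realType) (p1 p2 : nat).
Implicit Types eta theta : 'rV[R]_(p1 + p2).

(** For t < k truncated subtraction gives [x 0], which is why this value has to vanish. *)
Lemma fps_shift (x : fps R) k t : x 0%N = 0 ->
  (fps_of_poly 'X^k * x) t = x (t - k)%N.
Proof.
move=> x0; rewrite fpsME; under eq_bigr do rewrite /fps_of_poly coefXn.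
have [kt|tk] := ltnP k t.+1.
  rewrite (bigD1 (Ordinal kt))//= eqxx mul1r big1 ?addr0// => i /eqP ik.
  by case: eqP => [h|_]; [case: ik; apply: val_inj|rewrite mul0r].
rewrite big1; first by rewrite (eqP (ltnW tk : (_ - _ == 0)%N)).
move=> i _; case: eqP => [h|_]; last by rewrite mul0r.
by have := ltn_ord i; rewrite h ltnNge tk.
Qed.

Lemma fps_lag (x : fps R) m (c : 'I_m -> R) t : x 0%N = 0 ->
  (fps_of_poly (\sum_(j < m) c j *: 'X^(j.+1)) * x) t =
  \sum_(j < m) c j * x (t - j.+1)%N.
Proof.
move=> x0; rewrite rmorph_sum mulr_suml fps_sumE; apply: eq_bigr => j _ /=.
rewrite -fps_shift// !fpsME mulr_sumr; apply: eq_bigr => i _.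
by rewrite /fps_of_poly coefZ mulrA.
Qed.

Lemma arma_regE eta (y e : fps R) t : y 0%N = 0 -> e 0%N = 0 ->
  arma_reg eta y e t =
  (fps_of_poly (lag1 eta) * y - fps_of_poly (lag2 eta) * e) t.
Proof. by move=> y0 e0; rewrite fpsBE !fps_lag. Qed.

(* The series d and, up to linearity in theta, f_theta of the header. *)
Definition dser eta0 eta : fps R :=
  fps_of_poly (sylv eta0 (eta - eta0)) *
  (fps_inv (arS eta0) * fps_inv (maS eta)).

Definition fser eta0 (i : 'I_(p1 + p2)) : fps R :=
  fps_of_poly (sylv eta0 (delta_mx 0 i)) *
  (fps_inv (arS eta0) * fps_inv (maS eta0)).

Lemma arS_inv eta : arS eta * fps_inv (arS eta) = 1.
Proof. by apply: fps_mul_inv; exact: coef0_ar. Qed.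
Lemma maS_inv eta : maS eta * fps_inv (maS eta) = 1.
Proof. by apply: fps_mul_inv; exact: coef0_ma. Qed.

Lemma fser_sum eta0 theta m : \sum_i theta ord0 i * fser eta0 i m =
  (fps_of_poly (sylv eta0 theta) *
   (fps_inv (arS eta0) * fps_inv (maS eta0))) m.
Proof.
rewrite [in RHS](row_sum_delta theta) linear_sum rmorph_sum mulr_suml fps_sumE.
apply: eq_bigr => i _ /=; rewrite linearZ/= !fpsME mulr_sumr.
by apply: eq_bigr => j _; rewrite /fps_of_poly coefZ mulrA.
Qed.

(** As identities of series, A1_eta0 y = A2_eta0 e and A1_eta y = A2_eta r, where r is the residual.
    Eliminating y gives A1_eta0 A2_eta (r - e) = N(eta - eta0) e. *)
Lemma resid_filter eta0 eta (y e : fps R) t : y 0%N = 0 -> e 0%N = 0 ->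
  (forall s, (1 <= s)%N -> y s = arma_reg eta0 y e s + e s) ->
  resid eta y t = e t + (dser eta0 eta * e) t.
Proof.
move=> y0 e0 hy; pose r : fps R := resid eta y.
have r0 : r 0%N = 0 by [].
have reg_rec (zeta : 'rV[R]_(p1 + p2)) (x : fps R) : x 0%N = 0 ->
    (forall s, (1 <= s)%N -> y s = arma_reg zeta y x s + x s) ->
    arS zeta * y = maS zeta * x.
  move=> x0 hx; rewrite /arS /maS ar_polyE ma_polyE !rmorphB !rmorph1 !mulrBl !mul1r.
  apply/funext => s; rewrite !fpsBE.
  have := arma_regE zeta s y0 x0; rewrite fpsBE => hreg.
  suff : y s = arma_reg zeta y x s + x s by rewrite hreg; lra.
  case: s {hreg} => [|s]; last exact: hx.
  rewrite y0 x0 /arma_reg !big1 ?subr0 ?addr0// => j _.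
    by rewrite sub0n x0 mulr0.
  by rewrite sub0n y0 mulr0.
have hy0 := reg_rec eta0 e e0 hy.
have hr : arS eta * y = maS eta * r.
  by apply: reg_rec => // -[//|s _]; rewrite /r residS /arma_g addrC subrK.
suff : r = e + dser eta0 eta * e by move=> /(congr1 (@^~ t)).
have i1 := arS_inv eta0; have i2 := maS_inv eta.
transitivity (e + fps_inv (arS eta0) * fps_inv (maS eta) *
    (arS eta0 * (maS eta * r) - arS eta0 * maS eta * e)).
  transitivity (e + (arS eta0 * fps_inv (arS eta0)) * (maS eta * fps_inv (maS eta)) *
    (r - e)); first by rewrite i1 i2 !mul1r addrC subrK.
  by ring.
rewrite /dser -sylvE rmorphB !rmorphM -/(arS eta) -/(maS eta) -/(arS eta0) -/(maS eta0).
congr (_ + _); rewrite -hr.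
transitivity (fps_inv (arS eta0) * fps_inv (maS eta) *
  (arS eta * (arS eta0 * y) - arS eta0 * maS eta * e)); first by ring.
by rewrite hy0; ring.
Qed.

End Filter.

Section Bounds.
Variables (R : realType) (p1 p2 : nat).
Notation p := (p1 + p2)%N.
Implicit Types eta theta : 'rV[R]_(p1 + p2).

Lemma fpsM_coef_le (a b : fps R) w n D m : 1 <= w -> (m < n)%N ->
  (forall i, (i <= m)%N -> `|b i| <= D) -> `|(a * b) m| <= wsum w n a * D.
Proof.
move=> w1 mn hD; rewrite fpsME; apply: (le_trans (ler_norm_sum _ _ _)).
have D0 : 0 <= D by apply: le_trans (hD 0%N _).
apply: (@le_trans _ _ (wsum w m.+1 a * D)); last first.
  by rewrite ler_wpM2r// wsum_leq// (le_trans ler01).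
rewrite mulr_suml; apply: ler_sum => i _; rewrite normrM; apply: ler_pM => //.
  by rewrite ler_peMr// exprn_ege1.
by rewrite hD// leq_subr.
Qed.

Lemma coef_le_wsum (a : fps R) w B m : 1 < w -> (forall n, wsum w n a <= B) ->
  `|a m| <= B * w^-1 ^+ m.
Proof.
move=> w1 hB; have w0 : 0 < w by rewrite (lt_trans ltr01).
rewrite exprVn ler_pdivlMr ?exprn_gt0//.
exact: (le_trans (wsum_coef (n := m.+1) _ w0 _)).
Qed.

(** The interface to the probabilistic part: besides the representation by filters and their
    vanishing constant terms, these five bounds are all that is retained of the ARMA structure. *)
Theorem arma_filter_bounds (Pi : set 'rV[R]_(p1 + p2)) eta0 :
  compact Pi -> Pi eta0 -> (forall eta, Pi eta -> arma_admissible eta) ->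
  exists C rho kappa : R, [/\ 0 < C, 0 < rho < 1, 0 < kappa &
  [/\ forall eta m, Pi eta -> `|dser eta0 eta m| <= C * `|eta - eta0| * rho ^+ m,
      forall eta m, Pi eta ->
        `|dser eta0 eta m - \sum_i (eta - eta0) ord0 i * fser eta0 i m|
        <= C * `|eta - eta0| ^+ 2 * rho ^+ m,
      forall i m, `|fser eta0 i m| <= C * rho ^+ m,
      forall eta, Pi eta ->
        kappa * `|eta - eta0| ^+ 2 <= \sum_(m < p.+1) dser eta0 eta m ^+ 2
    & forall theta, kappa * `|theta| ^+ 2 <=
        \sum_(m < p.+1) (\sum_i theta ord0 i * fser eta0 i m) ^+ 2 ]].
Proof.
move=> cPi Pi0 adm.
have [k2 hk2] := geo_inv_ma_uniform cPi adm.
have [k1 hk1] := geo_inv_poly (coef0_ar eta0)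
  (fun z hz => (let: And3 h _ _ := adm _ Pi0 in h z hz).1).
pose k := maxn k1 k2; pose w : R := weight R k; pose K : R := k%:R.
have w1 : 1 < w := weight_gt1 _ k.
have w0 : 0 < w by rewrite (lt_trans ltr01).
have w0' := ltW w0; have w1' := ltW w1.
have hi1 n : wsum w n (fps_inv (arS eta0)) <= K.
  exact: (geo_le (leq_maxl k1 k2) hk1).
have hi2 eta n : Pi eta -> wsum w n (fps_inv (maS eta)) <= K.
  by move=> he; exact: (geo_le (leq_maxr k1 k2) (hk2 _ he)).
have K0 : 0 <= K by rewrite ler0n.
pose c : R := p1%:R * w ^+ p1 + p2%:R * w ^+ p2.
have c10 : 0 <= p1%:R * w ^+ p1 by rewrite mulr_ge0// exprn_ge0.
have c20 : 0 <= p2%:R * w ^+ p2 by rewrite mulr_ge0// exprn_ge0.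
have c0 : 0 <= c by rewrite addr_ge0.
have hl1 theta n : wsum w n (fps_of_poly (lag1 theta)) <= c * `|theta|.
  by rewrite (le_trans (wsum_lag1 _ _ w1'))// ler_wpM2r// lerDl.
have hl2 theta n : wsum w n (fps_of_poly (lag2 theta)) <= c * `|theta|.
  by rewrite (le_trans (wsum_lag2 _ _ w1'))// ler_wpM2r// lerDr.
have [M M0 hM] : exists2 M : R, 0 <= M & forall eta, Pi eta -> `|eta| <= M.
  have [N [_ hN]] := compact_bounded cPi.
  exists (`|N| + 1); first by rewrite addr_ge0.
  by move=> eta he; apply: hN he; rewrite (le_lt_trans (ler_norm N))// ltrDl.
pose S := 1 + c * M.
have S1 : 1 <= S by rewrite lerDl mulr_ge0.
have S0 : 0 < S by rewrite (lt_le_trans ltr01).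
have hA1 eta n : Pi eta -> wsum w n (arS eta) <= S.
  move=> /hM he; rewrite /arS ar_polyE rmorphB rmorph1.
  rewrite (le_trans (wsumD _ _ _ w0'))// lerD ?wsum1// wsumN.
  by rewrite (le_trans (hl1 _ _))// ler_wpM2l.
have hA2 eta n : Pi eta -> wsum w n (maS eta) <= S.
  move=> /hM he; rewrite /maS ma_polyE rmorphB rmorph1.
  rewrite (le_trans (wsumD _ _ _ w0'))// lerD ?wsum1// wsumN.
  by rewrite (le_trans (hl2 _ _))// ler_wpM2l.
have hs theta n : wsum w n (fps_of_poly (sylv eta0 theta)) <= 2 * S * c * `|theta|.
  rewrite rmorphB !rmorphM (le_trans (wsumD _ _ _ w0'))// wsumN.
  apply: (@le_trans _ _ (S * (c * `|theta|) + S * (c * `|theta|))); last lra.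
  by apply: lerD; rewrite (le_trans (wsumM _ _ _ w0'))//;
    apply: ler_pM; rewrite ?wsum_ge0 ?hl1 ?hl2//; [exact: hA1|exact: hA2].
have hphi eta n : Pi eta ->
    wsum w n (fps_inv (arS eta0) * fps_inv (maS eta)) <= K * K.
  move=> he; rewrite (le_trans (wsumM _ _ _ w0'))//.
  by apply: ler_pM; rewrite ?wsum_ge0// hi2.
have hd theta eta n : Pi eta -> wsum w n (fps_of_poly (sylv eta0 theta) *
   (fps_inv (arS eta0) * fps_inv (maS eta))) <= 2 * S * c * `|theta| * (K * K).
  move=> he; rewrite (le_trans (wsumM _ _ _ w0'))//.
  by apply: ler_pM; rewrite ?wsum_ge0// hphi.
have [C2 C20 hC2] := sylv_lower_bound (adm _ Pi0).
(* Multiplying g back by A1_eta0 A2_eta recovers N(theta), whose degree is at most p1 + p2. Hence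
   the first p1 + p2 + 1 coefficients of g already control N(theta), and thereby theta. *)
have hlow theta eta : Pi eta -> ((C2 * S ^+ 2) ^+ 2)^-1 * `|theta| ^+ 2 <=
   \sum_(m < p.+1) ((fps_of_poly (sylv eta0 theta) *
   (fps_inv (arS eta0) * fps_inv (maS eta))) m) ^+ 2.
  move=> he; set g := _ * (_ * _); set s := \sum_(_ < _) _.
  have s0 : 0 <= s by apply: sumr_ge0 => i _; exact: sqr_ge0.
  have Eg : fps_of_poly (sylv eta0 theta) = arS eta0 * maS eta * g.
    have i1 := arS_inv eta0; have i2 := maS_inv eta; rewrite /g.
    transitivity ((arS eta0 * fps_inv (arS eta0)) * (maS eta * fps_inv (maS eta)) *
      fps_of_poly (sylv eta0 theta)); first by rewrite i1 i2 !mul1r.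
    ring.
  have hg m : (m < p.+1)%N -> `|(sylv eta0 theta)`_m| <= S ^+ 2 * Num.sqrt s.
    move=> mp; rewrite -[X in `|X|]/(fps_of_poly (sylv eta0 theta) m) Eg.
    apply: (@le_trans _ _ (wsum w p.+1 (arS eta0 * maS eta) * Num.sqrt s)).
      apply: fpsM_coef_le => // i im; rewrite -sqrtr_sqr ler_sqrt//.
      have ip : (i < p.+1)%N by rewrite (leq_ltn_trans im).
      rewrite /s (bigD1 (Ordinal ip))//= lerDl.
      by apply: sumr_ge0 => j _; exact: sqr_ge0.
    rewrite ler_wpM2r ?sqrtr_ge0// (le_trans (wsumM _ _ _ w0'))// expr2.
    by apply: ler_pM; rewrite ?wsum_ge0 ?hA1 ?hA2.
  have := hC2 _ _ hg; rewrite mulrA => h.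
  rewrite ler_pdivrMl ?exprn_gt0 ?mulr_gt0 ?exprn_gt0//.
  rewrite -[X in _ <= _ * X](sqr_sqrtr s0) -exprMn; apply: lerXn2r => //; rewrite nnegrE ?normr_ge0//.
  exact: le_trans (normr_ge0 _) h.
(* Chosen to dominate both the first order constant and the one of the linearisation error. *)
pose Cb : R := 2 * S * c * (K * K) * (1 + K * c) + 1.
have CC : 0 <= 2 * S * c * (K * K) by rewrite !mulr_ge0// ltW.
have h1 : 2 * S * c * (K * K) <= Cb.
  have : 0 <= 2 * S * c * (K * K) * (K * c) by rewrite mulr_ge0// mulr_ge0.
  rewrite /Cb; lra.
have h2 : 2 * S * c * (K * K) * (K * c) <= Cb by rewrite /Cb; lra.
exists Cb, w^-1, ((C2 * S ^+ 2) ^+ 2)^-1; split.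
- by rewrite /Cb ltr_wpDl// mulr_ge0// addr_ge0// mulr_ge0.
- by rewrite invr_gt0 w0 invf_lt1.
- by rewrite invr_gt0 exprn_gt0// mulr_gt0// exprn_gt0.
split.
- move=> eta m he; apply: coef_le_wsum => // n.
  apply: (le_trans (hd _ _ _ he)).
  by rewrite mulrAC ler_wpM2r.
- move=> eta m he; rewrite fser_sum -fpsBE; apply: coef_le_wsum => // n.
  (* The difference of the inverses of A2_eta and A2_eta0 contains the factor A2_eta0 - A2_eta =
     lag2(eta - eta0), which supplies the second power of the norm. *)
  have -> : dser eta0 eta - fps_of_poly (sylv eta0 (eta - eta0)) *
     (fps_inv (arS eta0) * fps_inv (maS eta0)) =
     fps_of_poly (sylv eta0 (eta - eta0)) *
     (fps_inv (arS eta0) * fps_inv (maS eta)) *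
     (fps_inv (maS eta0) * fps_of_poly (lag2 (eta - eta0))).
    have i2 := maS_inv eta; have i20 := maS_inv eta0.
    have -> : fps_of_poly (lag2 (eta - eta0)) = maS eta0 - maS eta.
      by rewrite -rmorphB !ma_polyE raddfB/=; congr fps_of_poly; ring.
    rewrite /dser; set s := fps_of_poly _; set i1 := fps_inv (arS eta0).
    transitivity (s * i1 * (fps_inv (maS eta) * (maS eta0 * fps_inv (maS eta0))
      - fps_inv (maS eta0) * (maS eta * fps_inv (maS eta)))).
      by rewrite i2 i20; ring.
    by ring.
  apply: (le_trans (wsumM _ _ _ w0')).
  apply: (@le_trans _ _ (2 * S * c * `|eta - eta0| * (K * K) * (K * (c * `|eta - eta0|)))).
    apply: ler_pM; rewrite ?wsum_ge0 ?hd// (le_trans (wsumM _ _ _ w0'))//.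
    by apply: ler_pM; rewrite ?wsum_ge0 ?hi2.
  have -> : 2 * S * c * `|eta - eta0| * (K * K) * (K * (c * `|eta - eta0|)) =
    2 * S * c * (K * K) * (K * c) * `|eta - eta0| ^+ 2 by ring.
  by rewrite ler_wpM2r// exprn_ge0.
- move=> i m; apply: coef_le_wsum => // n.
  apply: (le_trans (hd _ _ _ Pi0)).
  apply: le_trans h1; rewrite mulrAC ler_piMr//.
  rewrite [leLHS]/Num.norm/= mx_normrE; apply: bigmax_le => //= -[a b] _ /=.
  by rewrite mxE; case: (_ && _); rewrite ?normr1 ?normr0.
- by move=> eta he; exact: hlow.
- by move=> theta; under eq_bigr do rewrite fser_sum; exact: hlow.
Qed.

End Bounds.

(** * Comparison with a quadratic form *)

Section Forms.
Variables (R : realType) (s2 rho : R).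
Hypotheses (s20 : 0 < s2) (rho0 : 0 < rho) (rho1 : rho < 1).
Implicit Types (e u v : nat -> R) (n m i j t : nat) (U V k : R).

(** If [e 0 = 0], the cut at n loses nothing for t <= n + 1. *)
Definition flt e n u t : R := \sum_(m < n.+1) u m * e (t - m)%N.
(* The centring is the exact mean: the n - i factor accounts for e_t = 0 at
   t <= 0. *)
Definition acov e n i j : R :=
  \sum_(1 <= t < n.+1) e (t - i)%N * e (t - j)%N
  - (i == j)%:R * (s2 * (n - i)%:R).
(* The K of the header. *)
Definition acov_dev e n : R := (Num.sqrt n%:R)^-1 *
  \sum_(i < n.+1) \sum_(j < n.+1) rho ^+ i * rho ^+ j * `|acov e n i j|.
Definition past_size e n : R := \sum_(m < n.+1) rho ^+ m * `|e (n.+1 - m)%N|.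
(** For the innovations this is the mean of [Sf]: e_{t-i} e_{t-j} has nonzero mean only if i = j <
    t, and the lag m is available at n - m of the times t <= n. *)
Definition qf n u v : R := s2 * \sum_(m < n.+1) (n - m)%:R * (u m * v m).
Definition Sf e n u v : R := \sum_(1 <= t < n.+1) flt e n u t * flt e n v t.
Definition dl m : R := (m == 0%N)%:R.

Lemma Sf_qf e n u v : Sf e n u v - qf n u v =
  \sum_(i < n.+1) \sum_(j < n.+1) u i * v j * acov e n i j.
Proof.
rewrite /Sf /flt /acov.
transitivity (\sum_(i < n.+1) \sum_(j < n.+1)
   u i * v j * (\sum_(1 <= t < n.+1) e (t - i)%N * e (t - j)%N) - qf n u v).
  congr (_ - _); under eq_bigr do rewrite big_distrlr/=.
  rewrite exchange_big/=; apply: eq_bigr => i _.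
  rewrite exchange_big/=; apply: eq_bigr => j _.
  by rewrite mulr_sumr; apply: eq_bigr => t _; ring.
rewrite /qf mulr_sumr -sumrB; apply: eq_bigr => i _.
under [RHS]eq_bigr do rewrite mulrBr; rewrite sumrB; congr (_ - _).
rewrite (bigD1 i)//= eqxx mul1r big1 ?addr0; first by ring.
by move=> j /eqP ij; case: eqP => [/val_inj h|_]; [case: ij|rewrite mul0r mulr0].
Qed.

Lemma acov_dev_ge0 e n : 0 <= acov_dev e n.
Proof.
rewrite mulr_ge0 ?invr_ge0 ?sqrtr_ge0//.
by do 2![apply: sumr_ge0 => ? _]; rewrite !mulr_ge0// exprn_ge0// ltW.
Qed.

Lemma past_size_ge0 e n : 0 <= past_size e n.
Proof. by apply: sumr_ge0 => ? _; rewrite !mulr_ge0// exprn_ge0// ltW. Qed.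

(** The weights of the sample autocovariances are at most U V rho^(i + j), the weights built into
    [acov_dev]; hence one path quantity serves all filters. *)
Lemma Sf_qf_le e n u v U V : (0 < n)%N -> 
  (forall m, `|u m| <= U * rho ^+ m) -> (forall m, `|v m| <= V * rho ^+ m) ->
  `|Sf e n u v - qf n u v| <= U * V * (Num.sqrt n%:R * acov_dev e n).
Proof.
move=> n0 hu hv; rewrite /acov_dev mulVKf; last first.
  by rewrite gt_eqF// sqrtr_gt0 ltr0n.
rewrite Sf_qf (le_trans (ler_norm_sum _ _ _))// mulr_sumr.
apply: ler_sum => i _; rewrite (le_trans (ler_norm_sum _ _ _))// mulr_sumr.
apply: ler_sum => j _; rewrite !normrM [leRHS]mulrA ler_wpM2r//.
rewrite (_ : U * V * _ = (U * rho ^+ i) * (V * rho ^+ j)); last by ring.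
by rewrite ler_pM.
Qed.

Lemma flt_le e n u U : 
  (forall m, `|u m| <= U * rho ^+ m) -> `|flt e n u n.+1| <= U * past_size e n.
Proof.
move=> hu; rewrite (le_trans (ler_norm_sum _ _ _))// mulr_sumr.
by apply: ler_sum => m _; rewrite normrM mulrA ler_wpM2r.
Qed.

Lemma flt_dl e n t : flt e n dl t = e t.
Proof.
rewrite /flt big_ord_recl big1 ?addr0 => [|i _]; last by rewrite /dl mul0r.
by rewrite /dl eqxx mul1r subn0.
Qed.

Lemma fltB e n u v t : flt e n (fun m => u m - v m) t = flt e n u t - flt e n v t.
Proof. by rewrite -sumrB; apply: eq_bigr => m _; rewrite mulrBl. Qed.

Lemma SfBr e n u v v' :
  Sf e n u (fun m => v m - v' m) = Sf e n u v - Sf e n u v'.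
Proof. by rewrite -sumrB; apply: eq_bigr => t _; rewrite fltB mulrBr. Qed.

Lemma ssqE e n u : \sum_(1 <= t < n.+1) (e t + flt e n u t) ^+ 2 =
  Sf e n dl dl + 2 * Sf e n dl u + Sf e n u u.
Proof.
rewrite /Sf mulr_sumr -!big_split/=; apply: eq_bigr => t _.
by rewrite !flt_dl; ring.
Qed.

Lemma qf_dl n u : u 0%N = 0 -> qf n dl u = 0.
Proof.
move=> u0; rewrite /qf big_ord_recl u0 big1 => [|i _]; first by rewrite !mulr0 addr0 mulr0.
by rewrite /dl/= !(mul0r, mulr0).
Qed.

Lemma qfC n u v : qf n u v = qf n v u.
Proof. by congr (_ * _); apply: eq_bigr => m _; ring. Qed.

Lemma qfBr n u v v' :
  qf n u (fun m => v m - v' m) = qf n u v - qf n u v'.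
Proof.
by rewrite -mulrBr -sumrB; congr (_ * _); apply: eq_bigr => m _; ring.
Qed.

Lemma qfBl n u u' v :
  qf n (fun m => u m - u' m) v = qf n u v - qf n u' v.
Proof. by rewrite qfC qfBr !(qfC _ v). Qed.

Lemma geo_sum_le n : \sum_(m < n) rho ^+ m <= (1 - rho)^-1.
Proof.
have r1 : 0 < 1 - rho by rewrite subr_gt0.
rewrite -[leRHS]mul1r ler_pdivlMr// mulrC.
have := subrX1 rho n; have := exprn_ge0 n (ltW rho0); lra.
Qed.

Lemma qf_le n u v U V :
  (forall m, `|u m| <= U * rho ^+ m) -> (forall m, `|v m| <= V * rho ^+ m) ->
  `|qf n u v| <= s2 * n%:R * (U * V) * (1 - rho)^-1.
Proof.
move=> hu hv; rewrite normrM (gtr0_norm s20) -!mulrA ler_pM2l//.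
rewrite (le_trans (ler_norm_sum _ _ _))//.
have U0 : 0 <= U by have := hu 0%N; rewrite expr0 mulr1; apply: le_trans.
have V0 : 0 <= V by have := hv 0%N; rewrite expr0 mulr1; apply: le_trans.
apply: (@le_trans _ _ (\sum_(m < n.+1) n%:R * (U * V) * rho ^+ m)); last first.
  by rewrite -mulr_sumr -!mulrA !ler_wpM2l// geo_sum_le.
apply: ler_sum => m _; rewrite !normrM -!mulrA; apply: ler_pM; rewrite ?mulr_ge0//.
  by rewrite normr_nat ler_nat leq_subr.
apply: (@le_trans _ _ (U * rho ^+ m * (V * rho ^+ m))); first exact: ler_pM.
rewrite (_ : _ * _ * _ = U * (V * rho ^+ m) * rho ^+ m); last by ring.
have rm0 : 0 <= rho ^+ m by rewrite exprn_ge0// ltW.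
by rewrite ler_piMr ?mulr_ge0// exprn_ile1// ltW.
Qed.

(** Only the lags m <= p are kept, and for these n - m >= n / 2. *)
Lemma qf_lower n p u k : (p.*2 <= n)%N -> 0 <= k -> k <= \sum_(m < p.+1) u m ^+ 2 ->
  s2 / 2 * n%:R * k <= qf n u u.
Proof.
move=> pn k0 hk.
have -> : s2 / 2 * n%:R * k = s2 * (n%:R / 2 * k) by ring.
rewrite /qf ler_wpM2l ?(ltW s20)//.
have pn' : (p.+1 <= n.+1)%N by rewrite ltnS (leq_trans _ pn)// -addnn leq_addr.
rewrite -(big_mkord xpredT (fun m => (n - m)%:R * (u m * u m))).
rewrite (big_cat_nat (n := p.+1))//=.
rewrite big_mkord; apply: ler_wpDr.
  by apply: sumr_ge0 => i _; rewrite mulr_ge0// -expr2 sqr_ge0.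
apply: (@le_trans _ _ (\sum_(m < p.+1) n%:R / 2 * u m ^+ 2)).
  by rewrite -mulr_sumr ler_wpM2l.
apply: ler_sum => m _; rewrite -expr2 ler_wpM2r ?sqr_ge0//.
rewrite ler_pdivrMr// -natrM ler_nat.
have := ltn_ord m; rewrite ltnS => mp.
rewrite muln2 doubleB -addnn -addnBA ?leq_addr//.
by rewrite -(leq_double) in mp; apply: leq_trans pn.
Qed.

End Forms.

Ltac pos := repeat first [done | rewrite invr_gt0 | apply: addr_gt0
  | apply: mulr_gt0 | apply: exprn_gt0].
Ltac nng := repeat first [done | exact: ltW | (apply: exprn_even_ge0; done) | rewrite invr_ge0 | apply: addr_ge0
  | apply: sqr_ge0 | apply: mulr_ge0 | apply: exprn_ge0].

Section Arith.
Variable R : realType.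
Implicit Types (s x y z K X : R).

Lemma sq_sum2_le x y : (x + y) ^+ 2 <= 2 * (x ^+ 2 + y ^+ 2).
Proof. have := sqr_ge0 (x - y); lra. Qed.

Lemma sqr_le_norm (a B : R) : `|a| <= B -> a ^+ 2 <= B ^+ 2.
Proof.
move=> h; rewrite -[leLHS]real_normK ?num_real//.
by apply: lerXn2r => //; rewrite nnegrE (le_trans _ h).
Qed.

Lemma le_of_quad A B x : 0 < A -> 0 <= B -> 0 <= x -> A * x ^+ 2 <= B * x -> A * x <= B.
Proof.
move=> A0 B0 x0; have [->|xn0] := eqVneq x 0; first by move=> _; rewrite mulr0.
have xp : 0 < x by rewrite lt_neqAle eq_sym xn0.
by rewrite expr2 mulrA ler_pM2r.
Qed.

(** Since K / (tau s) >= 1, one may multiply s^2 by its cube and K^2 by its first power. *)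
Lemma regime_bad (tau s K : R) : 0 < tau -> 0 < s -> tau * s <= K ->
  s ^+ 2 <= tau ^- 3 * (K ^+ 3 / s) /\ K ^+ 2 <= tau ^- 1 * (K ^+ 3 / s).
Proof.
move=> t0 s0 h; have K0 : 0 <= K by rewrite (le_trans _ h)// mulr_ge0// ltW.
split.
  rewrite (_ : tau ^- 3 * _ = K ^+ 3 / (s * tau ^+ 3)); last by field; rewrite !gt_eqF.
  rewrite ler_pdivlMr ?mulr_gt0 ?exprn_gt0//.
  have -> : s ^+ 2 * (s * tau ^+ 3) = (tau * s) ^+ 3 by ring.
  by apply: lerXn2r; rewrite ?nnegrE// mulr_ge0// ltW.
rewrite (_ : tau ^- 1 * _ = K ^+ 3 / (tau * s)); last by field; rewrite !gt_eqF.
rewrite ler_pdivlMr ?mulr_gt0// [leRHS]exprSr.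
by rewrite ler_wpM2l ?sqr_ge0.
Qed.

End Arith.

(** * Pathwise comparison of the least squares estimator with the quadratic minimiser *)

Section Comparison.
Variables (R : realType) (q p : nat) (s2 rho kappa C M delta : R).
Variables (Pi : set 'rV[R]_p) (eta0 : 'rV[R]_p).
Variables (d : 'rV[R]_p -> nat -> R) (f : 'I_p -> nat -> R).
Hypotheses (s20 : 0 < s2) (rho0 : 0 < rho) (rho1 : rho < 1).
Hypotheses (kappa0 : 0 < kappa) (C0 : 0 < C) (M0 : 0 < M) (delta0 : 0 < delta).
Definition fl (theta : 'rV[R]_p) (m : nat) : R := \sum_i theta ord0 i * f i m.
Hypothesis Pi0 : Pi eta0.
Hypothesis Pi_ball : forall theta, `|theta| < delta -> Pi (eta0 + theta).
Hypothesis Pi_bounded : forall eta, Pi eta -> `|eta - eta0| <= M.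
Hypothesis d_0 : forall eta, d eta 0%N = 0.
Hypothesis f_0 : forall i, f i 0%N = 0.
Hypothesis d_le : forall eta m, Pi eta -> `|d eta m| <= C * `|eta - eta0| * rho ^+ m.
Hypothesis d_diff : forall eta m, Pi eta ->
  `|d eta m - fl (eta - eta0) m| <= C * `|eta - eta0| ^+ 2 * rho ^+ m.
Hypothesis fl_le : forall theta m, `|fl theta m| <= C * `|theta| * rho ^+ m.
Hypothesis d_low : forall eta, Pi eta ->
  kappa * `|eta - eta0| ^+ 2 <= \sum_(m < q.+1) d eta m ^+ 2.
Hypothesis fl_low : forall theta,
  kappa * `|theta| ^+ 2 <= \sum_(m < q.+1) fl theta m ^+ 2.

Notation dl := (@dl R).

Lemma fl0 theta : fl theta 0%N = 0.
Proof. by rewrite /fl big1// => i _; rewrite f_0 mulr0. Qed.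

Lemma flB theta theta' : fl (theta - theta') = (fun m => fl theta m - fl theta' m).
Proof.
apply/funext => m; rewrite /fl -sumrB; apply: eq_bigr => i _.
by rewrite !mxE mulrBl.
Qed.

(** No probability is involved: e is any sequence and [thetas] any solution of the normal equations.
    The right-hand side is a bound valid in both regimes of K. *)
Theorem lse_comparison : exists2 C' : R, 0 <= C' &
  forall (n : nat) (e : nat -> R) (etah thetas : 'rV[R]_p),
  (0 < n)%N -> (q.*2 <= n)%N -> Pi etah ->
  (forall eta, Pi eta -> \sum_(1 <= t < n.+1) (e t + flt e n (d etah) t) ^+ 2
                      <= \sum_(1 <= t < n.+1) (e t + flt e n (d eta) t) ^+ 2) ->
  (forall theta, qf s2 n (fl thetas) (fl theta) = - Sf e n dl (fl theta)) ->
  (Num.sqrt n%:R * flt e n (d etah) n.+1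
   - Num.sqrt n%:R * flt e n (fl thetas) n.+1) ^+ 2
  <= C' * (acov_dev s2 rho e n ^+ 3 * past_size rho e n ^+ 2 / Num.sqrt n%:R).
Proof.
pose k := s2 / 2 * kappa.
have k0 : 0 < k by pos.
have kE : k = s2 / 2 * kappa by [].
clearbody k.
(* Consistency constant: sqrt n times the norm of either estimation error will be at most [c1 * K].
   The 4 is a 2 from the cross term and a 2 from absorbing half of the quadratic form. *)
pose c1 := 4 * C / k.
have c10 : 0 < c1 by pos.
have c1E : c1 = 4 * C / k by [].
clearbody c1.
(* For K <= tau s the first bound lets half of the quadratic form absorb its random deviation, and
   the second places eta0 + [thetas] inside Pi. *)
have [tau [tau0 tau1 tau2]] : exists tau : R, [/\ 0 < tau, C ^+ 2 * tau <= k / 2 &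
    c1 * tau < delta].
  exists (Num.min (k / (2 * C ^+ 2)) (delta / (2 * c1))); split.
  - by rewrite lt_min; apply/andP; split; pos.
  - apply: (@le_trans _ _ (C ^+ 2 * (k / (2 * C ^+ 2)))).
      by rewrite ler_wpM2l ?sqr_ge0// ge_min lexx.
    by rewrite le_eqVlt; apply/orP; left; apply/eqP; field; rewrite gt_eqF.
  - apply: (@le_lt_trans _ _ (c1 * (delta / (2 * c1)))).
      by rewrite ler_wpM2l ?(ltW c10)// ge_min lexx orbT.
    rewrite (_ : _ * _ = delta / 2); last by field; rewrite gt_eqF.
    by have := delta0; lra.
pose G := (1 - rho)^-1.
have G0 : 0 < G by rewrite invr_gt0 subr_gt0.
have GE : (1 - rho)^-1 = G by [].
clearbody G.
(* Majorises all errors of the quadratic approximation in units of K^3 / s; [Cg] and [Cb] below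
   belong to the regimes K <= tau s and K >= tau s. *)
pose c3 := 3 * C * (1 + C) * c1 ^+ 2 + 2 * s2 * C ^+ 2 * G * c1 ^+ 3.
have c30 : 0 < c3.
  by pos.
pose Cg := 2 * C ^+ 2 * (c1 ^+ 4 * tau + 2 * c3 / k).
pose Cb := 2 * C ^+ 2 * (M ^+ 2 * tau ^- 3 + c1 ^+ 2 * tau ^- 1).
have Cg0 : 0 <= Cg.
  by nng.
have Cb0 : 0 <= Cb.
  by nng.
have [c3E CgE CbE] : [/\ c3 = 3 * C * (1 + C) * c1 ^+ 2 + 2 * s2 * C ^+ 2 * G * c1 ^+ 3,
  Cg = 2 * C ^+ 2 * (c1 ^+ 4 * tau + 2 * c3 / k) &
  Cb = 2 * C ^+ 2 * (M ^+ 2 * tau ^- 3 + c1 ^+ 2 * tau ^- 1)] by [].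
clearbody Cg Cb c3.
exists (Cg + Cb) => [|n e etah thetas n0 qn Pih hmin hth]; first exact: addr_ge0.
set s : R := Num.sqrt n%:R; set K : R := acov_dev _ _ _ _; set X : R := past_size _ _ _.
have s0 : 0 < s by rewrite sqrtr_gt0 ltr0n.
have ss : s ^+ 2 = n%:R by rewrite sqr_sqrtr.
have K0 : 0 <= K by apply: acov_dev_ge0.
have X0 : 0 <= X by apply: past_size_ge0.
set x : R := `|etah - eta0|; set y : R := `|thetas|; set z : R := `|(etah - eta0) - thetas|.
have x0 : 0 <= x by exact: normr_ge0.
have y0 : 0 <= y by exact: normr_ge0.
have z0 : 0 <= z by exact: normr_ge0.
have Tge0 : 0 <= K ^+ 3 * X ^+ 2 / s.
  by nng.
have dl_geo m : `|dl m| <= 1 * rho ^+ m.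
  by rewrite /dl; case: m => [|m]; rewrite ?normr1 ?expr0 ?mul1r// normr0 exprn_ge0 ?ltW.
have Sfd eta (u : nat -> R) (U : R) : Pi eta -> (forall m, `|u m| <= U * rho ^+ m) -> u 0%N = 0 ->
    `|Sf e n dl u| <= U * (s * K).
  move=> he hu u0; have := Sf_qf_le s2 e n0 dl_geo hu.
  by rewrite qf_dl// subr0 mul1r.
have qlow (u : nat -> R) (r : R) : 0 <= r -> kappa * r ^+ 2 <= \sum_(m < q.+1) u m ^+ 2 ->
    k * (s * r) ^+ 2 <= qf s2 n u u.
  move=> r0 hr; have := qf_lower s20 qn _ hr.
  move=> /(_ (mulr_ge0 (ltW kappa0) (sqr_ge0 _))); apply: le_trans.
  by rewrite exprMn ss kE; lra.
(* Test the normal equations with [thetas] itself: coercivity on the left, and on the right a score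
   of size C y s K. *)
have hy : s * y <= c1 * K.
  have h1 : k * (s * y) ^+ 2 <= C * K * (s * y).
    apply: (le_trans (qlow _ _ y0 (fl_low thetas))); rewrite hth.
    have := Sfd eta0 _ _ Pi0 (fl_le thetas) (fl0 _).
    rewrite -/y ler_norml => /andP[+ _]; lra.
  have := le_of_quad k0 (mulr_ge0 (ltW C0) K0) (mulr_ge0 (ltW s0) y0) h1.
  rewrite -ler_pdivlMl// => /le_trans; apply.
  have : 0 <= k^-1 * (C * K) by nng.
  rewrite c1E (_ : 4 * C / k * K = 4 * (k^-1 * (C * K))); last by ring.
  lra.
(* Large K: the two prediction errors are bounded separately, the first one by the diameter bound M
   alone. *)
have [Kt|/ltW Kt] := leP (tau * s) K.
  have [b1 b2] := regime_bad tau0 s0 Kt.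
  apply: (@le_trans _ _ (Cb * (K ^+ 3 * X ^+ 2 / s))); last first.
    by rewrite ler_wpM2r// lerDr.
  apply: (le_trans (sq_sum2_le _ _)); rewrite sqrrN ![(s * _) ^+ 2]exprMn.
  have a1 : flt e n (d etah) n.+1 ^+ 2 <= C ^+ 2 * M ^+ 2 * X ^+ 2.
    rewrite -!exprMn; apply: sqr_le_norm.
    apply: (le_trans (flt_le e n (fun m => d_le m Pih))).
    by rewrite ler_wpM2r// ler_wpM2l ?Pi_bounded// ltW.
  have a2 : flt e n (fl thetas) n.+1 ^+ 2 <= C ^+ 2 * y ^+ 2 * X ^+ 2.
    rewrite -!exprMn; apply: sqr_le_norm.
    exact: (flt_le e n (fl_le thetas)).
  have hy2 : s ^+ 2 * y ^+ 2 <= c1 ^+ 2 * K ^+ 2.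
    by rewrite -!exprMn; apply: lerXn2r; rewrite ?nnegrE//; nng.
  set W : R := K ^+ 3 / s in b1 b2.
  have -> : Cb * (K ^+ 3 * X ^+ 2 / s) = 2 *
     (C ^+ 2 * M ^+ 2 * X ^+ 2 * (tau ^- 3 * W) + C ^+ 2 * X ^+ 2 * c1 ^+ 2 * (tau ^- 1 * W)).
    by rewrite CbE /W; ring.
  rewrite ler_wpM2l//; apply: lerD.
    apply: (@le_trans _ _ (s ^+ 2 * (C ^+ 2 * M ^+ 2 * X ^+ 2))).
      by rewrite ler_wpM2l ?sqr_ge0.
    by rewrite mulrC ler_wpM2l//; nng.
  apply: (@le_trans _ _ (s ^+ 2 * (C ^+ 2 * y ^+ 2 * X ^+ 2))).
    by rewrite ler_wpM2l ?sqr_ge0.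
  rewrite (_ : s ^+ 2 * _ = C ^+ 2 * X ^+ 2 * (s ^+ 2 * y ^+ 2)); last by ring.
  rewrite -[leRHS]mulrA ler_wpM2l//; first by nng.
  by apply: (le_trans hy2); rewrite ler_wpM2l ?sqr_ge0.
have dh0 := d_0 etah.
(* Compare with eta0, whose filter vanishes identically. *)
have hx : s * x <= c1 * K.
  have L1 := hmin _ Pi0; rewrite !ssqE in L1.
  have dz m : `|d eta0 m| <= 0 * rho ^+ m.
    by have := d_le m Pi0; rewrite subrr normr0 mulr0.
  have e1 : Sf e n dl (d eta0) = 0.
    have := Sfd _ _ _ Pi0 dz (d_0 _); rewrite mul0r normr_le0 => /eqP //.
  have e2 : Sf e n (d eta0) (d eta0) = 0.
    rewrite /Sf big1// => t _; rewrite /flt big1 ?mul0r// => m _.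
    by have := dz m; rewrite mul0r normr_le0 => /eqP ->; rewrite mul0r.
  have := Sfd _ _ _ Pih (fun m => d_le m Pih) dh0.
  have := Sf_qf_le s2 e n0 (fun m => d_le m Pih) (fun m => d_le m Pih).
  rewrite -/x -/s -/K !ler_norml => /andP[h1 _] /andP[h2 _].
  have h3 := qlow _ _ x0 (d_low Pih).
  (* This is where K <= tau s enters. *)
  have h4 : C * x * (C * x) * (s * K) <= k / 2 * (s * x) ^+ 2.
    rewrite (_ : _ * (s * K) = x ^+ 2 * s * (C ^+ 2 * K)); last by ring.
    rewrite (_ : _ * (s * x) ^+ 2 = x ^+ 2 * s * (k / 2 * s)); last by ring.
    apply: ler_wpM2l; first by nng.
    apply: (@le_trans _ _ (C ^+ 2 * tau * s)); last by rewrite ler_wpM2r// ltW.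
    by rewrite -mulrA ler_wpM2l ?sqr_ge0.
  have h5 : k * (s * x) ^+ 2 <= 4 * C * K * (s * x) by lra.
  have := le_of_quad k0 (mulr_ge0 (mulr_ge0 (ler0n _ 4) (ltW C0)) K0) (mulr_ge0 (ltW s0) x0) h5.
  by rewrite -ler_pdivlMl// => /le_trans; apply; rewrite c1E mulrC mulrAC.
have K3s : 0 <= K ^+ 3 / s by nng.
(* Three replacements: d by its linear part in the score term (cost r^2 s K), [Sf] by [qf] in the
   quadratic term (again r^2 s K), and d by its linear part inside [qf] (cost s^2 r^3). With s r <=
   c1 K each is of order K^3 / s. *)
have quad eta : Pi eta -> s * `|eta - eta0| <= c1 * K ->
   `|\sum_(1 <= t < n.+1) (e t + flt e n (d eta) t) ^+ 2 -
     (Sf e n dl dl + 2 * Sf e n dl (fl (eta - eta0)) +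
      qf s2 n (fl (eta - eta0)) (fl (eta - eta0)))| <= c3 * (K ^+ 3 / s).
  move=> he; set r : R := `|eta - eta0| => hr; rewrite ssqE.
  have r0 : 0 <= r by exact: normr_ge0.
  set u := d eta; set v := fl _.
  have hu : forall m, `|u m| <= C * r * rho ^+ m by move=> m; exact: d_le.
  have hv : forall m, `|v m| <= C * r * rho ^+ m by move=> m; exact: fl_le.
  have huv m : `|u m - v m| <= C * r ^+ 2 * rho ^+ m by exact: d_diff.
  have uv0 : u 0%N - v 0%N = 0 by rewrite /u /v d_0 fl0 subrr.
  have := Sfd _ _ _ he huv uv0; rewrite SfBr => h1.
  have h2 := Sf_qf_le s2 e n0 hu hu; rewrite -/s -/K in h2.
  have h3 := qf_le s20 rho0 rho1 n huv hu.
  have h4 := qf_le s20 rho0 rho1 n huv hv.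
  rewrite qfBl GE -ss in h3; rewrite qfBl GE -ss in h4.
  have e1 : r ^+ 2 * (s * K) <= c1 ^+ 2 * (K ^+ 3 / s).
    rewrite [leRHS]mulrA ler_pdivlMr//.
    rewrite (_ : _ * s = (s * r) ^+ 2 * K); last by ring.
    rewrite (_ : c1 ^+ 2 * K ^+ 3 = (c1 * K) ^+ 2 * K); last by ring.
    by rewrite ler_wpM2r//; apply: lerXn2r => //; rewrite ?nnegrE; nng.
  have e2 : s ^+ 2 * r ^+ 3 <= c1 ^+ 3 * (K ^+ 3 / s).
    rewrite [leRHS]mulrA ler_pdivlMr//.
    rewrite (_ : _ * s = (s * r) ^+ 3); last by ring.
    by rewrite -exprMn; apply: lerXn2r => //; rewrite ?nnegrE; nng.
  set W : R := K ^+ 3 / s in e1 e2 K3s *.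
  have -> : c3 * W = 2 * (C * (c1 ^+ 2 * W)) + C ^+ 2 * (c1 ^+ 2 * W) +
    2 * (s2 * C ^+ 2 * G * (c1 ^+ 3 * W)) + (C * (c1 ^+ 2 * W) + 2 * (C ^+ 2 * (c1 ^+ 2 * W))).
    by rewrite c3E; ring.
  have f1 : C * r ^+ 2 * (s * K) <= C * (c1 ^+ 2 * W).
    by rewrite -mulrA ler_wpM2l// ltW.
  have f2 : C * r * (C * r) * (s * K) <= C ^+ 2 * (c1 ^+ 2 * W).
    rewrite (_ : _ * (s * K) = C ^+ 2 * (r ^+ 2 * (s * K))); last by ring.
    by rewrite ler_wpM2l// sqr_ge0.
  have f3 : s2 * s ^+ 2 * (C * r ^+ 2 * (C * r)) * G <= s2 * C ^+ 2 * G * (c1 ^+ 3 * W).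
    rewrite (_ : _ * G = s2 * C ^+ 2 * G * (s ^+ 2 * r ^+ 3)); last by ring.
    by rewrite ler_wpM2l//; nng.
  have f4 : 0 <= C * (c1 ^+ 2 * W) by nng.
  have f5 : 0 <= C ^+ 2 * (c1 ^+ 2 * W) by nng.
  move: h1 h2 h3 h4; rewrite (qfC _ _ v u) !ler_norml.
  move=> /andP[? ?] /andP[? ?] /andP[? ?] /andP[? ?].
  apply/andP; split; lra.
(* The minimiser of the quadratic form is an admissible competitor, so the minimality of [etah] may
   be applied to it. *)
have hs : Pi (eta0 + thetas).
  apply: Pi_ball; apply: le_lt_trans tau2; rewrite -/y -(ler_pM2l s0).
  by apply: (le_trans hy); rewrite [leRHS]mulrCA ler_wpM2l ?(ltW c10)// [leRHS]mulrC.
have es : eta0 + thetas - eta0 = thetas by rewrite addrAC subrr add0r.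
(* By the normal equations the quadratic approximation exceeds its minimum by exactly the form at
   the difference. Minimality of [etah] bounds this excess by two approximation errors. *)
have hz : k * (s * z) ^+ 2 <= 2 * c3 * (K ^+ 3 / s).
  have L1 := hmin _ hs.
  have q1 := quad _ Pih hx.
  have q2 := quad _ hs; rewrite es in q2; have {}q2 := q2 hy.
  apply: (le_trans (qlow _ _ z0 (fl_low _))).
  have := hth (etah - eta0 - thetas); rewrite (flB (etah - eta0) thetas) SfBr qfBr.
  rewrite qfBl !qfBr (qfC _ _ (fl (etah - eta0)) (fl thetas)) => hth'.
  move: q1 q2; rewrite !ler_norml => /andP[? ?] /andP[? ?].
  lra.
have -> : s * flt e n (d etah) n.+1 - s * flt e n (fl thetas) n.+1 =
  s * flt e n (fun m => d etah m - fl (etah - eta0) m) n.+1 +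
  s * flt e n (fl (etah - eta0 - thetas)) n.+1.
  by rewrite (flB (etah - eta0) thetas) !fltB; ring.
apply: (@le_trans _ _ (Cg * (K ^+ 3 * X ^+ 2 / s))); last first.
  by rewrite ler_wpM2r// lerDl.
apply: (le_trans (sq_sum2_le _ _)); rewrite ![(s * _) ^+ 2]exprMn.
have a1 : flt e n (fun m => d etah m - fl (etah - eta0) m) n.+1 ^+ 2 <= C ^+ 2 * x ^+ 4 * X ^+ 2.
  rewrite (_ : _ * _ = (C * x ^+ 2 * X) ^+ 2); last by ring.
  apply: sqr_le_norm.
  exact: (flt_le e n (fun m => d_diff m Pih)).
have a2 : flt e n (fl (etah - eta0 - thetas)) n.+1 ^+ 2 <= C ^+ 2 * z ^+ 2 * X ^+ 2.
  rewrite -!exprMn; apply: sqr_le_norm.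
  exact: (flt_le e n (fl_le _)).
(* One factor K of (c1 K)^4 is traded for tau s. *)
have hx4 : s ^+ 2 * x ^+ 4 <= c1 ^+ 4 * tau * (K ^+ 3 / s).
  rewrite [leRHS]mulrA ler_pdivlMr// -(ler_pM2r s0).
  rewrite (_ : _ * s * s = (s * x) ^+ 4); last by ring.
  apply: (@le_trans _ _ ((c1 * K) ^+ 4)).
    by apply: lerXn2r => //; rewrite ?nnegrE; nng.
  rewrite (_ : (c1 * K) ^+ 4 = c1 ^+ 4 * K ^+ 3 * K); last by ring.
  rewrite (_ : _ * tau * _ * s = c1 ^+ 4 * K ^+ 3 * (tau * s)); last by ring.
  by rewrite ler_wpM2l//; nng.
have hz2 : s ^+ 2 * z ^+ 2 <= 2 * c3 / k * (K ^+ 3 / s).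
  by rewrite -exprMn mulrAC ler_pdivlMr// mulrC.
set W : R := K ^+ 3 / s in hx4 hz2.
have -> : Cg * (K ^+ 3 * X ^+ 2 / s) = 2 *
   (C ^+ 2 * X ^+ 2 * (c1 ^+ 4 * tau * W) + C ^+ 2 * X ^+ 2 * (2 * c3 / k * W)).
  by rewrite CgE /W; ring.
rewrite ler_wpM2l//; apply: lerD.
  apply: (@le_trans _ _ (C ^+ 2 * X ^+ 2 * (s ^+ 2 * x ^+ 4))); last first.
    by rewrite ler_wpM2l//; nng.
  rewrite (_ : _ * (_ * x ^+ 4) = s ^+ 2 * (C ^+ 2 * x ^+ 4 * X ^+ 2)); last by ring.
  by rewrite ler_wpM2l ?sqr_ge0.
apply: (@le_trans _ _ (C ^+ 2 * X ^+ 2 * (s ^+ 2 * z ^+ 2))); last first.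
  by rewrite ler_wpM2l//; nng.
rewrite (_ : _ * (_ * z ^+ 2) = s ^+ 2 * (C ^+ 2 * z ^+ 2 * X ^+ 2)); last by ring.
by rewrite ler_wpM2l ?sqr_ge0.
Qed.

End Comparison.

(** * Independence of the past and moments *)

Section IndependentPair.
Context d d1 d2 (T : measurableType d) (T1 : measurableType d1)
  (T2 : measurableType d2) (R : realType) (P : probability T R).
Variables (f1 : {mfun T >-> T1}) (f2 : {mfun T >-> T2}).
Hypothesis f12 : forall A B, measurable A -> measurable B ->
  P (f1 @^-1` A `&` f2 @^-1` B) = (P (f1 @^-1` A) * P (f2 @^-1` B))%E.

(** Agreement on rectangles identifies the joint law with the product of the marginals; Fubini then
    separates the factors. *)
Lemma indep_pair_integral (g : T1 -> R) (h : T2 -> R) :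
  measurable_fun setT g -> measurable_fun setT h ->
  P.-integrable setT (EFin \o (g \o f1)) ->
  P.-integrable setT (EFin \o (h \o f2)) ->
  P.-integrable setT (EFin \o (fun w => g (f1 w) * h (f2 w))) ->
  \int[P]_w (g (f1 w) * h (f2 w)) = (\int[P]_w g (f1 w)) * (\int[P]_w h (f2 w)).
Proof.
move=> mg mh Ig Ih Igh.
pose phi : T -> T1 * T2 := fun w => (f1 w, f2 w).
have mphi : measurable_fun [set: T] phi by exact: measurable_fun_pair.
pose phim : {mfun T >-> (T1 * T2)%type} :=
  MeasurableFun.Pack (MeasurableFun.Class (isMeasurableFun.Build _ _ _ _ _ mphi)).
pose F : T1 * T2 -> \bar R := fun z => (g z.1 * h z.2)%:E.
have mF : measurable_fun [set: T1 * T2] F.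
  apply/measurable_EFinP/measurable_funM.
    exact: (measurableT_comp mg).
  exact: (measurableT_comp mh).
pose m1 := distribution P f1.
pose m2 := distribution P f2.
pose m := distribution P phim.
have E A : measurable A -> (m1 \x m2)%E A = m A.
  by apply: product_measure_unique => B C mB mC; exact: f12.
have IF : P.-integrable setT (F \o phim) by exact: Igh.
have ImF : m.-integrable setT F by exact: integrable_pushforward.
have IpF : (m1 \x m2)%E.-integrable setT F.
  apply/integrableP; split => //; rewrite (@eq_measure_integral _ _ _ _ m).
    by case/integrableP : ImF.
  by move=> A mA _; exact: E.
have e1 : (\int[P]_w (g (f1 w) * h (f2 w))%:E = \int[m]_z F z)%E.
  by rewrite (integral_distribution mF IF).
have e2 : (\int[m]_z F z = \int[m1 \x m2]_z F z)%E.
  by apply: eq_measure_integral => A mA _; apply/esym; apply: E.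
have ch : (\int[m2]_y (h y)%:E = \int[P]_w (h (f2 w))%:E)%E.
  by rewrite integral_distribution//; exact/measurable_EFinP.
have cg : (\int[m1]_x (g x)%:E = \int[P]_w (g (f1 w))%:E)%E.
  by rewrite integral_distribution//; exact/measurable_EFinP.
have Im2h : m2.-integrable setT (EFin \o h).
  by apply: integrable_pushforward => //; exact/measurable_EFinP.
have Im1g : m1.-integrable setT (EFin \o g).
  by apply: integrable_pushforward => //; exact/measurable_EFinP.
rewrite /Rintegral e1 e2 -(integral12_prod_meas1 IpF).
pose c : R := fine (\int[P]_w (h (f2 w))%:E).
have cE : c%:E = (\int[P]_w (h (f2 w))%:E)%E.
  by rewrite /c fineK//; exact: integrable_fin_num.
transitivity (fine (\int[m1]_x (c%:E * (g x)%:E))%E).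
  congr fine; apply: eq_integral => x _; rewrite /fubini_F /F/=.
  under eq_integral do rewrite EFinM.
  by rewrite integralZl// ch -cE muleC.
rewrite integralZl// cg -cE fineM//; first by rewrite mulrC.
exact: integrable_fin_num.
Qed.

End IndependentPair.

Section Independence.
Context d (T : measurableType d) (R : realType) (P : probability T R).
Variable X : nat -> {RV P >-> R}.

Definition past_gens (N : nat) : set (set T) :=
  [set A | exists i (B : set R), [/\ (i < N)%N, measurable B & A = X i @^-1` B]].

Notation pastT N := (g_sigma_algebraType (past_gens N)).

(** A pi-system generating the same sigma-algebra as [past_gens]; mutual independence speaks
    directly about these sets. *)
Definition past_rects (N : nat) : set (set T) :=
  [set A | exists B : nat -> set R, (forall i, measurable (B i)) /\
    A = \bigcap_(i in [set` iota 0 N]) (X i @^-1` B i)].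

Lemma measurable_preRV i (B : set R) : measurable B -> measurable (X i @^-1` B).
Proof. by move=> mB; rewrite -[X in measurable X]setTI; exact: measurable_funP. Qed.

Lemma past_rects_measurable N : past_rects N `<=` measurable.
Proof.
move=> _ [B [mB ->]]; rewrite bigcap_seq; apply: bigsetI_measurable => i _.
exact: measurable_preRV.
Qed.

Lemma past_rects_setI N : setI_closed (past_rects N).
Proof.
move=> _ _ [B [mB ->]] [C [mC ->]]; exists (fun i => B i `&` C i); split.
  by move=> i; exact: measurableI.
by rewrite -bigcapI; apply: eq_bigcapr => i _; rewrite preimage_setI.
Qed.

Lemma past_rects_setT N : past_rects N setT.
Proof.
exists (fun=> setT); split => [i|]; first exact: measurableT.
by apply/seteqP; split.
Qed.

Lemma past_gens_rects N : past_gens N `<=` past_rects N.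
Proof.
move=> _ [i [B [iN mB ->]]].
exists (fun j => if j == i then B else setT); split => [j|].
  by case: eqP => _ //; exact: measurableT.
apply/seteqP; split => [w /= Bw j _ /=|w /= /(_ i)]; first by case: eqP => [->|].
by rewrite eqxx; apply; rewrite /= mem_iota add0n.
Qed.

Lemma past_gens_measurable N : <<s past_gens N >> `<=` @measurable _ T.
Proof.
apply: smallest_sub; first exact: sigma_algebra_measurable.
by move=> A /past_gens_rects /past_rects_measurable.
Qed.

Hypothesis indX : mutually_independent X.

(** With C the event on [X N], the finite measures A -> P(A and C) and A -> P(C) P(A) agree on the
    pi-system of rectangles, hence on the sigma-algebra it generates. *)
Lemma past_indep_event N A (B : set R) : <<s past_gens N >> A -> measurable B ->
  P (A `&` (X N @^-1` B)) = (P A * P (X N @^-1` B))%E.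
Proof.
move=> sA mB; set C := X N @^-1` B.
have mC : measurable C by exact: measurable_preRV.
have [k kE] : exists k : {nonneg R}, (k%:num)%:E = P C.
  by exists (NngNum (fine_ge0 (measure_ge0 P C))); rewrite /= fineK// fin_num_measure.
transitivity (mrestr P mC A) => //.
transitivity (mscale k P A); last by rewrite /mscale/= kE muleC.
apply: (@g_sigma_algebra_measure_unique _ R T (past_rects N) _ (fun=> setT)) => //.
- exact: past_rects_measurable.
- by move=> _; exact: past_rects_setT.
- by rewrite bigcup_const//; exists 0%N.
- exact: past_rects_setI.
- move=> _ [D [mD ->]]; rewrite -[LHS]/(P (_ `&` C)) -[RHS]/((k%:num)%:E * P _)%E kE.
  (* Imposing B at index N turns the rectangle intersected with C into a rectangle in N + 1
     variables. *)
  pose D' i := if i == N then B else D i.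
  have mD' i : measurable (D' i) by rewrite /D'; case: eqP.
  have E1 : \bigcap_(i in [set` iota 0 N]) (X i @^-1` D i) =
     \bigcap_(i in [set` iota 0 N]) (X i @^-1` D' i).
    apply: eq_bigcapr => i /=; rewrite mem_iota add0n /D' => /andP[_ iN].
    by rewrite ltn_eqF.
  have E2 : \bigcap_(i in [set` iota 0 N]) (X i @^-1` D i) `&` C =
     \bigcap_(i in [set` rcons (iota 0 N) N]) (X i @^-1` D' i).
    rewrite E1; apply/seteqP; split => [w [h1 h2] i /=|w h].
      rewrite mem_rcons inE => /orP[/eqP->|]; last exact: h1.
      by rewrite /D' eqxx.
    split => [i /= hi|]; first by apply: h => /=; rewrite mem_rcons inE hi orbT.
    have := h N; rewrite /= mem_rcons inE eqxx /D' eqxx; exact.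
  rewrite E2 E1 !indX ?rcons_uniq ?iota_uniq ?mem_iota ?add0n ?ltnn//=.
  by rewrite -cats1 big_cat big_seq1/= {2}/D' eqxx muleC.
- by move=> _; rewrite -[ltLHS]/(P (_ `&` C)) setTI (le_lt_trans (probability_le1 _ mC))// ltry.
- move: A sA; apply: smallest_sub; first exact: smallest_sigma_algebra.
  by move=> A /past_gens_rects; exact: sub_sigma_algebra.
Qed.

(** Measurability with respect to X_0, ..., X_{N-1}. Later X_t is the innovation at time t + 1, so N
    becomes the last observed time. *)
Definition past_fun N (f : T -> R) :=
  measurable_fun [set: pastT N] (f : pastT N -> R).

Lemma measurable_past_id N : measurable_fun [set: T] (id : T -> pastT N).
Proof. by move=> _ B mB; rewrite setTI; exact: (@past_gens_measurable N B mB). Qed.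

Lemma past_fun_measurable N f : past_fun N f -> measurable_fun setT f.
Proof. by move=> mf; have := measurableT_comp mf (@measurable_past_id N). Qed.

Theorem past_indep_integral N (f : T -> R) (h : R -> R) :
  past_fun N f -> measurable_fun setT h ->
  P.-integrable setT (EFin \o f) -> P.-integrable setT (EFin \o (h \o X N)) ->
  P.-integrable setT (EFin \o (fun w => f w * h (X N w))) ->
  \int[P]_w (f w * h (X N w)) = (\int[P]_w f w) * (\int[P]_w h (X N w)).
Proof.
move=> mf mh If Ih Ifh.
have mid := @measurable_past_id N.
pose idm : {mfun T >-> pastT N} :=
  MeasurableFun.Pack (MeasurableFun.Class (isMeasurableFun.Build _ _ _ _ _ mid)).
apply: (indep_pair_integral (f1 := idm) (f2 := X N)) => // A B mA mB.
exact: past_indep_event.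
Qed.

End Independence.

(** * Power means and moment bounds *)

Section PowerMean.
Variable R : realType.

(** Cauchy-Schwarz through the Lagrange identity: the gap is half the double sum of a_i a_j (x_i -
    x_j)^2. *)
Lemma sq_mean n (a x : 'I_n -> R) : (forall i, 0 <= a i) ->
  (\sum_i a i * x i) ^+ 2 <= (\sum_i a i) * \sum_i a i * x i ^+ 2.
Proof.
move=> a0; set A := \sum_i a i; set B := \sum_i a i * x i; set D := \sum_i _ * _ ^+ 2.
have : 0 <= \sum_i \sum_j a i * a j * (x i - x j) ^+ 2.
  by apply: sumr_ge0 => i _; apply: sumr_ge0 => j _; nng.
have -> : \sum_i \sum_j a i * a j * (x i - x j) ^+ 2 =
   \sum_i (a i * x i ^+ 2 * A - 2 * (a i * x i) * B + a i * D).
  apply: eq_bigr => i _.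
  rewrite /A /B /D !mulr_sumr -sumrB -big_split/=.
  by apply: eq_bigr => j _; ring.
rewrite big_split/= sumrB -!mulr_suml -/A -/D -mulr_sumr -/B; lra.
Qed.

Lemma pow4_mean n (a x : 'I_n -> R) : (forall i, 0 <= a i) ->
  (\sum_i a i * x i) ^+ 4 <= (\sum_i a i) ^+ 3 * \sum_i a i * x i ^+ 4.
Proof.
move=> a0; have A0 : 0 <= \sum_i a i by exact: sumr_ge0.
rewrite (_ : (_ ^+ 4) = ((\sum_i a i * x i) ^+ 2) ^+ 2); last by rewrite -exprM.
apply: (@le_trans _ _ (((\sum_i a i) * \sum_i a i * x i ^+ 2) ^+ 2)).
  apply: lerXn2r; rewrite ?nnegrE ?sqr_ge0 ?sq_mean//.
  by rewrite mulr_ge0// sumr_ge0// => i _; rewrite mulr_ge0 ?sqr_ge0.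
rewrite exprMn (_ : (\sum_i a i) ^+ 3 = (\sum_i a i) ^+ 2 * (\sum_i a i)); last by rewrite -exprSr.
rewrite -mulrA ler_wpM2l ?sqr_ge0//.
rewrite (_ : \sum_i a i * x i ^+ 4 = \sum_i a i * (x i ^+ 2) ^+ 2).
  exact: sq_mean.
by apply: eq_bigr => i _; rewrite -exprM.
Qed.

Lemma pow8_mean n (a x : 'I_n -> R) : (forall i, 0 <= a i) ->
  (\sum_i a i * x i) ^+ 8 <= (\sum_i a i) ^+ 7 * \sum_i a i * x i ^+ 8.
Proof.
move=> a0; have A0 : 0 <= \sum_i a i by exact: sumr_ge0.
rewrite (_ : (_ ^+ 8) = ((\sum_i a i * x i) ^+ 2) ^+ 4); last by rewrite -exprM.
apply: (@le_trans _ _ (((\sum_i a i) * \sum_i a i * x i ^+ 2) ^+ 4)).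
  apply: lerXn2r; rewrite ?nnegrE ?sqr_ge0 ?sq_mean//.
  by rewrite mulr_ge0// sumr_ge0// => i _; rewrite mulr_ge0 ?sqr_ge0.
rewrite exprMn (_ : (\sum_i a i) ^+ 7 = (\sum_i a i) ^+ 4 * (\sum_i a i) ^+ 3); last by rewrite -exprD.
rewrite -mulrA ler_wpM2l ?exprn_ge0//.
rewrite (_ : \sum_i a i * x i ^+ 8 = \sum_i a i * (x i ^+ 2) ^+ 4).
  exact: pow4_mean.
by apply: eq_bigr => i _; rewrite -exprM.
Qed.

Lemma pow4_sum2 (x y : R) : (x + y) ^+ 4 <= 8 * (x ^+ 4 + y ^+ 4).
Proof.
have h := sq_sum2_le x y; have h2 := sq_sum2_le (x ^+ 2) (y ^+ 2).
rewrite (exprM _ 2 2); apply: (@le_trans _ _ ((2 * (x ^+ 2 + y ^+ 2)) ^+ 2)).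
  by apply: lerXn2r; rewrite ?nnegrE ?sqr_ge0// mulr_ge0// addr_ge0 ?sqr_ge0.
rewrite exprMn (exprM x 2 2) (exprM y 2 2); lra.
Qed.

Lemma pow8_sum2 (x y : R) : (x + y) ^+ 8 <= 128 * (x ^+ 8 + y ^+ 8).
Proof.
have h := pow4_sum2 x y; have h2 := sq_sum2_le (x ^+ 4) (y ^+ 4).
rewrite (exprM _ 4 2); apply: (@le_trans _ _ ((8 * (x ^+ 4 + y ^+ 4)) ^+ 2)).
  by apply: lerXn2r; rewrite ?nnegrE ?(exprn_even_ge0)// mulr_ge0// addr_ge0 ?exprn_even_ge0.
rewrite exprMn (exprM x 4 2) (exprM y 4 2); lra.
Qed.

End PowerMean.

Section Degree.
Context d (T : measurableType d) (R : realType) (P : probability T R).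
Variable e : nat -> {RV P >-> R}.
Implicit Types (f g : T -> R) (N k j : nat).

Hypothesis e8 : forall t, P.-integrable setT (EFin \o (fun w => e t w ^+ 8)).

(** A common envelope for polynomials in the first N variables, so that integrability has to be
    proved only once, for its eighth power. *)
Definition env N (w : T) : R := 1 + \sum_(s < N) `|e s w|.

(* With eighth moments, dg N k for k <= 8 is a form of integrability stable under
   sums and products. *)
Definition dg N k f : Prop := measurable_fun setT f /\
  exists C : R, forall w, `|f w| <= C * env N w ^+ k.

Local Notation "''Ex' [ f ]" := (\int[P]_w (f w)) (format "''Ex' [ f ]").

Lemma env_ge1 N w : 1 <= env N w.
Proof. by rewrite lerDl sumr_ge0. Qed.

Lemma env_gt0 N w : 0 < env N w.
Proof. exact: lt_le_trans ltr01 (env_ge1 N w). Qed.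

Lemma dg_bound N k f : dg N k f -> exists2 C : R, 0 <= C & forall w, `|f w| <= C * env N w ^+ k.
Proof.
move=> [_ [C hC]]; exists `|C| => // w; apply: (le_trans (hC w)).
by rewrite ler_wpM2r ?ler_norm// exprn_ge0// ltW// env_gt0.
Qed.

Lemma measurable_env N : measurable_fun setT (env N).
Proof.
apply: measurable_funD => //; apply: measurable_sum => s.
exact: measurableT_comp.
Qed.

Lemma integrable_env8 N : P.-integrable setT (EFin \o (fun w => env N w ^+ 8)).
Proof.
elim: N => [|N IH].
  apply: (eq_integrable _ (fun=> 1%:E)) => //.
    by move=> w _ /=; rewrite /env big_ord0 addr0 expr1n.
  exact: finite_measure_integrable_cst.
pose g w := 128 * (env N w ^+ 8 + e N w ^+ 8).
apply: (@le_integrable _ _ _ _ _ _ _ (EFin \o g)) => //.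
- by apply/measurable_EFinP/measurable_funX/measurable_env.
- move=> w _; rewrite /= lee_fin /g.
  rewrite !ger0_norm; last first.
  + by nng.
  + by nng.
  rewrite /env big_ord_recr/= addrA.
  apply: (le_trans (pow8_sum2 _ _)).
  by rewrite -[`|e N w| ^+ 8]normrX [`|_ ^+ 8|]ger0_norm//; nng.
- have -> : EFin \o g = (fun w => 128%:E * ((EFin \o (fun w => env N w ^+ 8)%R) \+
    (EFin \o (fun w => e N w ^+ 8)%R)) w)%E by [].
  by apply: (integrableZl measurableT); apply: (integrableD measurableT).
Qed.

Lemma dg_le N j k f : (j <= k)%N -> dg N j f -> dg N k f.
Proof.
move=> jk h; have [C C0 hC] := dg_bound h; split; first by case: h.
exists C => w; apply: (le_trans (hC w)); rewrite ler_wpM2l//.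
by rewrite ler_weXn2l// env_ge1.
Qed.

Lemma dg_cst N c : dg N 0 (fun=> c).
Proof. by split; [exact: measurable_cst|exists `|c| => w; rewrite expr0 mulr1]. Qed.

Lemma dg_var N s : (s < N)%N -> dg N 1 (e s).
Proof.
move=> sN; split; first exact: measurable_funP.
exists 1 => w; rewrite expr1 mul1r /env (bigD1 (Ordinal sN))//= addrCA lerDl.
by rewrite addr_ge0// sumr_ge0.
Qed.

Lemma dgD N k f g : dg N k f -> dg N k g -> dg N k (fun w => f w + g w).
Proof.
move=> [mf [C hC]] [mg [D hD]]; split; first exact: measurable_funD.
by exists (C + D) => w; rewrite mulrDl (le_trans (ler_normD _ _))// lerD.
Qed.

Lemma dgM N j k f g : dg N j f -> dg N k g -> dg N (j + k) (fun w => f w * g w).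
Proof.
move=> [mf [C hC]] [mg [D hD]]; split; first exact: measurable_funM.
by exists (C * D) => w; rewrite normrM exprD mulrACA ler_pM.
Qed.

Lemma dgZ N k c f : dg N k f -> dg N k (fun w => c * f w).
Proof. by move=> hf; have := dgM (dg_cst N c) hf. Qed.

Lemma dgB N k f g : dg N k f -> dg N k g -> dg N k (fun w => f w - g w).
Proof.
move=> hf hg; have := dgD hf (dgZ (-1) hg).
by under eq_fun do rewrite mulN1r.
Qed.

Lemma dgX N k f n : dg N k f -> dg N (k * n) (fun w => f w ^+ n).
Proof.
move=> [mf [C hC]]; split; first exact: measurable_funX.
exists (C ^+ n) => w; rewrite normrX exprM -exprMn; apply: lerXn2r => //.
by rewrite nnegrE (le_trans _ (hC w)).
Qed.

Lemma dg_norm N k f : dg N k f -> dg N k (fun w => `|f w|).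
Proof.
move=> [mf [C hC]]; split; first exact: measurableT_comp.
by exists C => w; rewrite normr_id.
Qed.

Lemma dg_sum N k I (r : seq I) (Q : pred I) (F : I -> T -> R) :
  (forall i, Q i -> dg N k (F i)) -> dg N k (fun w => \sum_(i <- r | Q i) F i w).
Proof.
move=> h; elim: r => [|i r IH].
  under eq_fun do rewrite big_nil.
  exact: (dg_le (leq0n _) (dg_cst _ _)).
under eq_fun do rewrite big_cons.
by case Qi: (Q i) => //; apply: dgD IH; exact: h.
Qed.

Lemma dg_int N k f : (k <= 8)%N -> dg N k f -> P.-integrable setT (EFin \o f).
Proof.
move=> k8 /(dg_le k8) h; have [C C0 hC] := dg_bound h.
apply: (@le_integrable _ _ _ _ _ _ _ (EFin \o (fun w => C * env N w ^+ 8))) => //.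
- by apply/measurable_EFinP; case: h.
- by move=> w _; rewrite /= lee_fin; exact: (le_trans (hC w) (ler_norm _)).
- have -> : EFin \o (fun w => C * env N w ^+ 8) =
    (fun w => C%:E * (EFin \o (fun w => env N w ^+ 8)%R) w)%E by [].
  by apply: (integrableZl measurableT); exact: integrable_env8.
Qed.

Lemma ExD N f g : dg N 8 f -> dg N 8 g ->
  'Ex[fun w => f w + g w] = 'Ex[f] + 'Ex[g].
Proof. by move=> hf hg; rewrite RintegralD//; [exact: (dg_int (leqnn 8) hf)|exact: (dg_int (leqnn 8) hg)]. Qed.

Lemma ExB N f g : dg N 8 f -> dg N 8 g ->
  'Ex[fun w => f w - g w] = 'Ex[f] - 'Ex[g].
Proof. by move=> hf hg; rewrite RintegralB//; [exact: (dg_int (leqnn 8) hf)|exact: (dg_int (leqnn 8) hg)]. Qed.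

Lemma ExZ N c f : dg N 8 f -> 'Ex[fun w => c * f w] = c * 'Ex[f].
Proof. by move=> hf; rewrite RintegralZl//; exact: (dg_int (leqnn 8) hf). Qed.

Lemma Ex_cst c : 'Ex[fun=> c] = c.
Proof. by rewrite Rintegral_cst// [X in fine X](_ : _ = 1%E) ?mulr1//; exact: probability_setT. Qed.

Lemma Ex_le N f g : dg N 8 f -> dg N 8 g -> (forall w, f w <= g w) ->
  'Ex[f] <= 'Ex[g].
Proof. by move=> hf hg fg; apply: le_Rintegral => //; [exact: (dg_int (leqnn 8) hf)|exact: (dg_int (leqnn 8) hg)]. Qed.

Lemma Ex_ge0 f : (forall w, 0 <= f w) -> 0 <= 'Ex[f].
Proof. by move=> f0; exact: Rintegral_ge0. Qed.

Lemma Ex_sum N I (r : seq I) (F : I -> T -> R) :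
  (forall i, dg N 8 (F i)) ->
  'Ex[fun w => \sum_(i <- r) F i w] = \sum_(i <- r) 'Ex[F i].
Proof.
move=> h; elim: r => [|i r IH].
  by under eq_Rintegral do rewrite big_nil; rewrite big_nil Ex_cst.
under eq_Rintegral do rewrite big_cons.
by rewrite (@ExD N) ?IH ?big_cons//; exact: dg_sum.
Qed.

(** Induction on m. Of the cross terms in (S + X)^4 only S^3 X must vanish in mean; the others are
    absorbed into S^4 and X^4 by Young's inequality. *)
Lemma martingale_moment4 N m (X : nat -> T -> R) (mu : R) : 0 <= mu ->
  (forall i, (i < m)%N -> dg N 2 (X i)) ->
  (forall i, (i < m)%N -> 'Ex[fun w => (\sum_(j < i) X j w) ^+ 3 * X i w] = 0) ->
  (forall i, (i < m)%N -> 'Ex[fun w => X i w ^+ 4] <= mu) ->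
  'Ex[fun w => (\sum_(j < m) X j w) ^+ 4] <= 16 * m%:R ^+ 2 * mu.
Proof.
move=> mu0; elim: m => [|m IH] dX hX0 hX4.
  under eq_Rintegral do rewrite big_ord0 expr0n/=.
  by rewrite Ex_cst expr0n/= mulr0 mul0r.
have dS : dg N 2 (fun w => \sum_(j < m) X j w).
  by apply: dg_sum => j _; apply: dX; rewrite ltnW// ltnS ltn_ord.
have dXm := dX _ (ltnSn m).
have {}IH := IH (fun i im => dX i (ltnW im)) (fun i im => hX0 i (ltnW im))
  (fun i im => hX4 i (ltnW im)).
set S := fun w => \sum_(j < m) X j w in dS.
have dS4 : dg N 8 (fun w => S w ^+ 4) by exact: (dgX 4 dS).
have dX4 : dg N 8 (fun w => X m w ^+ 4) by exact: (dgX 4 dXm).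
have dS3 : dg N 8 (fun w => S w ^+ 3 * X m w) by exact: (dgM (dgX 3 dS) dXm).
case: (posnP m) => [m0|mp].
  have E0 w : \sum_(j < m.+1) X j w = X m w.
    by rewrite big_ord_recr/= big1 ?add0r// => -[j]; rewrite m0.
  under eq_Rintegral do rewrite E0.
  by have := hX4 _ (ltnSn m); rewrite (_ : m.+1%:R = 1 :> R) ?m0//; lra.
(* With l = 4m the old bound grows by the factor 1 + 1/m, that is by 16 m mu, and the new term costs
   (16 m + 3) mu; together this stays below the increment 16 (2m + 1) mu. *)
have [l [l0 lE]] : exists l : R, 0 < l /\ l = 4 * m%:R.
  by exists (4 * m%:R); rewrite mulr_gt0 ?ltr0n.
pose G w := (1 + 4 / l) * S w ^+ 4 + (4 * (S w ^+ 3 * X m w) + (4 * l + 3) * X m w ^+ 4).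
have dG : dg N 8 G by apply: dgD; [exact: dgZ|apply: dgD; exact: dgZ].
have le1 : 'Ex[fun w => (\sum_(j < m.+1) X j w) ^+ 4] <= 'Ex[G].
  apply: (@Ex_le N) => //.
    by apply: (@dgX N 2 _ 4); apply: dg_sum => j _; exact: dX.
  move=> w; rewrite big_ord_recr/= -/(S w) /G.
  set s := S w; set x := X m w.
  (* This square bounds 8 s^2 x^2 by (4 / l) s^4 + 4 l x^4; the square [h2] reduces 4 s x^3 to s^2
     x^2 and x^4. *)
  have h1 : 0 <= (2 * s ^+ 2 - 2 * l * x ^+ 2) ^+ 2 / l.
    by rewrite mulr_ge0 ?sqr_ge0// invr_ge0 ltW.
  have h1' : (2 * s ^+ 2 - 2 * l * x ^+ 2) ^+ 2 / l =
     4 / l * s ^+ 4 - 8 * s ^+ 2 * x ^+ 2 + 4 * l * x ^+ 4.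
    by field; rewrite gt_eqF.
  have h2 : 0 <= (s * x - x ^+ 2) ^+ 2 by exact: sqr_ge0.
  rewrite h1' in h1; lra.
have EG : 'Ex[G] = (1 + 4 / l) * 'Ex[fun w => S w ^+ 4] + (4 * l + 3) * 'Ex[fun w => X m w ^+ 4].
  have d1 := dgZ (1 + 4 / l) dS4; have d2 := dgZ 4 dS3.
  have d3 := dgZ (4 * l + 3) dX4.
  rewrite (ExD d1 (dgD d2 d3)) (ExD d2 d3) (ExZ _ dS4) (ExZ _ dS3) (ExZ _ dX4).
  by rewrite (hX0 _ (ltnSn m)) mulr0 add0r.
apply: (le_trans le1); rewrite EG.
have hX4m := hX4 _ (ltnSn m).
have a1 : (4 * l + 3) * 'Ex[fun w => X m w ^+ 4] <= (4 * l + 3) * mu.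
  by rewrite ler_wpM2l// addr_ge0// mulr_ge0// ltW.
have a2 : (1 + 4 / l) * 'Ex[fun w => S w ^+ 4] <= (1 + 4 / l) * (16 * m%:R ^+ 2 * mu).
  by rewrite ler_wpM2l// addr_ge0// divr_ge0// ltW.
have mr0 : 0 < m%:R :> R by rewrite ltr0n.
have a3 : (1 + 4 / l) * (16 * m%:R ^+ 2 * mu) = 16 * m%:R ^+ 2 * mu + 16 * m%:R * mu.
  by rewrite lE; field; rewrite gt_eqF.
have a4 : (4 * l + 3) * mu = 16 * m%:R * mu + 3 * mu by rewrite lE; ring.
rewrite -[m.+1]addn1 natrD.
lra.
Qed.

End Degree.

(** * Moments of the sample autocovariances *)

Section Moments.
Context d (T : measurableType d) (R : realType) (P : probability T R).
Variable e : nat -> {RV P >-> R}.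
Variables (s2 mu rho : R).
Implicit Types (f g : T -> R) (N k j : nat).
Local Notation "''Ex' [ f ]" := (\int[P]_w (f w)) (format "''Ex' [ f ]").
Notation past_fun := (past_fun (fun t => e t.+1)).
Notation dg := (dg e).

Hypothesis e8 : forall t, P.-integrable setT (EFin \o (fun w => e t w ^+ 8)).
Hypothesis e_0 : forall w, e 0%N w = 0.
Hypothesis inde : mutually_independent (fun t => e t.+1).
Hypothesis mean0 : forall t, 'Ex[e t.+1] = 0.
Hypothesis var2 : forall t, 'Ex[fun w => e t.+1 w ^+ 2] = s2.
Hypothesis mom8 : forall t, 'Ex[fun w => e t w ^+ 8] <= mu.

Lemma past_fun_cst N c : past_fun N (fun=> c).
Proof. exact: measurable_cst. Qed.

Lemma past_fun_var N s : (s <= N)%N -> past_fun N (e s).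
Proof.
case: s => [_|s sN].
  by rewrite (_ : (e 0%N : T -> R) = fun=> 0); [exact: past_fun_cst|apply/funext => w; exact: e_0].
move=> _ B mB; rewrite setTI; apply: sub_sigma_algebra.
by exists s, B.
Qed.

Lemma past_funD N f g : past_fun N f -> past_fun N g -> past_fun N (fun w => f w + g w).
Proof. exact: measurable_funD. Qed.
Lemma past_funM N f g : past_fun N f -> past_fun N g -> past_fun N (fun w => f w * g w).
Proof. exact: measurable_funM. Qed.
Lemma past_funB N f g : past_fun N f -> past_fun N g -> past_fun N (fun w => f w - g w).
Proof. exact: measurable_funB. Qed.
Lemma past_funX N f n : past_fun N f -> past_fun N (fun w => f w ^+ n).
Proof. exact: measurable_funX. Qed.
Lemma past_fun_sum N I (r : seq I) (F : I -> T -> R) :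
  (forall i, past_fun N (F i)) -> past_fun N (fun w => \sum_(i <- r) F i w).
Proof. by move=> h; apply: measurable_sum. Qed.

Lemma mom8_ge0 : 0 <= mu.
Proof.
by apply: le_trans (mom8 0); apply: Ex_ge0 => w; rewrite exprn_even_ge0.
Qed.

(** The degree of f leaves room for one further innovation within eighth moments. *)
Lemma Ex_innov N M f : past_fun N f -> (N.+1 < M)%N -> dg M 7 f ->
  'Ex[fun w => f w * e N.+1 w] = 0.
Proof.
move=> pf NM df; have de := dg_var e NM.
have := past_indep_integral inde pf (@measurable_id _ _ setT).
move=> /(_ (dg_int e8 _ df) (dg_int e8 _ de) (dg_int e8 _ (dgM df de))) ->//.
by rewrite mean0 mulr0.
Qed.

Lemma Ex_innov2 N M f : past_fun N f -> (N.+1 < M)%N -> dg M 6 f ->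
  'Ex[fun w => f w * e N.+1 w ^+ 2] = s2 * 'Ex[f].
Proof.
move=> pf NM df; have de := dgX 2 (dg_var e NM).
have mX : measurable_fun [set: R] (fun x : R => x ^+ 2) by exact: measurable_funX.
have := past_indep_integral inde pf mX.
move=> /(_ (dg_int e8 _ df) (dg_int e8 _ de) (dg_int e8 _ (dgM df de))) ->//.
by rewrite var2 mulrC.
Qed.

Lemma s2_ge0 : 0 <= s2.
Proof. by rewrite -(var2 0); apply: Ex_ge0 => w; rewrite sqr_ge0. Qed.

(** The centring is present only when [e (k.+1 - i)] is a genuine innovation and not a zero initial
    value. *)
Definition acov_incr i j k w : R :=
  e (k.+1 - i)%N w * e (k.+1 - j)%N w - (i == j)%:R * (s2 * (i < k.+1)%:R).

Lemma acov_sum n i j w :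
  acov s2 (e ^~ w) n i j = \sum_(k < n) acov_incr i j k w.
Proof.
rewrite sumrB /acov big_add1 big_mkord; congr (_ - _).
rewrite -mulr_sumr -mulr_sumr; congr (_ * (_ * _)).
elim: n => [|n IH]; first by rewrite big_ord0 sub0n.
rewrite big_ord_recr/= -IH ltnS; case: leqP => ni.
  by rewrite subSn// -[(n - i).+1]addn1 natrD.
by rewrite addr0 (_ : (n.+1 - i = n - i)%N)//; lia.
Qed.

Lemma acovC (x : nat -> R) n i j : acov s2 x n i j = acov s2 x n j i.
Proof.
rewrite /acov; case: (eqVneq i j) => [->//|ij].
rewrite !mul0r; congr (_ - _).
by apply: eq_bigr => t _; rewrite mulrC.
Qed.

Lemma dg_acov_incr n i j k : (k < n)%N -> dg n.+1 2 (acov_incr i j k).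
Proof.
move=> kn; apply: dgB; last exact: (dg_le (leq0n _) (dg_cst _ _ _)).
by apply: (@dgM _ _ _ _ _ _ 1 1); apply: dg_var; rewrite ltnS (leq_trans (leq_subr _ _)).
Qed.

Lemma Ex_mul4 s t : 'Ex[fun w => (e s w * e t w) ^+ 4] <= 2 * mu.
Proof.
pose N := (maxn s t).+1.
have ds : dg N 1 (e s) by apply: dg_var; rewrite ltnS leq_maxl.
have dt : dg N 1 (e t) by apply: dg_var; rewrite ltnS leq_maxr.
have d1 := dgX 4 (dgM ds dt); have d2 := dgX 8 ds; have d3 := dgX 8 dt.
apply: (le_trans (Ex_le e8 d1 (dgD d2 d3) _)).
  move=> w /=; rewrite exprMn; set x := e s w; set y := e t w.
  have := sqr_ge0 (x ^+ 4 - y ^+ 4); have := sqr_ge0 (x ^+ 4); have := sqr_ge0 (y ^+ 4).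
  rewrite (_ : (x ^+ 4 - y ^+ 4) ^+ 2 = (x ^+ 4) ^+ 2 + (y ^+ 4) ^+ 2 - 2 * (x ^+ 4 * y ^+ 4)); last by ring.
  rewrite -!exprM; lra.
rewrite (ExD e8 d2 d3); have := mom8 s; have := mom8 t; lra.
Qed.

(** By symmetry i <= j, so e_{k+1-i} is the later factor. The increments are then martingale
    differences with respect to the innovations up to time k - i. *)
Lemma acov_moment4 n i j :
  'Ex[fun w => acov s2 (e ^~ w) n i j ^+ 4] <= 16 * n%:R ^+ 2 * (8 * (2 * mu + s2 ^+ 4)).
Proof.
wlog ij : i j / (i <= j)%N.
  move=> h; case: (leqP i j) => [|/ltnW] /h//.
  by under [in X in X -> _]eq_Rintegral do rewrite acovC.
under eq_Rintegral do rewrite acov_sum.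
have mu0 := mom8_ge0.
apply: (martingale_moment4 e8 (N := n.+1)) => [|k kn|k kn|k kn].
- by rewrite mulr_ge0// addr_ge0 ?exprn_even_ge0// mulr_ge0.
- exact: dg_acov_incr.
(* For k + 1 <= j the factor e_{k+1-j} is an initial value, and the whole increment vanishes. *)
- have [kj|jk] := leqP k.+1 j.
    under eq_Rintegral => w _.
      rewrite (_ : acov_incr i j k w = 0) ?mulr0; first by over.
      rewrite /acov_incr (_ : (k.+1 - j = 0)%N) ?e_0 ?mulr0; last by lia.
      case: eqP => [->|_]; last by rewrite mul0r subr0.
      by rewrite ltnNge kj/= !mulr0 subr0.
    by rewrite Ex_cst.
  have kiE : (k.+1 - i = (k - i).+1)%N by lia.
  pose S w := \sum_(l < k) acov_incr i j l w.
  have pS : past_fun (k - i) S.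
    apply: past_fun_sum => l; apply: past_funB; last exact: past_fun_cst.
    by apply: past_funM; apply: past_fun_var; have := ltn_ord l; lia.
  have dS : dg n.+1 2 S.
    by apply: dg_sum => l _; apply: dg_acov_incr; rewrite (ltn_trans _ kn).
  have kn1 : ((k - i).+1 < n.+1)%N by lia.
  have [eij|nij] := eqVneq i j.
    subst j.
    have d3 := dgX 3 dS.
    have d1 := dgM d3 (dgX 2 (dg_var e kn1)).
    under eq_Rintegral => w _.
      rewrite -/(S w) /acov_incr eqxx mul1r jk mulr1 kiE -expr2 mulrBr [X in _ - X]mulrC; over.
    have d2 := dgZ s2 d3.
    rewrite (ExB e8 d1 (dg_le _ d2))// (ExZ e8 _ (dg_le _ d3))//.
    by rewrite (Ex_innov2 (past_funX 3 pS) kn1 d3) subrr.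
  have lt : (k.+1 - j < n.+1)%N by lia.
  under eq_Rintegral => w _.
    rewrite -/(S w) /acov_incr (negbTE nij) mul0r subr0 [e _ _ * _]mulrC mulrA kiE; over.
  apply: (Ex_innov _ kn1 (dgM (dgX 3 dS) (dg_var e lt))).
  apply: past_funM; first exact: past_funX.
  by apply: past_fun_var; lia.
- pose c : R := (i == j)%:R * (s2 * (i < k.+1)%:R).
  have kn1 : (k.+1 - i < n.+1)%N by lia.
  have kn2 : (k.+1 - j < n.+1)%N by lia.
  have d1 := dgX 4 (dgM (dg_var e kn1) (dg_var e kn2)).
  have dc := dg_le (leq0n 8) (dg_cst e n.+1 (c ^+ 4)).
  apply: (le_trans (Ex_le e8 (dgX 4 (dg_acov_incr i j kn)) (dgZ 8 (dgD d1 dc)) _)).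
    move=> w /=; rewrite /acov_incr -/c; have := pow4_sum2 (e (k.+1 - i)%N w * e (k.+1 - j)%N w) (- c).
    by rewrite (_ : (- c) ^+ 4 = c ^+ 4); last by ring.
  rewrite (ExZ e8 _ (dgD d1 dc)) (ExD e8 d1 dc) Ex_cst ler_wpM2l// lerD//.
    exact: Ex_mul4.
  have s20 := s2_ge0.
  rewrite /c; apply: lerXn2r; rewrite ?nnegrE ?mulr_ge0//.
  by case: (i == j); case: (i < k.+1)%N; rewrite ?mul1r ?mul0r ?mulr1 ?mulr0.
Qed.

Lemma dg_acov n i j : dg n.+1 2 (fun w => acov s2 (e ^~ w) n i j).
Proof.
under eq_fun do rewrite acov_sum.
by apply: dg_sum => k _; exact: dg_acov_incr.
Qed.

Lemma dg_acov_dev n : dg n.+1 2 (fun w => acov_dev s2 rho (e ^~ w) n).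
Proof.
apply: dgZ; apply: dg_sum => i _; apply: dg_sum => j _; apply: dgZ.
by apply: dg_norm; exact: dg_acov.
Qed.

Lemma dg_past_size n : dg n.+2 1 (fun w => past_size rho (e ^~ w) n).
Proof.
apply: dg_sum => m _; apply: dgZ; apply: dg_norm; apply: dg_var.
by rewrite ltnS leq_subr.
Qed.

Lemma dg_wide N M k f : (N <= M)%N -> dg N k f -> dg M k f.
Proof.
move=> NM h; have [C C0 hC] := dg_bound h; split; first by case: h.
exists C => w; apply: (le_trans (hC w)); rewrite ler_wpM2l//.
apply: lerXn2r; [by rewrite nnegrE ltW// env_gt0|by rewrite nnegrE ltW// env_gt0|].
rewrite /env lerD2l -!(big_mkord xpredT (fun s => `|e s w|)).
by rewrite [leRHS](big_cat_nat (n := N))//= lerDl sumr_ge0.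
Qed.

Hypothesis rho0 : 0 < rho.
Hypothesis rho1 : rho < 1.

(** The bound on the fourth moment of one increment obtained in [acov_moment4]. *)
Definition mu4 : R := 8 * (2 * mu + s2 ^+ 4).
Definition geo_mass : R := (1 - rho)^-1.

Lemma geo_mass_ge0 : 0 <= geo_mass.
Proof. by rewrite invr_ge0 subr_ge0 ltW. Qed.

(** Convexity moves the fourth power inside the sums over i and j. Each sum costs three powers of
    [geo_mass] for this and one more for the remaining weights, and the factor n^2 cancels against
    the normalisation. *)
Lemma acov_dev_moment4 n : (0 < n)%N ->
  'Ex[fun w => acov_dev s2 rho (e ^~ w) n ^+ 4] <= geo_mass ^+ 8 * (16 * mu4).
Proof.
move=> n0; have rm i : 0 <= rho ^+ i by rewrite exprn_ge0// ltW.
have hG := geo_sum_le rho0 rho1 n.+1; rewrite -/geo_mass in hG.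
have A0 : 0 <= \sum_(i < n.+1) rho ^+ i by exact: sumr_ge0.
have G0 := geo_mass_ge0.
have hG3 : (\sum_(i < n.+1) rho ^+ i) ^+ 3 <= geo_mass ^+ 3 by apply: lerXn2r.
have nr : 0 < n%:R :> R by rewrite ltr0n.
have dH i j : dg n.+1 8 (fun w => acov s2 (e ^~ w) n i j ^+ 4) by exact: (dgX 4 (dg_acov n i j)).
pose B w := (n%:R ^+ 2)^-1 * (geo_mass ^+ 3 * (geo_mass ^+ 3 *
  \sum_(i < n.+1) rho ^+ i * \sum_(j < n.+1) rho ^+ j * acov s2 (e ^~ w) n i j ^+ 4)).
have dB0 : dg n.+1 8 (fun w => \sum_(i < n.+1) rho ^+ i * \sum_(j < n.+1) rho ^+ j * acov s2 (e ^~ w) n i j ^+ 4).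
  by apply: dg_sum => i _; apply: dgZ; apply: dg_sum => j _; apply: dgZ; exact: dH.
have dB : dg n.+1 8 B by do 3!apply: dgZ.
apply: (le_trans (Ex_le e8 (dgX 4 (dg_acov_dev n)) dB _)).
  move=> w /=; rewrite /acov_dev exprMn /B.
  rewrite (_ : (Num.sqrt n%:R)^-1 ^+ 4 = (n%:R ^+ 2)^-1); last first.
    by rewrite exprVn (exprM _ 2 2) sqr_sqrtr// ltW.
  apply: ler_wpM2l; first by rewrite invr_ge0 exprn_ge0// ltW.
  under eq_bigr do under eq_bigr do rewrite -mulrA.
  under eq_bigr do rewrite -mulr_sumr.
  apply: (le_trans (pow4_mean _ _)) => //.
  apply: ler_pM; [exact: exprn_ge0|by apply: sumr_ge0 => ? _; nng|by []|].
  rewrite [leRHS]mulr_sumr; apply: ler_sum => i _.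
  rewrite [leRHS]mulrCA ler_wpM2l//.
  apply: (le_trans (pow4_mean _ _)) => //.
  apply: ler_pM; [exact: exprn_ge0|by apply: sumr_ge0 => ? _; nng|by []|].
  apply: ler_sum => j _; rewrite ler_wpM2l// -normrX ger0_norm//; nng.
have dj i : dg n.+1 8 (fun w => \sum_(j < n.+1) rho ^+ j * acov s2 (e ^~ w) n i j ^+ 4).
  by apply: dg_sum => j _; apply: dgZ; exact: dH.
have mu40' : 0 <= mu4.
  have := mom8_ge0; have := exprn_even_ge0 s2 (isT : ~~ odd 4).
  by move=> *; rewrite /mu4 mulr_ge0// addr_ge0// mulr_ge0.
rewrite /B (ExZ e8 _ (dgZ _ (dgZ _ dB0))) (ExZ e8 _ (dgZ _ dB0)) (ExZ e8 _ dB0).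
rewrite (Ex_sum e8 (N := n.+1)); last by move=> i; apply: dgZ.
apply: (@le_trans _ _ ((n%:R ^+ 2)^-1 * (geo_mass ^+ 3 * (geo_mass ^+ 3 * (geo_mass * (geo_mass * (16 * n%:R ^+ 2 * mu4))))))); last first.
  by rewrite le_eqVlt; apply/orP; left; apply/eqP; field; rewrite gt_eqF.
apply: ler_wpM2l; first by rewrite invr_ge0 exprn_ge0// ltW.
do 2!(apply: ler_wpM2l; first by rewrite exprn_ge0).
have mu40 : 0 <= 16 * n%:R ^+ 2 * mu4 by nng.
apply: (@le_trans _ _ (\sum_(i < n.+1) rho ^+ i * (geo_mass * (16 * n%:R ^+ 2 * mu4)))); last first.
  by rewrite -mulr_suml ler_wpM2r// mulr_ge0.
apply: ler_sum => i _; rewrite (ExZ e8 _ (dj i)) ler_wpM2l//.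
rewrite (Ex_sum e8 (N := n.+1)); last by move=> j; apply: dgZ; exact: dH.
apply: (@le_trans _ _ (\sum_(j < n.+1) rho ^+ j * (16 * n%:R ^+ 2 * mu4))); last first.
  by rewrite -mulr_suml ler_wpM2r.
by apply: ler_sum => j _; rewrite (ExZ e8 _ (dH i j)) ler_wpM2l// acov_moment4.
Qed.

Lemma past_size_moment8 n :
  'Ex[fun w => past_size rho (e ^~ w) n ^+ 8] <= geo_mass ^+ 8 * mu.
Proof.
have rm i : 0 <= rho ^+ i by rewrite exprn_ge0// ltW.
have hG := geo_sum_le rho0 rho1 n.+1; rewrite -/geo_mass in hG.
have A0 : 0 <= \sum_(i < n.+1) rho ^+ i by exact: sumr_ge0.
have G0 := geo_mass_ge0; have mu0 := mom8_ge0.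
have hG7 : (\sum_(i < n.+1) rho ^+ i) ^+ 7 <= geo_mass ^+ 7 by apply: lerXn2r.
have de (m : 'I_n.+1) : dg n.+2 8 (fun w => e (n.+1 - m)%N w ^+ 8).
  have h : (n.+1 - m < n.+2)%N by rewrite ltnS leq_subr.
  exact: (dgX 8 (dg_var e h)).
pose B w := geo_mass ^+ 7 * \sum_(m < n.+1) rho ^+ m * e (n.+1 - m)%N w ^+ 8.
have dB0 : dg n.+2 8 (fun w => \sum_(m < n.+1) rho ^+ m * e (n.+1 - m)%N w ^+ 8).
  by apply: dg_sum => m _; apply: dgZ.
apply: (le_trans (Ex_le e8 (dgX 8 (dg_past_size n)) (dgZ (geo_mass ^+ 7) dB0) _)).
  move=> w /=; apply: (le_trans (pow8_mean _ _)) => //.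
  apply: ler_pM; [exact: exprn_ge0|by apply: sumr_ge0 => ? _; nng|by []|].
  apply: ler_sum => i _; rewrite ler_wpM2l// -normrX ger0_norm//; nng.
rewrite (ExZ e8 _ dB0) (Ex_sum e8 (N := n.+2)); last by move=> m; exact: dgZ.
rewrite (_ : geo_mass ^+ 8 * mu = geo_mass ^+ 7 * (geo_mass * mu)); last by rewrite mulrA -exprSr.
rewrite ler_wpM2l ?exprn_ge0//.
apply: (@le_trans _ _ (\sum_(m < n.+1) rho ^+ m * mu)); last first.
  by rewrite -mulr_suml ler_wpM2r.
by apply: ler_sum => m _; rewrite (ExZ e8 _ (de m)) ler_wpM2l.
Qed.

(** Distinguish K <= Z^2 from K > Z^2: in the first case K^3 Z^2 <= Z^8, in the second it is at most
    K^4. *)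
Lemma error_moment n : (0 < n)%N ->
  'Ex[fun w => acov_dev s2 rho (e ^~ w) n ^+ 3 * past_size rho (e ^~ w) n ^+ 2]
  <= geo_mass ^+ 8 * (16 * mu4) + geo_mass ^+ 8 * mu.
Proof.
move=> n0.
have dK := dg_wide (leqnSn n.+1) (dg_acov_dev n); have dX := dg_past_size n.
have d1 : dg n.+2 8 _ := dgX 4 dK; have d2 : dg n.+2 8 _ := dgX 8 dX.
apply: (le_trans (Ex_le e8 (dgM (dgX 3 dK) (dgX 2 dX)) (dgD d1 d2) _)).
  move=> w /=; set x := acov_dev _ _ _ _; set y := past_size _ _ _.
  have x0 : 0 <= x by exact: acov_dev_ge0.
  have y0 : 0 <= y by exact: past_size_ge0.
  have [xy|/ltW yx] := leP x (y ^+ 2).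
    apply: ler_wpDl; first by rewrite exprn_ge0.
    rewrite (_ : y ^+ 8 = (y ^+ 2) ^+ 3 * y ^+ 2); last by ring.
    by rewrite ler_wpM2r ?exprn_ge0//; apply: lerXn2r; rewrite ?nnegrE ?exprn_ge0.
  apply: ler_wpDr; first by rewrite exprn_ge0.
  by rewrite [x ^+ 4]exprSr ler_wpM2l ?exprn_ge0.
rewrite (ExD e8 d1 d2) lerD ?past_size_moment8//.
exact: acov_dev_moment4.
Qed.

End Moments.

(** * Linear processes and the score *)

Section LinearProcess.
Context d (T : measurableType d) (R : realType) (P : probability T R).
Variable e : nat -> {RV P >-> R}.
Variables (s2 mu : R).
Implicit Types (f g Q : T -> R) (N k j t : nat) (u v : nat -> R).
Local Notation "''Ex' [ f ]" := (\int[P]_w (f w)) (format "''Ex' [ f ]").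
Notation past_fun := (past_fun (fun t => e t.+1)).
Notation dg := (dg e).

Hypothesis e8 : forall t, P.-integrable setT (EFin \o (fun w => e t w ^+ 8)).
Hypothesis e_0 : forall w, e 0%N w = 0.
Hypothesis inde : mutually_independent (fun t => e t.+1).
Hypothesis mean0 : forall t, 'Ex[e t.+1] = 0.
Hypothesis var2 : forall t, 'Ex[fun w => e t.+1 w ^+ 2] = s2.
Hypothesis mom8 : forall t, 'Ex[fun w => e t w ^+ 8] <= mu.

(** The sum stops at the first observation, so in contrast to [flt] it does not refer to the sample
    size. *)
Definition lin_proc u t (w : T) : R := \sum_(m < t) u m * e (t - m)%N w.
Definition score_sum u a m (w : T) : R := \sum_(j < m) e (a + j).+1 w * lin_proc u (a + j).+1 w.

Lemma flt_lin_proc u n t w : (t <= n.+1)%N -> flt (e ^~ w) n u t = lin_proc u t w.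
Proof.
move=> tn; rewrite /flt /lin_proc -!(big_mkord xpredT (fun m => u m * e (t - m)%N w)).
rewrite (big_cat_nat (n := t))//= [X in _ + X]big_nat_cond [X in _ + X]big1 ?addr0//.
by move=> m /andP[/andP[tm _] _]; rewrite (_ : (t - m = 0)%N) ?e_0 ?mulr0//; lia.
Qed.

Lemma dg_lin_proc u t N : (t < N)%N -> dg N 1 (lin_proc u t).
Proof.
move=> tN; apply: dg_sum => m _; apply: dgZ; apply: dg_var.
by rewrite (leq_ltn_trans (leq_subr _ _)).
Qed.

Lemma dg_score_sum u a m N : (a + m < N)%N -> dg N 2 (score_sum u a m).
Proof.
move=> h; apply: dg_sum => j _; have := ltn_ord j => jm.
by apply: (@dgM _ _ _ _ _ _ 1 1); [apply: dg_var|apply: dg_lin_proc]; lia.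
Qed.

(** [u 0 = 0] removes the innovation of time t itself; this makes the process predictable. *)
Lemma past_fun_lin_proc u t N : u 0%N = 0 -> (t <= N.+1)%N -> past_fun N (lin_proc u t).
Proof.
move=> u0 tN; apply: past_fun_sum => -[[|m] mt]/=.
  rewrite (_ : (fun w => _) = fun=> 0); first exact: past_fun_cst.
  by apply/funext => w; rewrite /= u0 mul0r.
by apply: past_funM; [exact: past_fun_cst|apply: past_fun_var => //; lia].
Qed.

Lemma past_fun_score_sum u a m N : u 0%N = 0 -> (a + m <= N)%N -> past_fun N (score_sum u a m).
Proof.
move=> u0 h; apply: past_fun_sum => j; have := ltn_ord j => jm.
by apply: past_funM; [apply: past_fun_var => //|apply: past_fun_lin_proc => //]; lia.
Qed.

Lemma Ex_mom4 t : 'Ex[fun w => e t w ^+ 4] <= 1 + mu.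
Proof.
have de : dg t.+1 1 (e t) := dg_var e (ltnSn t).
have d8 := dgX 8 de; have d1 := dg_le (leq0n 8) (dg_cst e t.+1 1).
have d4 : dg t.+1 8 (fun w => e t w ^+ 4) := dg_le (isT : (1 * 4 <= 8)%N) (dgX 4 de).
apply: (le_trans (Ex_le e8 d4 (dgD d1 d8) _)).
  move=> w /=; set x := e t w; have := sqr_ge0 (x ^+ 4 - 1); have := sqr_ge0 (x ^+ 4).
  rewrite (_ : (x ^+ 4 - 1) ^+ 2 = x ^+ 8 + 1 - 2 * x ^+ 4); last by ring.
  rewrite (_ : (x ^+ 4) ^+ 2 = x ^+ 8); last by ring.
  lra.
by rewrite (ExD e8 d1 d8) Ex_cst lerD2l.
Qed.

Lemma lin_proc_abs_le u a t w : (forall m, `|u m| <= a m) ->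
  `|lin_proc u t w| <= \sum_(m < t) a m * `|e (t - m)%N w|.
Proof.
move=> ha; rewrite (le_trans (ler_norm_sum _ _ _))//.
by apply: ler_sum => m _; rewrite normrM ler_wpM2r.
Qed.

Lemma lin_proc_moment4 u a t W : (forall m, `|u m| <= a m) -> \sum_(m < t) a m <= W ->
  'Ex[fun w => lin_proc u t w ^+ 4] <= W ^+ 4 * (1 + mu).
Proof.
move=> ha hW.
have a0 m : 0 <= a m by apply: le_trans (ha m).
have A0 : 0 <= \sum_(m < t) a m by exact: sumr_ge0.
have W0 : 0 <= W by exact: le_trans hW.
have hW3 : (\sum_(m < t) a m) ^+ 3 <= W ^+ 3 by apply: lerXn2r.
have de (m : 'I_t) : dg t.+1 8 (fun w => e (t - m)%N w ^+ 4).
  have h : (t - m < t.+1)%N by rewrite ltnS leq_subr.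
  exact: (dg_le (isT : (1 * 4 <= 8)%N) (dgX 4 (dg_var e h))).
have dB0 : dg t.+1 8 (fun w => \sum_(m < t) a m * e (t - m)%N w ^+ 4).
  by apply: dg_sum => m _; apply: dgZ.
have dF : dg t.+1 8 (fun w => lin_proc u t w ^+ 4) :=
  dg_le (isT : (1 * 4 <= 8)%N) (dgX 4 (dg_lin_proc u (ltnSn t))).
apply: (le_trans (Ex_le e8 dF (dgZ (W ^+ 3) dB0) _)).
  move=> w /=; apply: (@le_trans _ _ ((\sum_(m < t) a m * `|e (t - m)%N w|) ^+ 4)).
    rewrite -[leLHS]ger0_norm; last by nng.
    rewrite normrX; apply: lerXn2r; rewrite ?nnegrE//.
      by apply: sumr_ge0 => m _; rewrite mulr_ge0.
    exact: lin_proc_abs_le.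
  apply: (le_trans (pow4_mean _ _)) => //.
  apply: ler_pM; [exact: exprn_ge0|by apply: sumr_ge0 => m _; nng|by []|].
  by apply: ler_sum => i _; rewrite ler_wpM2l// -normrX ger0_norm//; nng.
rewrite (ExZ e8 _ dB0) (Ex_sum e8 (N := t.+1)); last by move=> m; exact: dgZ.
rewrite (_ : W ^+ 4 * (1 + mu) = W ^+ 3 * (W * (1 + mu))); last by rewrite mulrA -exprSr.
have mu0 := mom8_ge0 mom8.
rewrite ler_wpM2l ?exprn_ge0//.
apply: (@le_trans _ _ (\sum_(m < t) a m * (1 + mu))); last first.
  by rewrite -mulr_suml ler_wpM2r// addr_ge0.
by apply: ler_sum => m _; rewrite (ExZ e8 _ (de m)) ler_wpM2l// Ex_mom4.
Qed.

Lemma lin_proc_moment8 u a t W : (forall m, `|u m| <= a m) -> \sum_(m < t) a m <= W ->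
  'Ex[fun w => lin_proc u t w ^+ 8] <= W ^+ 8 * mu.
Proof.
move=> ha hW.
have a0 m : 0 <= a m by apply: le_trans (ha m).
have A0 : 0 <= \sum_(m < t) a m by exact: sumr_ge0.
have W0 : 0 <= W by exact: le_trans hW.
have hW7 : (\sum_(m < t) a m) ^+ 7 <= W ^+ 7 by apply: lerXn2r.
have de (m : 'I_t) : dg t.+1 8 (fun w => e (t - m)%N w ^+ 8).
  have h : (t - m < t.+1)%N by rewrite ltnS leq_subr.
  exact: (dgX 8 (dg_var e h)).
have dB0 : dg t.+1 8 (fun w => \sum_(m < t) a m * e (t - m)%N w ^+ 8).
  by apply: dg_sum => m _; apply: dgZ.
have dF : dg t.+1 8 (fun w => lin_proc u t w ^+ 8) := dgX 8 (dg_lin_proc u (ltnSn t)).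
apply: (le_trans (Ex_le e8 dF (dgZ (W ^+ 7) dB0) _)).
  move=> w /=; apply: (@le_trans _ _ ((\sum_(m < t) a m * `|e (t - m)%N w|) ^+ 8)).
    rewrite -[leLHS]ger0_norm; last by nng.
    rewrite normrX; apply: lerXn2r; rewrite ?nnegrE//.
      by apply: sumr_ge0 => m _; rewrite mulr_ge0.
    exact: lin_proc_abs_le.
  apply: (le_trans (pow8_mean _ _)) => //.
  apply: ler_pM; [exact: exprn_ge0|by apply: sumr_ge0 => m _; nng|by []|].
  by apply: ler_sum => i _; rewrite ler_wpM2l// -normrX ger0_norm//; nng.
rewrite (ExZ e8 _ dB0) (Ex_sum e8 (N := t.+1)); last by move=> m; exact: dgZ.
rewrite (_ : W ^+ 8 * mu = W ^+ 7 * (W * mu)); last by rewrite mulrA -exprSr.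
have mu0 := mom8_ge0 mom8.
rewrite ler_wpM2l ?exprn_ge0//.
apply: (@le_trans _ _ (\sum_(m < t) a m * mu)); last first.
  by rewrite -mulr_suml ler_wpM2r.
by apply: ler_sum => m _; rewrite (ExZ e8 _ (de m)) ler_wpM2l.
Qed.

(** The summands are martingale differences because the process is predictable; (x y)^4 <= x^8 + y^8
    bounds their fourth moments. *)
Lemma score_sum_moment4 u a W s m : u 0%N = 0 -> (forall m, `|u m| <= a m) ->
  (forall t, \sum_(m < t) a m <= W) ->
  'Ex[fun w => score_sum u s m w ^+ 4] <= 16 * m%:R ^+ 2 * (mu + W ^+ 8 * mu).
Proof.
move=> u0 ha hW; have mu0 := mom8_ge0 mom8.
pose N := (s + m).+1.
have dF j : (j < m)%N -> dg N 1 (lin_proc u (s + j).+1) by move=> jm; apply: dg_lin_proc; rewrite /N; lia.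
have de j : (j < m)%N -> dg N 1 (e (s + j).+1) by move=> jm; apply: dg_var; rewrite /N; lia.
apply: (martingale_moment4 e8 (N := N)
  (X := fun j w => e (s + j).+1 w * lin_proc u (s + j).+1 w)) => [|j jm|j jm|j jm].
- by apply: addr_ge0 => //; apply: mulr_ge0 => //; nng.
- exact: dgM (de _ jm) (dF _ jm).
- rewrite -/(score_sum u s j _).
  under eq_Rintegral => w _ do rewrite -/(score_sum u s j w) [e _ _ * _]mulrC mulrA.
  have dM : dg N 2 (score_sum u s j) by apply: dg_score_sum; rewrite /N; lia.
  apply: (Ex_innov e8 inde mean0 _ _ (dgM (dgX 3 dM) (dF _ jm))).
    apply: past_funM; first by apply: past_funX; apply: past_fun_score_sum.
    exact: past_fun_lin_proc.
  by rewrite /N; lia.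
have d1 := dgX 8 (de _ jm); have d2 := dgX 8 (dF _ jm).
apply: (le_trans (Ex_le e8 (dgX 4 (dgM (de _ jm) (dF _ jm))) (dgD d1 d2) _)).
  move=> w /=; rewrite exprMn; set x := e _ w; set y := lin_proc _ _ w.
  have := sqr_ge0 (x ^+ 4 - y ^+ 4); have := sqr_ge0 (x ^+ 4); have := sqr_ge0 (y ^+ 4).
  rewrite (_ : (x ^+ 4 - y ^+ 4) ^+ 2 = (x ^+ 4) ^+ 2 + (y ^+ 4) ^+ 2 - 2 * (x ^+ 4 * y ^+ 4)); last by ring.
  rewrite -!exprM; lra.
by rewrite (ExD e8 d1 d2) lerD//; exact: (lin_proc_moment8 ha).
Qed.

Lemma past_fun_le N N' f : (N <= N')%N -> past_fun N f -> past_fun N' f.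
Proof.
move=> NN pf _ B mB; have := pf measurableT B mB.
suff : <<s past_gens (fun t => e t.+1) N >> `<=` <<s past_gens (fun t => e t.+1) N' >>.
  by apply.
apply: smallest_sub; first exact: smallest_sigma_algebra.
move=> A [i [C [iN mC AE]]]; apply: sub_sigma_algebra; exists i, C; split => //.
exact: leq_trans NN.
Qed.

Lemma Ex_innov_pair Q N M s t k : past_fun N Q -> dg M k Q -> (k <= 6)%N ->
  (N < s)%N -> (N < t)%N -> (s < M)%N -> (t < M)%N ->
  'Ex[fun w => Q w * (e s w * e t w)] = (s == t)%:R * (s2 * 'Ex[Q]).
Proof.
move=> pQ dQ k6 Ns Nt sM tM.
wlog ts : s t Ns Nt sM tM / (t <= s)%N.
  move=> h; case: (leqP t s) => [|/ltnW] st; first exact: h.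
  by rewrite eq_sym -h//; apply: eq_Rintegral => w _; rewrite [e s w * _]mulrC.
case: s Ns sM ts => // s Ns sM ts.
have [st|st] := eqVneq s.+1 t.
  rewrite mul1r -st; under eq_Rintegral do rewrite -expr2.
  apply: (Ex_innov2 e8 inde var2 (past_fun_le _ pQ) sM (dg_le k6 dQ)).
  by rewrite -ltnS.
rewrite mul0r; under eq_Rintegral do rewrite [e s.+1 _ * _]mulrC mulrA.
apply: (Ex_innov e8 inde mean0 _ sM (dgM (dg_le k6 dQ) (dg_var e tM))).
apply: past_funM; first by apply: past_fun_le pQ; rewrite -ltnS.
by apply: past_fun_var => //; move/eqP: st => st; lia.
Qed.

(** [N + l <= t] puts all l innovations of the windows after time N, hence they are orthogonal given
    Q. *)
Lemma Ex_lin_proc_pair Q N M k u v t l : past_fun N Q -> dg M k Q -> (k <= 6)%N ->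
  (t < M)%N -> (l <= t)%N -> (N + l <= t)%N ->
  'Ex[fun w => Q w * ((\sum_(m < l) u m * e (t - m)%N w) *
                     (\sum_(m < l) v m * e (t - m)%N w))]
  = s2 * (\sum_(m < l) u m * v m) * 'Ex[Q].
Proof.
move=> pQ dQ k6 tM lt Nl.
have dee (i j : 'I_l) : dg M 8 (fun w => Q w * (e (t - i)%N w * e (t - j)%N w)).
  apply: (@dgM _ _ _ _ _ _ 6 2); first exact: dg_le dQ.
  by apply: (@dgM _ _ _ _ _ _ 1 1); apply: dg_var; rewrite (leq_ltn_trans (leq_subr _ _)).
transitivity ('Ex[fun w => \sum_(i < l) \sum_(j < l)
    u i * v j * (Q w * (e (t - i)%N w * e (t - j)%N w))]).
  apply: eq_Rintegral => w _; rewrite big_distrlr/= mulr_sumr.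
  apply: eq_bigr => i _; rewrite mulr_sumr; apply: eq_bigr => j _; ring.
rewrite (Ex_sum e8 (N := M)); last first.
  by move=> i; apply: dg_sum => j _; exact: dgZ.
rewrite -[RHS]mulrA mulrCA mulr_suml; apply: eq_bigr => i _.
rewrite (Ex_sum e8 (N := M)); last by move=> j; exact: dgZ.
have il := ltn_ord i.
rewrite (bigD1 i)//= [X in _ + X]big1 ?addr0 => [|j ji]; last first.
  have jl := ltn_ord j.
  rewrite (ExZ e8 _ (dee _ _)) (Ex_innov_pair pQ dQ k6); try lia.
  rewrite (_ : (_ == _) = false) ?mul0r ?mulr0//.
  by apply/negbTE/eqP; move/eqP: ji => ji ?; apply: ji; apply: val_inj => /=; lia.
rewrite (ExZ e8 _ (dee _ _)) (Ex_innov_pair pQ dQ k6); try lia.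
by rewrite eqxx mul1r.
Qed.

Lemma Ex_lin_proc_lin_proc u v t : 'Ex[fun w => lin_proc u t w * lin_proc v t w] = s2 * \sum_(m < t) u m * v m.
Proof.
have p1 : past_fun 0 (fun=> 1 : R) by exact: past_fun_cst.
have h := @Ex_lin_proc_pair (fun=> 1) 0 t.+1 0 u v t t p1 (dg_cst e _ 1).
rewrite -[RHS]mulr1 -[X in _ = _ * X](Ex_cst P 1) -h//.
by apply: eq_Rintegral => w _; rewrite mul1r.
Qed.

(** Scores at distinct times are orthogonal, so each step of the induction adds only the diagonal
    term. *)
Lemma Ex_score_sum_score_sum u v N : u 0%N = 0 -> v 0%N = 0 ->
  'Ex[fun w => score_sum u 0 N w * score_sum v 0 N w] =
  s2 ^+ 2 * \sum_(t < N) \sum_(m < t.+1) u m * v m.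
Proof.
move=> u0 v0; elim: N => [|N IH].
  under eq_Rintegral do rewrite /score_sum !big_ord0 mulr0.
  by rewrite Ex_cst big_ord0 mulr0.
have pM x : x 0%N = 0 -> past_fun N (score_sum x 0 N) by move=> x0; apply: past_fun_score_sum.
have pF x : x 0%N = 0 -> past_fun N (lin_proc x N.+1) by move=> x0; apply: past_fun_lin_proc.
have dM x : dg N.+2 2 (score_sum x 0 N) by apply: dg_score_sum.
have dF x : dg N.+2 1 (lin_proc x N.+1) by apply: dg_lin_proc.
have de : dg N.+2 1 (e N.+1) by apply: dg_var.
transitivity ('Ex[fun w => score_sum u 0 N w * score_sum v 0 N w +
   ((score_sum u 0 N w * lin_proc v N.+1 w * e N.+1 w + score_sum v 0 N w * lin_proc u N.+1 w * e N.+1 w) +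
    lin_proc u N.+1 w * lin_proc v N.+1 w * e N.+1 w ^+ 2)]).
  by apply: eq_Rintegral => w _; rewrite /score_sum !big_ord_recr/= !add0n; ring.
have d1 : dg N.+2 8 (fun w => score_sum u 0 N w * score_sum v 0 N w).
  exact: (dg_le (isT : (2 + 2 <= 8)%N) (dgM (dM u) (dM v))).
have d2 x z : dg N.+2 8 (fun w => score_sum x 0 N w * lin_proc z N.+1 w * e N.+1 w).
  exact: (dg_le (isT : (2 + 1 + 1 <= 8)%N) (dgM (dgM (dM x) (dF z)) de)).
have d3 : dg N.+2 8 (fun w => lin_proc u N.+1 w * lin_proc v N.+1 w * e N.+1 w ^+ 2).
  exact: (dg_le (isT : (1 + 1 + 1 * 2 <= 8)%N) (dgM (dgM (dF u) (dF v)) (dgX 2 de))).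
rewrite (ExD e8 d1 (dgD (dgD (d2 _ _) (d2 _ _)) d3)) (ExD e8 (dgD (d2 _ _) (d2 _ _)) d3).
rewrite (ExD e8 (d2 _ _) (d2 _ _)) IH.
rewrite (Ex_innov e8 inde mean0 (past_funM (pM u u0) (pF v v0)) (ltnSn _) (dg_le _ (dgM (dM u) (dF v))))//.
rewrite (Ex_innov e8 inde mean0 (past_funM (pM v v0) (pF u u0)) (ltnSn _) (dg_le _ (dgM (dM v) (dF u))))//.
rewrite (Ex_innov2 e8 inde var2 (past_funM (pF u u0) (pF v v0)) (ltnSn _) (dg_le _ (dgM (dF u) (dF v))))//.
by rewrite Ex_lin_proc_lin_proc [in RHS]big_ord_recr/=; ring.
Qed.

End LinearProcess.

(** * The leading term *)

Section Gram.
Variables (R : realType) (p q : nat) (s2 rho kappa C : R) (f : 'I_p -> nat -> R).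
Hypotheses (s20 : 0 < s2) (rho0 : 0 < rho) (rho1 : rho < 1).
Hypotheses (kappa0 : 0 < kappa) (C0 : 0 <= C).
Hypothesis f_le : forall i m, `|f i m| <= C * rho ^+ m.
Hypothesis fl_low : forall theta : 'rV[R]_p,
  kappa * `|theta| ^+ 2 <= \sum_(m < q.+1) fl f theta m ^+ 2.
Notation G := (1 - rho)^-1.

(** The Phi of the header up to normalisation, with the exact finite-sample weights (n - m) / n; see
    [qf_gram]. *)
Definition gram n : 'M[R]_p :=
  \matrix_(i, j) (n%:R^-1 * \sum_(m < n.+1) (n - m)%:R * (f i m * f j m)).

Definition part_gram n : 'M[R]_p := \matrix_(i, j) \sum_(m < n) f i m * f j m.

(** Up to the factor s2^2 n, the second moment matrix of the score of the first N observations. N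
    and n are separate because the score will be cut before time n. *)
Definition mean_gram n N : 'M[R]_p :=
  \matrix_(i, j) (n%:R^-1 * \sum_(t < N) part_gram t.+1 i j).

Lemma qf_gram n (theta theta' : 'rV[R]_p) : (0 < n)%N ->
  qf s2 n (fl f theta) (fl f theta') =
  s2 * n%:R * \sum_i \sum_j theta ord0 i * theta' ord0 j * gram n i j.
Proof.
move=> n0; rewrite /qf -mulrA; congr (_ * _).
have nn : n%:R != 0 :> R by rewrite pnatr_eq0 -lt0n.
transitivity (\sum_(m < n.+1) \sum_i \sum_j theta ord0 i * theta' ord0 j *
    ((n - m)%:R * (f i m * f j m))).
  apply: eq_bigr => m _; rewrite /fl big_distrlr/= mulr_sumr.
  apply: eq_bigr => i _; rewrite mulr_sumr; apply: eq_bigr => j _; ring.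
rewrite exchange_big/= mulr_sumr; apply: eq_bigr => i _.
rewrite exchange_big/= mulr_sumr; apply: eq_bigr => j _.
by rewrite mxE -mulr_sumr mulrCA mulVKf.
Qed.

Lemma gram_lower n (theta : 'rV[R]_p) : (0 < n)%N -> (q.*2 <= n)%N ->
  kappa / 2 * `|theta| ^+ 2 <= \sum_i \sum_j theta ord0 i * theta ord0 j * gram n i j.
Proof.
move=> n0 qn; have nn : 0 < n%:R :> R by rewrite ltr0n.
have k0 : 0 <= kappa * `|theta| ^+ 2 by nng.
have := qf_lower s20 qn k0 (fl_low theta).
rewrite qf_gram//.
have -> : s2 / 2 * n%:R * (kappa * `|theta| ^+ 2) = s2 * n%:R * (kappa / 2 * `|theta| ^+ 2) by ring.
by rewrite ler_pM2l ?mulr_gt0.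
Qed.

Lemma gram_unit n : (0 < n)%N -> (q.*2 <= n)%N -> gram n \in unitmx.
Proof.
move=> n0 qn; rewrite -row_free_unit; apply: inj_row_free => v vG.
have : kappa / 2 * `|v| ^+ 2 <= 0.
  apply: (le_trans (gram_lower v n0 qn)); rewrite exchange_big/= big1// => j _.
  have := congr1 (fun A : 'rV[R]_p => A ord0 j) vG; rewrite !mxE => h.
  by under eq_bigr do rewrite mulrAC; rewrite -mulr_suml h mul0r.
rewrite pmulr_rle0 ?divr_gt0// => h.
have /eqP : `|v| ^+ 2 == 0 by rewrite eq_le h exprn_ge0.
by move=> /eqP; rewrite expf_eq0/= normr_eq0 => /eqP.
Qed.

(** For theta the i-th row of the inverse, the quadratic form equals its i-th coordinate; coercivity
    gives (kappa / 2) |theta|^2 <= |theta|. *)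
Lemma inv_gram_le n i j : (0 < n)%N -> (q.*2 <= n)%N ->
  `|invmx (gram n) i j| <= 2 / kappa.
Proof.
move=> n0 qn; have GU := gram_unit n0 qn.
pose theta : 'rV[R]_p := row i (invmx (gram n)).
have tG : theta *m gram n = delta_mx 0 i.
  by rewrite /theta -row_mul mulVmx// row1.
have hq : \sum_k \sum_l theta ord0 k * theta ord0 l * gram n k l = theta ord0 i.
  rewrite exchange_big/= (bigD1 i)//= [X in _ + X]big1 ?addr0 => [|l li].
    under eq_bigr do rewrite mulrAC; rewrite -mulr_suml.
    have := congr1 (fun A : 'rV[R]_p => A ord0 i) tG; rewrite !mxE/= !eqxx => ->.
    by rewrite mul1r.
  under eq_bigr do rewrite mulrAC; rewrite -mulr_suml.
  have := congr1 (fun A : 'rV[R]_p => A ord0 l) tG; rewrite !mxE/= (negbTE li) => ->.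
  by rewrite mul0r.
have coef (k : 'I_p) : `|theta ord0 k| <= `|theta|.
  by rewrite [leRHS]/Num.norm/= mx_normrE (le_bigmax _ (fun ij => `|theta ij.1 ij.2|) (ord0, k)).
have h := gram_lower theta n0 qn; rewrite hq in h.
have t0 : (0 : R) <= `|theta| by exact: normr_ge0.
have h2 : kappa / 2 * `|theta| ^+ 2 <= 1 * `|theta|.
  by apply: (le_trans h); rewrite mul1r (le_trans (ler_norm _))// coef.
have k20 : 0 < kappa / 2 by rewrite divr_gt0.
have := le_of_quad k20 ler01 t0 h2.
rewrite -ler_pdivlMl// mulr1 invf_div => h3.
by apply: le_trans h3; have := coef j; rewrite mxE.
Qed.

Lemma ff_le i j m : `|f i m * f j m| <= C ^+ 2 * rho ^+ m.
Proof.
rewrite normrM; apply: (@le_trans _ _ (C * rho ^+ m * (C * rho ^+ m))).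
  exact: ler_pM.
have r0 : 0 <= rho ^+ m by rewrite exprn_ge0// ltW.
rewrite (_ : _ * _ * _ = C ^+ 2 * rho ^+ m * rho ^+ m); last by ring.
by apply: ler_piMr; [nng|apply: exprn_ile1; exact: ltW].
Qed.

Lemma inv_onem_ge0 : 0 <= G.
Proof. by rewrite invr_ge0 subr_ge0 ltW. Qed.

Lemma part_gram_le n i j : `|part_gram n i j| <= C ^+ 2 * G.
Proof.
rewrite mxE (le_trans (ler_norm_sum _ _ _))//.
apply: (@le_trans _ _ (\sum_(m < n) C ^+ 2 * rho ^+ m)).
  by apply: ler_sum => m _; exact: ff_le.
by rewrite -mulr_sumr ler_wpM2l ?exprn_ge0// geo_sum_le.
Qed.

(** The lag m occurs in [part_gram t.+1] for m <= t < n, hence n - m times. *)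
Lemma gramE n i j : gram n i j = mean_gram n n i j.
Proof.
clear s20 rho0 rho1 kappa0 C0; rewrite !mxE; congr (_ * _).
under [RHS]eq_bigr do rewrite mxE.
under [RHS]eq_bigr => t _ do rewrite (big_ord_widen n.+1 (fun m => f i m * f j m) (leqW (ltn_ord t))).
under [RHS]eq_bigr => t _ do rewrite big_mkcond/=.
rewrite exchange_big/=; apply: eq_bigr => m _.
rewrite -big_mkcond/= -(big_mkord (fun t => (m < t.+1)%N) (fun=> f i m * f j m)).
have mn : (m <= n)%N by rewrite -ltnS.
rewrite (big_cat_nat (n := m))//= [X in X + _]big_nat_cond [X in X + _]big_pred0 ?add0r; last first.
  by move=> t; apply/negP => /andP[/andP[_ h1] h2]; lia.
rewrite big_nat_cond (eq_bigl (fun t => (m <= t < n)%N && true)); last first.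
  by move=> t; apply/idP/idP; lia.
by rewrite -big_nat_cond big_const_nat iter_addr_0 mulr_natl.
Qed.

(** Each of the l terms of the partial geometric sum is at least rho^l. A rate 1 / l suffices, as
    the other truncation errors are of this order. *)
Lemma geo_inv_le l : (0 < l)%N -> rho ^+ l <= G / l%:R.
Proof.
move=> l0; have r1 : 0 < 1 - rho by rewrite subr_gt0.
rewrite ler_pdivlMr ?ltr0n// -[leRHS]mul1r ler_pdivlMr// .
have hl : rho ^+ l * l%:R <= \sum_(m < l) rho ^+ m.
  rewrite mulr_natr -{2}(card_ord l) -sumr_const; apply: ler_sum => m _.
  by apply: ler_wiXn2l; [exact: ltW|exact: ltW|exact: ltnW].
have := subrX1 rho l; have := exprn_ge0 l (ltW rho0) => h1 h2.
apply: (@le_trans _ _ ((\sum_(m < l) rho ^+ m) * (1 - rho))).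
  by rewrite ler_wpM2r// ltW.
lra.
Qed.

(** The l - 1 missing summands are bounded, and l / n <= 1 / l since l^2 <= n. *)
Lemma mean_gram_diff n l i j : (0 < l)%N -> (l * l <= n)%N ->
  `|mean_gram n (n.+1 - l) i j - gram n i j| <= C ^+ 2 * G / l%:R.
Proof.
clear s20 kappa0; move=> l0 lln; have ln : (l <= n)%N by apply: leq_trans lln; rewrite leq_pmulr.
have n0 : (0 < n)%N by lia.
rewrite gramE !mxE -mulrBr -!(big_mkord xpredT (fun t => part_gram t.+1 i j)).
rewrite [X in _ - X](big_cat_nat (n := (n.+1 - l)%N))//=; last by lia.
rewrite opprD addNKr normrM normrN ger0_norm ?invr_ge0//.
apply: (@le_trans _ _ (n%:R^-1 * (l%:R * (C ^+ 2 * G)))).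
  rewrite ler_wpM2l ?invr_ge0// (le_trans (ler_norm_sum _ _ _))//.
  apply: (@le_trans _ _ (\sum_(n.+1 - l <= t < n) (C ^+ 2 * G))).
    by apply: ler_sum => t _; exact: part_gram_le.
  rewrite big_const_nat iter_addr_0 -[leLHS]mulr_natl ler_wpM2r//.
    by rewrite mulr_ge0 ?exprn_ge0 ?inv_onem_ge0.
  by rewrite ler_nat; lia.
have nr : 0 < n%:R :> R by rewrite ltr0n.
have lr : 0 < l%:R :> R by rewrite ltr0n.
rewrite ler_pdivlMr// -!mulrA ler_pdivrMl//.
rewrite (_ : l%:R * _ = C ^+ 2 * G * (l * l)%:R); last by rewrite natrM; ring.
rewrite mulrA [leRHS]mulrC ler_wpM2l ?mulr_ge0 ?exprn_ge0 ?inv_onem_ge0//.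
by rewrite ler_nat.
Qed.

(** Two partial sums differ by at most a multiple of rho^(t + 1) + rho^l; averaging over t < n
    leaves G / n + rho^l. *)
Lemma part_gram_diff n l i j : (0 < l)%N -> (l * l <= n)%N ->
  `|part_gram l i j - gram n i j| <= 2 * C ^+ 2 * G ^+ 2 / l%:R.
Proof.
clear s20 kappa0; move=> l0 lln; have ln : (l <= n)%N by apply: leq_trans lln; rewrite leq_pmulr.
have n0 : (0 < n)%N by lia.
have nr : 0 < n%:R :> R by rewrite ltr0n.
have lr : 0 < l%:R :> R by rewrite ltr0n.
have G0 := inv_onem_ge0.
have G1 : 1 <= G by rewrite invf_ge1 ?subr_gt0// lerBlDr lerDl ltW.
have c0 : 0 <= C ^+ 2 * G by rewrite mulr_ge0// exprn_ge0.
rewrite gramE [mean_gram _ _ _ _]mxE.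
pose D t := part_gram t.+1 i j - part_gram l i j.
have -> : part_gram l i j - n%:R^-1 * (\sum_(t < n) part_gram t.+1 i j) =
   - (n%:R^-1 * \sum_(t < n) D t).
  have -> : \sum_(t < n) D t = \sum_(t < n) part_gram t.+1 i j - n%:R * part_gram l i j.
    by rewrite /D sumrB sumr_const card_ord mulr_natl.
  by rewrite mulrBr mulKf ?gt_eqF// opprB.
rewrite normrN normrM ger0_norm ?invr_ge0//.
have hD (t : 'I_n) : `|D t| <= C ^+ 2 * G * (rho ^+ t.+1 + rho ^+ l).
  have pd a b : (a <= b)%N -> `|part_gram b i j - part_gram a i j| <= C ^+ 2 * G * rho ^+ a.
    move=> ab; rewrite !mxE -!(big_mkord xpredT (fun m => f i m * f j m)).
    rewrite (big_cat_nat (n := a) (p := b))//= addrAC subrr add0r.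
    rewrite (le_trans (ler_norm_sum _ _ _))//.
    apply: (@le_trans _ _ (\sum_(a <= m < b) C ^+ 2 * rho ^+ m)).
      by apply: ler_sum => m _; exact: ff_le.
    rewrite -{1}[a]add0n big_addn big_mkord -mulr_sumr -[leRHS]mulrA ler_wpM2l ?exprn_ge0//.
    under eq_bigr do rewrite exprD.
    by rewrite -mulr_suml; apply: ler_wpM2r; [nng|exact: geo_sum_le].
  have r0 m : 0 <= rho ^+ m by rewrite exprn_ge0// ltW.
  case: (leqP t.+1 l) => tl.
    rewrite /D distrC; apply: (le_trans (pd _ _ tl)).
    by rewrite ler_wpM2l// lerDl.
  by apply: (le_trans (pd _ _ (ltnW tl))); rewrite ler_wpM2l// lerDr.
apply: (@le_trans _ _ (n%:R^-1 * (C ^+ 2 * G * (G + n%:R * rho ^+ l)))).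
  rewrite ler_wpM2l ?invr_ge0// (le_trans (ler_norm_sum _ _ _))//.
  apply: (@le_trans _ _ (\sum_(t < n) C ^+ 2 * G * (rho ^+ t.+1 + rho ^+ l))).
    by apply: ler_sum => t _; exact: hD.
  rewrite -mulr_sumr ler_wpM2l// big_split/= sumr_const card_ord -[_ *+ n]mulr_natl.
  rewrite lerD2r; apply: le_trans (geo_sum_le rho0 rho1 n).
  apply: ler_sum => t _; rewrite exprS ler_piMl ?exprn_ge0// ltW//.
have hl := geo_inv_le l0.
rewrite (_ : n%:R^-1 * _ = C ^+ 2 * G * (G / n%:R + rho ^+ l)); last first.
  by field; rewrite !gt_eqF ?subr_gt0.
rewrite (_ : 2 * C ^+ 2 * G ^+ 2 / l%:R = C ^+ 2 * G * (G / l%:R + G / l%:R)); last by ring.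
rewrite ler_wpM2l// lerD//.
by rewrite ler_wpM2l// lef_pV2 ?posrE// ler_nat.
Qed.

End Gram.

(** N is the cut time: the score keeps the innovations 1, ..., N and the window of length l at time
    n + 1 those from N + 1 on. *)
Lemma trunc_index l n : (0 < l)%N -> (l <= n)%N ->
  exists N, [/\ (n.+1 - l)%N = N, (N <= n)%N, (n - N <= l)%N, (N + l = n.+1)%N &
    [/\ (N + (n - N) < n.+2)%N, (0 + N < n.+2)%N & (0 + n < n.+2)%N]].
Proof. by move=> l0 ln; exists (n.+1 - l)%N; split; [..|split]; lia. Qed.

Section QuarticForm.
Variables (R : realType) (p : nat).
Implicit Types Y A B F : 'M[R]_p.

(** The second moment of the bilinear form with matrix Y in two independent vectors with second
    moment matrices A and B. *)
Definition quart Y A B : R :=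
  \sum_k \sum_i \sum_k' \sum_i' Y k i * Y k' i' * (A k k' * B i i').

Lemma quart_trace Y A B : quart Y A B = \tr (Y^T *m A *m Y *m B^T).
Proof.
rewrite /mxtrace /quart exchange_big/=; apply: eq_bigr => i _.
rewrite mxE exchange_big/=.
under eq_bigr => k' _ do rewrite exchange_big/=.
rewrite exchange_big/=; apply: eq_bigr => i' _.
rewrite !mxE mulr_suml; apply: eq_bigr => k' _.
rewrite mxE mulr_suml mulr_suml; apply: eq_bigr => k _.
by rewrite !mxE; ring.
Qed.

(** The origin of the dimension factor in the limit. *)
Lemma quart_inv F : F \in unitmx -> quart (invmx F) F F = p%:R.
Proof.
move=> Fu; rewrite quart_trace -(mulmxA _ F) mulmxV// mulmx1 -trmx_mul.
by rewrite mxtrace_tr mulmxV// mxtrace1.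
Qed.

Lemma quart_diff Y A B A' B' y a b da db :
  (forall i j, `|Y i j| <= y) -> (forall i j, `|A' i j| <= a) ->
  (forall i j, `|B i j| <= b) ->
  (forall i j, `|A i j - A' i j| <= da) -> (forall i j, `|B i j - B' i j| <= db) ->
  `|quart Y A B - quart Y A' B'| <= p%:R ^+ 4 * (y ^+ 2 * (da * b + a * db)).
Proof.
move=> hY hA hB hAA hBB; rewrite /quart -sumrB.
have -> : p%:R ^+ 4 * (y ^+ 2 * (da * b + a * db)) =
  \sum_(k < p) \sum_(i < p) \sum_(k' < p) \sum_(i' < p) (y ^+ 2 * (da * b + a * db)).
  rewrite !(sumr_const, card_ord) -!mulrnA -[RHS]mulr_natl !natrM; ring.
rewrite (le_trans (ler_norm_sum _ _ _))//; apply: ler_sum => k _; rewrite -sumrB.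
rewrite (le_trans (ler_norm_sum _ _ _))//; apply: ler_sum => i _; rewrite -sumrB.
rewrite (le_trans (ler_norm_sum _ _ _))//; apply: ler_sum => k' _; rewrite -sumrB.
rewrite (le_trans (ler_norm_sum _ _ _))//; apply: ler_sum => i' _.
rewrite -mulrBr !normrM; apply: ler_pM; rewrite ?mulr_ge0//; first by rewrite expr2 ler_pM.
have -> : A k k' * B i i' - A' k k' * B' i i' =
  (A k k' - A' k k') * B i i' + A' k k' * (B i i' - B' i i') by ring.
by rewrite (le_trans (ler_normD _ _))// !normrM lerD// ler_pM.
Qed.

Lemma sq_sum_le (x : 'I_p -> R) : (\sum_i x i) ^+ 2 <= p%:R * \sum_i x i ^+ 2.
Proof.
have := @sq_mean R p (fun=> 1) x (fun=> ler01).
by rewrite sumr_const card_ord; under eq_bigr do rewrite mul1r; under [X in _ * X]eq_bigr do rewrite mul1r.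
Qed.

End QuarticForm.

Section Limit.
Context d (T : measurableType d) (R : realType) (P : probability T R).
Variable e : nat -> {RV P >-> R}.
Variables (p q : nat) (s2 mu rho kappa C : R) (f : 'I_p -> nat -> R).
Local Notation "''Ex' [ f ]" := (\int[P]_w (f w)) (format "''Ex' [ f ]").
Notation past_fun := (past_fun (fun t => e t.+1)).
Notation dg := (dg e).

Hypothesis e8 : forall t, P.-integrable setT (EFin \o (fun w => e t w ^+ 8)).
Hypothesis e_0 : forall w, e 0%N w = 0.
Hypothesis inde : mutually_independent (fun t => e t.+1).
Hypothesis mean0 : forall t, 'Ex[e t.+1] = 0.
Hypothesis var2 : forall t, 'Ex[fun w => e t.+1 w ^+ 2] = s2.
Hypothesis mom8 : forall t, 'Ex[fun w => e t w ^+ 8] <= mu.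
Hypotheses (s20 : 0 < s2) (rho0 : 0 < rho) (rho1 : rho < 1).
Hypotheses (kappa0 : 0 < kappa) (C0 : 0 <= C).
Hypothesis f_0 : forall i, f i 0%N = 0.
Hypothesis f_le : forall i m, `|f i m| <= C * rho ^+ m.
Hypothesis fl_low : forall theta : 'rV[R]_p,
  kappa * `|theta| ^+ 2 <= \sum_(m < q.+1) fl f theta m ^+ 2.
Notation G := (1 - rho)^-1.
Notation score_sum := (score_sum e).
Notation lin_proc := (lin_proc e).

Definition score n w : 'rV[R]_p := \row_k score_sum (f k) 0 n w.
(* theta*, the minimiser of the quadratic form. *)
Definition thetas n w : 'rV[R]_p :=
  - (n%:R * s2)^-1 *: (score n w *m invmx (gram f n)).

Lemma Sf_dl n (u : nat -> R) w : Sf (e ^~ w) n (@dl R) u = score_sum u 0 n w.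
Proof.
rewrite /Sf big_add1 big_mkord; apply: eq_bigr => j _ /=.
by rewrite flt_dl flt_lin_proc// ?add0n// ltnS ltnW.
Qed.

Lemma lin_proc_fl theta t w : lin_proc (fl f theta) t w = \sum_j theta ord0 j * lin_proc (f j) t w.
Proof.
rewrite /lin_proc; under eq_bigr do rewrite /fl mulr_suml.
rewrite exchange_big/=; apply: eq_bigr => j _; rewrite mulr_sumr.
by apply: eq_bigr => m _; rewrite mulrA.
Qed.

Lemma score_sum_fl theta s n w : score_sum (fl f theta) s n w = \sum_j theta ord0 j * score_sum (f j) s n w.
Proof.
rewrite /score_sum; under eq_bigr do rewrite lin_proc_fl mulr_sumr.
rewrite exchange_big/=; apply: eq_bigr => j _; rewrite mulr_sumr.
by apply: eq_bigr => m _; rewrite mulrCA.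
Qed.

Lemma thetasP n w theta : (0 < n)%N -> (q.*2 <= n)%N ->
  qf s2 n (fl f (thetas n w)) (fl f theta) = - Sf (e ^~ w) n (@dl R) (fl f theta).
Proof.
move=> n0 qn; rewrite qf_gram// Sf_dl score_sum_fl exchange_big/= mulr_sumr -sumrN.
have GU := gram_unit s20 kappa0 fl_low n0 qn.
apply: eq_bigr => j _.
under eq_bigr do rewrite mulrAC; rewrite -mulr_suml.
have -> : \sum_i thetas n w ord0 i * gram f n i j = (thetas n w *m gram f n) ord0 j.
  by rewrite [RHS]mxE.
rewrite /thetas -scalemxAl mulmxKV// !mxE.
have nr : 0 < n%:R :> R by rewrite ltr0n.
by field; rewrite !gt_eqF.
Qed.

Definition bilin n (M X : 'I_p -> R) : R :=
  \sum_k \sum_i invmx (gram f n) k i * (M k * X i).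

(** The prediction error of [thetas] at time n + 1, scaled by sqrt n. *)
Definition bval n w : R := Num.sqrt n%:R * flt (e ^~ w) n (fl f (thetas n w)) n.+1.

Definition cn n : R := Num.sqrt n%:R * - (n%:R * s2)^-1.

Lemma bvalE n w : bval n w =
  cn n * bilin n (fun k => score_sum (f k) 0 n w) (fun i => lin_proc (f i) n.+1 w).
Proof.
rewrite /bval flt_lin_proc// lin_proc_fl /cn -mulrA; congr (_ * _).
rewrite /bilin exchange_big/= mulr_sumr; apply: eq_bigr => i _.
rewrite /thetas mxE mxE -mulrA mulr_suml mulr_sumr [RHS]mulr_sumr.
by apply: eq_bigr => k _; rewrite mxE; ring.
Qed.

Lemma cn2 n : (0 < n)%N -> cn n ^+ 2 = (n%:R * s2 ^+ 2)^-1.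
Proof.
move=> n0; have nr : 0 < n%:R :> R by rewrite ltr0n.
rewrite /cn exprMn sqr_sqrtr ?ltW// sqrrN.
by field; rewrite !gt_eqF.
Qed.

Definition trunc_proc l t (u : nat -> R) w : R := \sum_(m < l) u m * e (t - m)%N w.
(** [bval] with its two factors cut so that they depend on disjoint blocks of innovations; the
    matrix stays that of n. *)
Definition btrunc n l w : R :=
  cn n * bilin n (fun k => score_sum (f k) 0 (n.+1 - l) w) (fun i => trunc_proc l n.+1 (f i) w).

(** W bounds the l1 norms of the filters; [m4] and [x4] are the resulting constants for fourth
    moments of score and gradient. *)
Let W : R := C * G.
Let m4 : R := mu + W ^+ 8 * mu.
Let x4 : R := W ^+ 4 * (1 + mu).

Let a m : R := C * rho ^+ m.
Let ha i m : `|f i m| <= a m. Proof. exact: f_le. Qed.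
Let hW t : \sum_(m < t) a m <= W.
Proof. by rewrite -mulr_sumr ler_wpM2l// geo_sum_le. Qed.

Let G0 : 0 <= G := inv_onem_ge0 rho1.
Let W0 : 0 <= W. Proof. exact: mulr_ge0. Qed.
Let mu0 : 0 <= mu := mom8_ge0 mom8.
Let m40 : 0 <= m4. Proof. by rewrite addr_ge0// mulr_ge0// exprn_ge0. Qed.
Let x40 : 0 <= x4. Proof. by rewrite mulr_ge0 ?exprn_ge0// addr_ge0. Qed.

Lemma score_sum_split u N n w : (N <= n)%N ->
  score_sum u 0 n w = score_sum u 0 N w + score_sum u N (n - N) w.
Proof.
move=> Nn; rewrite /score_sum.
rewrite -(big_mkord xpredT (fun j => e (0 + j).+1 w * lin_proc u (0 + j).+1 w)).
rewrite (big_cat_nat (n := N))//= big_mkord; congr (_ + _).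
rewrite -{1}[N]add0n big_addn big_mkord.
by apply: eq_bigr => j _; rewrite add0n addnC.
Qed.

Lemma tail_sum_le l t : \sum_(m < t) (if (m < l)%N then 0 else a m) <= C * rho ^+ l * G.
Proof.
have r0 k : 0 <= rho ^+ k by rewrite exprn_ge0// ltW.
rewrite -(big_mkord xpredT (fun m => if (m < l)%N then 0 else a m)).
apply: (@le_trans _ _ (\sum_(0 <= m < l + t) (if (m < l)%N then 0 else a m))).
  rewrite [leRHS](big_cat_nat (n := t))//= ?leq_addl// lerDl.
  by apply: sumr_ge0 => m _; case: ifP => // _; rewrite mulr_ge0.
rewrite (big_cat_nat (n := l))//= ?leq_addr//.
rewrite big_nat_cond big1 ?add0r; last by move=> m /andP[/andP[_ ->]].
rewrite -{1}[l]add0n big_addn addKn big_mkord.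
rewrite (eq_bigr (fun m : 'I_t => C * rho ^+ l * rho ^+ m)); last first.
  by move=> m _; rewrite ltnNge leq_addl/= /a addnC exprD mulrA.
by rewrite -mulr_sumr ler_wpM2l ?geo_sum_le// mulr_ge0.
Qed.

Lemma trunc_proc_diff i n l w : (l <= n.+1)%N ->
  lin_proc (f i) n.+1 w - trunc_proc l n.+1 (f i) w =
  lin_proc (fun m => if (m < l)%N then 0 else f i m) n.+1 w.
Proof.
move=> ln; rewrite /lin_proc /trunc_proc (big_ord_widen n.+1 (fun m => f i m * e (n.+1 - m)%N w) ln).
rewrite [X in _ - X]big_mkcond/= -sumrB; apply: eq_bigr => m _.
by case: ifP => _; rewrite ?subrr ?mul0r// subr0.
Qed.

Lemma dg_trunc_proc l t u N : (t < N)%N -> dg N 1 (trunc_proc l t u).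
Proof.
move=> tN; apply: dg_sum => m _; apply: dgZ; apply: dg_var.
by rewrite (leq_ltn_trans (leq_subr _ _)).
Qed.

(** The two changes are the score of at most l last steps and the filter tail beyond lag l. Their
    products with the untouched factors are separated by Young's inequality into fourth moments. *)
Lemma cross_moment k i n l : (0 < l)%N -> (l * l <= n)%N ->
  'Ex[fun w => (score_sum (f k) 0 n w * lin_proc (f i) n.+1 w -
     score_sum (f k) 0 (n.+1 - l) w * trunc_proc l n.+1 (f i) w) ^+ 2]
  <= n%:R / l%:R * (32 * m4 + x4 + x4 * G ^+ 2).
Proof.
move=> l0 lln; have ln : (l <= n)%N by apply: leq_trans lln; rewrite leq_pmulr.
have n0 : (0 < n)%N := leq_trans l0 ln.
have nr : 0 < n%:R :> R by rewrite ltr0n.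
have lr : 0 < l%:R :> R by rewrite ltr0n.
have lnl : l%:R <= n%:R / l%:R :> R by rewrite ler_pdivlMr// -natrM ler_nat.
have [N [-> Nn nN Nl [Nb0 Nb1 Nb2]]] := trunc_index l0 ln.
pose D1 := score_sum (f k) N (n - N); pose X := lin_proc (f i) n.+1.
pose M' := score_sum (f k) 0 N.
pose D2 := lin_proc (fun m => if (m < l)%N then 0 else f i m) n.+1.
have dD1 : dg n.+2 2 D1 by exact: dg_score_sum.
have dM' : dg n.+2 2 M' by exact: dg_score_sum.
have dX : dg n.+2 1 X by apply: dg_lin_proc.
have dD2 : dg n.+2 1 D2 by apply: dg_lin_proc.
have dF : dg n.+2 1 (trunc_proc l n.+1 (f i)) by apply: dg_trunc_proc.
have dM : dg n.+2 2 (score_sum (f k) 0 n) by exact: dg_score_sum.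
have q1 : dg n.+2 8 (fun w => D1 w ^+ 4) := dgX 4 dD1.
have q2 : dg n.+2 8 (fun w => X w ^+ 4) := dg_le (isT : (1 * 4 <= 8)%N) (dgX 4 dX).
have q3 : dg n.+2 8 (fun w => M' w ^+ 4) := dgX 4 dM'.
have q4 : dg n.+2 8 (fun w => D2 w ^+ 4) := dg_le (isT : (1 * 4 <= 8)%N) (dgX 4 dD2).
have q5 : dg n.+2 8 (fun w => (score_sum (f k) 0 n w * lin_proc (f i) n.+1 w -
     score_sum (f k) 0 N w * trunc_proc l n.+1 (f i) w) ^+ 2).
  exact: (dg_le (isT : ((2 + 1) * 2 <= 8)%N) (dgX 2 (dgB (dgM dM dX) (dgM dM' dF)))).
(* Balances a score with fourth moment of order n^2 against a tail with fourth moment of order l^-2: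
   both terms become n / l. For the other pair the weight l is used, with l <= n / l. *)
pose L : R := n%:R * l%:R.
have L0 : 0 < L by rewrite mulr_gt0.
pose B w := (l%:R^-1 * D1 w ^+ 4 + l%:R * X w ^+ 4) + (L^-1 * M' w ^+ 4 + L * D2 w ^+ 4).
apply: (le_trans (Ex_le e8 (g := B) q5 (dgD (dgD (dgZ _ q1) (dgZ _ q2)) (dgD (dgZ _ q3) (dgZ _ q4))) _)).
  move=> w /=; rewrite (score_sum_split _ _ Nn) -/(D1 w) -/(M' w).
  have eF : trunc_proc l n.+1 (f i) w = X w - D2 w.
    by rewrite /D2 -trunc_proc_diff ?(leq_trans ln)// opprB addrC subrK.
  rewrite eF (_ : (M' w + D1 w) * X w - M' w * (X w - D2 w) = D1 w * X w + M' w * D2 w); last by ring.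
  apply: (le_trans (sq_sum2_le _ _)); rewrite mulrDr /B.
  have young (lam x y : R) : 0 < lam -> 2 * (x * y) ^+ 2 <= lam^-1 * x ^+ 4 + lam * y ^+ 4.
    move=> lam0; rewrite -subr_ge0.
    have -> : lam^-1 * x ^+ 4 + lam * y ^+ 4 - 2 * (x * y) ^+ 2 = lam^-1 * (x ^+ 2 - lam * y ^+ 2) ^+ 2.
      by field; rewrite gt_eqF.
    by rewrite mulr_ge0 ?sqr_ge0// invr_ge0 ltW.
  by rewrite lerD// young.
rewrite (ExD e8 (dgD (dgZ _ q1) (dgZ _ q2)) (dgD (dgZ _ q3) (dgZ _ q4))).
rewrite (ExD e8 (dgZ _ q1) (dgZ _ q2)) (ExD e8 (dgZ _ q3) (dgZ _ q4)).
rewrite (ExZ e8 _ q1) (ExZ e8 _ q2) (ExZ e8 _ q3) (ExZ e8 _ q4).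
have M4 s m : 'Ex[fun w => score_sum (f k) s m w ^+ 4] <= 16 * m%:R ^+ 2 * m4.
  exact: (score_sum_moment4 e8 e_0 inde mean0 mom8 s m (f_0 k) (ha k) hW).
have b1 : 'Ex[fun w => D1 w ^+ 4] <= 16 * l%:R ^+ 2 * m4.
  apply: (le_trans (M4 _ _)); rewrite ler_wpM2r// ler_wpM2l//.
  by apply: lerXn2r; rewrite ?nnegrE// ler_nat.
have b3 : 'Ex[fun w => M' w ^+ 4] <= 16 * n%:R ^+ 2 * m4.
  apply: (le_trans (M4 _ _)); rewrite ler_wpM2r// ler_wpM2l//.
  by apply: lerXn2r; rewrite ?nnegrE// ler_nat.
have b2 : 'Ex[fun w => X w ^+ 4] <= x4.
  exact: (lin_proc_moment4 e8 mom8 (ha i) (hW _)).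
have b4 : 'Ex[fun w => D2 w ^+ 4] <= x4 * (G / l%:R) ^+ 2.
  have hu m : `|if (m < l)%N then 0 else f i m| <= (if (m < l)%N then 0 else a m).
    by case: ifP => // _; rewrite normr0.
  apply: (le_trans (lin_proc_moment4 e8 mom8 hu (tail_sum_le _ _))).
  have hl := geo_inv_le rho0 rho1 l0.
  have r0 : 0 <= rho ^+ l by rewrite exprn_ge0// ltW.
  have r1 : rho ^+ l <= 1 by rewrite exprn_ile1// ltW.
  rewrite (_ : _ * (1 + mu) = x4 * (rho ^+ l) ^+ 4); last by rewrite /x4 /W; ring.
  rewrite ler_wpM2l//; apply: (@le_trans _ _ ((rho ^+ l) ^+ 2)).
    rewrite (_ : (rho ^+ l) ^+ 4 = (rho ^+ l) ^+ 2 * (rho ^+ l) ^+ 2); last by ring.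
    by apply: ler_piMr; [nng|exact: exprn_ile1].
  by apply: lerXn2r; rewrite ?nnegrE// (le_trans r0).
have c1 : l%:R^-1 * 'Ex[fun w => D1 w ^+ 4] <= n%:R / l%:R * (16 * m4).
  apply: (@le_trans _ _ (l%:R^-1 * (16 * l%:R ^+ 2 * m4))).
    by rewrite ler_wpM2l// invr_ge0 ltW.
  rewrite (_ : _ * (_ * m4) = l%:R * (16 * m4)); last by field; rewrite gt_eqF.
  by rewrite ler_wpM2r// mulr_ge0.
have c2 : l%:R * 'Ex[fun w => X w ^+ 4] <= n%:R / l%:R * x4.
  apply: (@le_trans _ _ (l%:R * x4)); first by rewrite ler_wpM2l// ltW.
  by rewrite ler_wpM2r.
have c3 : L^-1 * 'Ex[fun w => M' w ^+ 4] <= n%:R / l%:R * (16 * m4).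
  apply: (@le_trans _ _ (L^-1 * (16 * n%:R ^+ 2 * m4))).
    by rewrite ler_wpM2l// invr_ge0 ltW.
  by rewrite le_eqVlt; apply/orP; left; apply/eqP; rewrite /L; field; rewrite !gt_eqF.
have c4 : L * 'Ex[fun w => D2 w ^+ 4] <= n%:R / l%:R * (x4 * G ^+ 2).
  apply: (@le_trans _ _ (L * (x4 * (G / l%:R) ^+ 2))).
    by rewrite ler_wpM2l// ltW.
  by rewrite le_eqVlt; apply/orP; left; apply/eqP; rewrite /L; field; rewrite !gt_eqF ?subr_gt0.
lra.
Qed.

Lemma bilin_sq_le n M X M' X' : (0 < n)%N -> (q.*2 <= n)%N ->
  (bilin n M X - bilin n M' X') ^+ 2 <=
  p%:R ^+ 2 * (2 / kappa) ^+ 2 * \sum_k \sum_i (M k * X i - M' k * X' i) ^+ 2.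
Proof.
move=> n0 qn; rewrite /bilin -sumrB; apply: (le_trans (sq_sum_le _)).
set c := 2 / kappa; set S := \sum_k \sum_i _.
rewrite (_ : p%:R ^+ 2 * c ^+ 2 * S = p%:R * (p%:R * (c ^+ 2 * S))); last by ring.
rewrite ler_wpM2l// /S !mulr_sumr; apply: ler_sum => k _.
rewrite -sumrB; apply: (le_trans (sq_sum_le _)).
rewrite ler_wpM2l// mulr_sumr; apply: ler_sum => i _.
rewrite -mulrBr exprMn ler_wpM2r ?sqr_ge0//; apply: sqr_le_norm.
exact: (inv_gram_le s20 kappa0 fl_low).
Qed.

Lemma dg_bilin n j k (M X : 'I_p -> T -> R) N : (forall i, dg N j (M i)) ->
  (forall i, dg N k (X i)) -> dg N (j + k) (fun w => bilin n (M ^~ w) (X ^~ w)).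
Proof.
move=> hM hX; apply: dg_sum => i _; apply: dg_sum => i' _; apply: dgZ.
exact: dgM.
Qed.

Lemma dg_bval n : dg n.+2 3 (bval n).
Proof.
rewrite (_ : bval n = fun w => cn n * bilin n (fun k => score_sum (f k) 0 n w) (fun i => lin_proc (f i) n.+1 w)).
  apply: dgZ; apply: (@dg_bilin n 2 1 (fun k => score_sum (f k) 0 n) (fun i => lin_proc (f i) n.+1)) => i.
    exact: dg_score_sum.
  exact: dg_lin_proc.
by apply/funext => w; rewrite bvalE.
Qed.

Lemma dg_btrunc n l : (0 < l)%N -> dg n.+2 3 (btrunc n l).
Proof.
move=> l0; apply: dgZ.
apply: (@dg_bilin n 2 1 (fun k => score_sum (f k) 0 (n.+1 - l)) (fun i => trunc_proc l n.+1 (f i))) => i.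
  by apply: dg_score_sum; rewrite add0n ltnS leq_subr.
exact: dg_trunc_proc.
Qed.

Definition trunc_const : R := p%:R ^+ 4 * (2 / kappa) ^+ 2 * (32 * m4 + x4 + x4 * G ^+ 2) / s2 ^+ 2.

Lemma bval_btrunc n l : (0 < l)%N -> (l * l <= n)%N -> (q.*2 <= n)%N ->
  'Ex[fun w => (bval n w - btrunc n l w) ^+ 2] <= trunc_const / l%:R.
Proof.
move=> l0 lln qn; have ln : (l <= n)%N by apply: leq_trans lln; rewrite leq_pmulr.
have n0 : (0 < n)%N := leq_trans l0 ln.
have nr : 0 < n%:R :> R by rewrite ltr0n.
have lr : 0 < l%:R :> R by rewrite ltr0n.
pose z k i w := (score_sum (f k) 0 n w * lin_proc (f i) n.+1 w -
     score_sum (f k) 0 (n.+1 - l) w * trunc_proc l n.+1 (f i) w) ^+ 2.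
have dz k i : dg n.+2 8 (z k i).
  apply: (dg_le (isT : ((2 + 1) * 2 <= 8)%N)); apply: dgX.
  by apply: dgB; apply: (@dgM _ _ _ _ _ _ 2 1); [exact: dg_score_sum|exact: dg_lin_proc|apply: dg_score_sum; rewrite add0n ltnS leq_subr|exact: dg_trunc_proc].
have dzz : dg n.+2 8 (fun w => \sum_k \sum_i z k i w).
  by apply: dg_sum => k _; apply: dg_sum => i _.
pose c := cn n ^+ 2 * (p%:R ^+ 2 * (2 / kappa) ^+ 2).
have dL : dg n.+2 8 (fun w => (bval n w - btrunc n l w) ^+ 2).
  exact: (dg_le (isT : (3 * 2 <= 8)%N) (dgX 2 (dgB (dg_bval n) (dg_btrunc n l0)))).
apply: (le_trans (Ex_le e8 dL (dgZ c dzz) _)).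
  move=> w /=; rewrite bvalE /btrunc -mulrBr exprMn /c -mulrA ler_wpM2l ?sqr_ge0//.
  exact: bilin_sq_le.
rewrite (ExZ e8 _ dzz) (Ex_sum e8 (N := n.+2)); last by move=> k; apply: dg_sum.
set b := n%:R / l%:R * (32 * m4 + x4 + x4 * G ^+ 2).
apply: (@le_trans _ _ (c * (\sum_(k < p) \sum_(i < p) b))).
  apply: ler_wpM2l; first by rewrite /c; nng.
  apply: ler_sum => k _; rewrite (Ex_sum e8 (N := n.+2))//.
  by apply: ler_sum => i _; exact: cross_moment.
rewrite !(sumr_const, card_ord) -mulrnA -[b *+ _]mulr_natl natrM /c cn2// /b /trunc_const.
by rewrite le_eqVlt; apply/orP; left; apply/eqP; field; rewrite !gt_eqF ?subr_gt0.
Qed.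

Definition var_const : R := s2 * (p%:R ^+ 4 * ((2 / kappa) ^+ 2 *
  (C ^+ 2 * G * (C ^+ 2 * G) + C ^+ 2 * G * (2 * C ^+ 2 * G ^+ 2)))).

(** Independence makes the second moment s2 times a quartic form in the truncated Gram matrices;
    replacing both by [gram] costs O(1 / l) and leaves the trace of the identity. *)
Lemma btrunc_var n l : (0 < l)%N -> (l * l <= n)%N -> (q.*2 <= n)%N ->
  `|'Ex[fun w => btrunc n l w ^+ 2] - p%:R * s2| <= var_const / l%:R.
Proof.
move=> l0 lln qn; have ln : (l <= n)%N by apply: leq_trans lln; rewrite leq_pmulr.
have n0 : (0 < n)%N := leq_trans l0 ln.
have nr : 0 < n%:R :> R by rewrite ltr0n.
have lr : 0 < l%:R :> R by rewrite ltr0n.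
pose Y := invmx (gram f n).
rewrite /btrunc; have [N [NE Nn nN Nl [Nb0 Nb1 Nb2]]] := trunc_index l0 ln.
rewrite NE; pose M k := score_sum (f k) 0 N; pose X i := trunc_proc l n.+1 (f i).
have dM k : dg n.+2 2 (M k) by exact: dg_score_sum.
have dX i : dg n.+2 1 (X i) by apply: dg_trunc_proc.
have pM k : past_fun N (M k) by apply: past_fun_score_sum => //.
have dq k k' i i' : dg n.+2 8 (fun w => (M k w * M k' w) * (X i w * X i' w)).
  exact: (dg_le (isT : (2 + 2 + (1 + 1) <= 8)%N) (dgM (dgM (dM k) (dM k')) (dgM (dX i) (dX i')))).
(* The window starts after the cut time, so its second moments factor out, and the remaining
   expectation is one of scores. *)
have Eq k k' i i' : 'Ex[fun w => (M k w * M k' w) * (X i w * X i' w)] =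
    n%:R * s2 ^+ 3 * (mean_gram f n N k k' * part_gram f l i i').
  rewrite (Ex_lin_proc_pair e8 e_0 inde mean0 var2 (f i) (f i') (past_funM (pM k) (pM k')) (dgM (dM k) (dM k'))) ?ltnSn//; last 2 first.
  - by rewrite (leq_trans ln).
  - by rewrite Nl.
  rewrite (Ex_score_sum_score_sum e8 e_0 inde mean0 var2)// !mxE.
  under [in RHS]eq_bigr do rewrite mxE.
  by field; rewrite gt_eqF.
have -> : 'Ex[fun w => (cn n * bilin n (M ^~ w) (X ^~ w)) ^+ 2] = s2 * quart Y (mean_gram f n N) (part_gram f l).
  transitivity ('Ex[fun w => cn n ^+ 2 * (\sum_k \sum_i \sum_k' \sum_i'
      Y k i * Y k' i' * ((M k w * M k' w) * (X i w * X i' w)))]).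
    apply: eq_Rintegral => w _; rewrite exprMn; congr (_ * _).
    rewrite /bilin expr2 mulr_suml; apply: eq_bigr => k _.
    rewrite mulr_suml; apply: eq_bigr => i _.
    rewrite mulr_sumr; apply: eq_bigr => k' _.
    rewrite mulr_sumr; apply: eq_bigr => i' _; rewrite /M /X /Y; ring.
  have d1 k i k' : dg n.+2 8 (fun w => \sum_i' Y k i * Y k' i' * ((M k w * M k' w) * (X i w * X i' w))).
    by apply: dg_sum => i' _; apply: dgZ.
  have d2 k i : dg n.+2 8 (fun w => \sum_k' \sum_i' Y k i * Y k' i' * ((M k w * M k' w) * (X i w * X i' w))).
    by apply: dg_sum => k' _.
  have d3 k : dg n.+2 8 (fun w => \sum_i \sum_k' \sum_i' Y k i * Y k' i' * ((M k w * M k' w) * (X i w * X i' w))).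
    by apply: dg_sum => i _.
  have d4 : dg n.+2 8 (fun w => \sum_k \sum_i \sum_k' \sum_i' Y k i * Y k' i' * ((M k w * M k' w) * (X i w * X i' w))).
    by apply: dg_sum => k _.
  rewrite (ExZ e8 _ d4) (Ex_sum e8 _ d3).
  rewrite cn2// mulr_sumr /quart mulr_sumr; apply: eq_bigr => k _.
  rewrite (Ex_sum e8 _ (d2 k)) !mulr_sumr; apply: eq_bigr => i _.
  rewrite (Ex_sum e8 _ (d1 k i)) !mulr_sumr; apply: eq_bigr => k' _.
  rewrite (Ex_sum e8 _ (fun i' => dgZ _ (dq k k' i i'))) !mulr_sumr; apply: eq_bigr => i' _.
  rewrite (ExZ e8 _ (dq k k' i i')) Eq.
  by field; rewrite !gt_eqF.
have GU := gram_unit s20 kappa0 fl_low n0 qn.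
rewrite -(quart_inv GU) -/Y [quart Y (gram f n) _ * _]mulrC -mulrBr normrM (gtr0_norm s20).
rewrite /var_const -mulrA ler_wpM2l ?(ltW s20)//.
have gram_le i j : `|gram f n i j| <= C ^+ 2 * G.
  rewrite gramE mxE normrM ger0_norm ?invr_ge0// ler_pdivrMl//.
  rewrite (le_trans (ler_norm_sum _ _ _))//.
  apply: (@le_trans _ _ (\sum_(t < n) C ^+ 2 * G)).
    by apply: ler_sum => t _; apply: (part_gram_le rho0 rho1 C0).
  by rewrite sumr_const card_ord -[_ *+ n]mulr_natl.
apply: (le_trans (@quart_diff _ _ Y _ _ _ _ (2 / kappa) (C ^+ 2 * G) (C ^+ 2 * G)
  (C ^+ 2 * G / l%:R) (2 * C ^+ 2 * G ^+ 2 / l%:R) _ _ _ _ _)).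
- by move=> i j; exact: (inv_gram_le s20 kappa0 fl_low).
- by [].
- by move=> i j; exact: (part_gram_le rho0 rho1 C0).
- by move=> i j; have := mean_gram_diff rho0 rho1 C0 f_le i j l0 lln; rewrite NE.
- by move=> i j; exact: (part_gram_diff rho0 rho1 C0).
by rewrite le_eqVlt; apply/orP; left; apply/eqP; field; rewrite !gt_eqF ?subr_gt0.
Qed.

End Limit.

(** * The prediction error *)

Section Transfer.
Context d (T : measurableType d) (R : realType) (P : probability T R).

Lemma pow8_le_powR (x q : R) : 8 < q -> x ^+ 8 <= 1 + `|x| `^ q.
Proof.
move=> q8; have -> : x ^+ 8 = `|x| ^+ 8 by rewrite -normrX ger0_norm// exprn_even_ge0.
have [x1|/ltW x1] := leP `|x| 1.
  by rewrite ler_wpDr ?powR_ge0// exprn_ile1.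
rewrite ler_wpDl// -powR_mulrn// ler_powR//.
by rewrite ltW.
Qed.

Lemma integrable_pow8 (X : {RV P >-> R}) (q : R) : 8 < q ->
  ('E_P[(fun w => `|X w| `^ q)%R] < +oo)%E ->
  P.-integrable setT (EFin \o (fun w => X w ^+ 8)).
Proof.
move=> q8; rewrite unlock => hq.
have mq : measurable_fun [set: T] (fun w => `|X w| `^ q).
  by apply: (measurableT_comp (measurable_powR _)); exact: measurableT_comp.
have Iq : P.-integrable setT (EFin \o (fun w => `|X w| `^ q)).
  apply/integrableP; split; first exact/measurable_EFinP.
  apply: le_lt_trans hq; rewrite le_eqVlt; apply/orP; left; apply/eqP.
  by apply: eq_integral => w _ /=; rewrite ger0_norm// powR_ge0.
apply: (@le_integrable _ _ _ _ _ _ _ (EFin \o (fun w => 1 + `|X w| `^ q))) => //.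
- by apply/measurable_EFinP; exact: measurable_funX.
- move=> w _ /=; rewrite lee_fin ger0_norm ?exprn_even_ge0//.
  by rewrite ger0_norm ?addr_ge0 ?powR_ge0// pow8_le_powR.
- have -> : EFin \o (fun w => 1 + `|X w| `^ q) =
    ((fun=> 1%:E) \+ (EFin \o (fun w => `|X w| `^ q)%R))%E by [].
  by apply: integrableD => //; exact: finite_measure_integrable_cst.
Qed.

Lemma integrable_same_law (X Y : {RV P >-> R}) (g : R -> R) :
  (forall B, measurable B -> distribution P X B = distribution P Y B) ->
  measurable_fun setT g -> P.-integrable setT (EFin \o (g \o X)) ->
  P.-integrable setT (EFin \o (g \o Y)) /\
  \int[P]_w g (Y w) = \int[P]_w g (X w).
Proof.
move=> XY mg IX.
have mg' : measurable_fun [set: R] (EFin \o g) by exact/measurable_EFinP.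
have IY : P.-integrable setT (EFin \o (g \o Y)).
  apply/integrableP; split.
    by apply/measurable_EFinP; exact: measurableT_comp.
  have [_] := integrableP _ _ _ IX.
  have mag : measurable_fun [set: R] (abse \o (EFin \o g)) by exact: measurableT_comp.
  have -> : (\int[P]_x `|(EFin \o (g \o X)) x| = \int[distribution P X]_y (abse \o (EFin \o g)) y)%E.
    by rewrite ge0_integral_distribution// => y; exact: abse_ge0.
  rewrite (_ : (\int[P]_x `|(EFin \o (g \o Y)) x| = \int[distribution P Y]_y (abse \o (EFin \o g)) y)%E); last first.
    by rewrite ge0_integral_distribution// => y; exact: abse_ge0.
  rewrite (@eq_measure_integral _ _ _ _ (distribution P Y))// => A mA _.
  exact: XY.
split=> //; rewrite /Rintegral; congr fine.
transitivity (\int[distribution P Y]_y (EFin \o g) y)%E.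
  by rewrite integral_distribution.
transitivity (\int[distribution P X]_y (EFin \o g) y)%E.
  by apply: eq_measure_integral => A mA _; apply/esym; apply: XY.
by rewrite integral_distribution.
Qed.

End Transfer.

(** The truncation parameter m is fixed first and n taken large afterwards; N may depend on m in any
    way. *)
Lemma cvg_of_rate (R : realType) (u : nat -> R) (c Q : R) :
  (forall m, (0 < m)%N -> exists N, forall n, (N <= n)%N -> `|u n - c| <= Q / m%:R) ->
  u @ \oo --> c.
Proof.
move=> h; apply/cvgrPdist_le => eps eps0.
have [m hm] := real_natr_bound (`|Q| / eps).
have [N hN] := h m.+1 isT.
exists N => // n /= Nn; rewrite distrC (le_trans (hN _ Nn))//.
rewrite ler_pdivrMr// (le_trans (ler_norm Q))//.
move: hm; rewrite ler_pdivrMr// => hm; apply: (le_trans hm).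
by rewrite mulrC ler_wpM2l ?ltW// ltr_nat.
Qed.

Lemma flt_conv (R : realType) (x u : fps R) n t : x 0%N = 0 -> (t <= n.+1)%N ->
  flt x n u t = (u * x) t.
Proof.
move=> x0 tn; rewrite /flt fpsME -!(big_mkord xpredT (fun m => u m * x (t - m)%N)).
rewrite [RHS]big_nat_recr//= subnn x0 mulr0 addr0.
rewrite (big_cat_nat (n := t))//= [X in _ + X]big_nat_cond [X in _ + X]big1 ?addr0//.
by move=> m /andP[/andP[tm _] _]; rewrite (eqP (tm : (t - m == 0)%N)) x0 mulr0.
Qed.

(** * The prediction error as a function of the past *)

Section Past.
Context d (T : measurableType d) (R : realType) (P : probability T R).
Variables (p1 p2 : nat) (eta0 : 'rV[R]_(p1 + p2)).
Variables (e : nat -> {RV P >-> R}) (y : nat -> T -> R).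
Hypothesis e_0 : forall w, e 0%N w = 0.
Hypothesis y_0 : forall w, y 0%N w = 0.
Hypothesis hy : forall (t : nat) (w : T), (1 <= t)%N ->
  y t w = arma_reg eta0 (y ^~ w) (fun s => e s w) t + e t w.
Notation past_fun := (past_fun (fun t => e t.+1)).

Lemma past_fun_reg n t (h : T -> 'rV[R]_(p1 + p2)) (Y E : nat -> T -> R) :
  (forall i, past_fun n (fun w => h w ord0 i)) ->
  (forall s, (s < t)%N -> past_fun n (Y s)) ->
  (forall s, (s < t)%N -> past_fun n (E s)) -> (0 < t)%N ->
  past_fun n (fun w => arma_reg (h w) (Y ^~ w) (E ^~ w) t).
Proof.
move=> hh hY hE t0; apply: past_funB.
  apply: past_fun_sum => j; have tj : (t - j.+1 < t)%N by rewrite ltn_subrL t0.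
  exact: (past_funM (hh (lshift p2 j)) (hY _ tj)).
apply: past_fun_sum => j; have tj : (t - j.+1 < t)%N by rewrite ltn_subrL t0.
exact: (past_funM (hh (rshift p1 j)) (hE _ tj)).
Qed.

Lemma past_fun_y n t : (t <= n)%N -> past_fun n (y t).
Proof.
elim/ltn_ind: t => -[|t] IH tn.
  by rewrite (_ : y 0%N = fun=> 0); [exact: past_fun_cst|apply/funext => w; exact: y_0].
rewrite (_ : y t.+1 = fun w => arma_reg eta0 (y ^~ w) (fun s => e s w) t.+1 + e t.+1 w); last first.
  by apply/funext => w; exact: hy.
apply: past_funD; last exact: past_fun_var.
apply: (@past_fun_reg _ _ (fun=> eta0) y (fun s => e s : T -> R)) => [i|s st|s st|//].
- exact: past_fun_cst.
- by apply: IH => //; rewrite (leq_trans _ tn)// ltnW.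
- by apply: past_fun_var => //; rewrite (leq_trans _ tn)// ltnW.
Qed.

Lemma past_sub n : past y n `<=` <<s past_gens (fun t => e t.+1) n >>.
Proof.
apply: smallest_sub; first exact: smallest_sigma_algebra.
move=> A [t [B [/andP[_ tn] mB ->]]].
by have := past_fun_y tn measurableT mB; rewrite setTI.
Qed.

Lemma past_fun_of_past n (f : T -> R) :
  (forall B, measurable B -> past y n (f @^-1` B)) -> past_fun n f.
Proof. by move=> hf _ B mB; rewrite setTI; apply: past_sub; exact: hf. Qed.

Lemma past_fun_resid n (h : T -> 'rV[R]_(p1 + p2)) s :
  (forall i, past_fun n (fun w => h w ord0 i)) -> (s <= n)%N ->
  past_fun n (fun w => resid (h w) (y ^~ w) s).
Proof.
move=> hh; elim/ltn_ind: s => -[|s] IH sn; first exact: past_fun_cst.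
rewrite (_ : (fun w => _) = fun w => y s.+1 w -
    arma_reg (h w) (y ^~ w) (resid (h w) (y ^~ w)) s.+1); last first.
  by apply/funext => w; rewrite residS.
apply: past_funB; first exact: past_fun_y.
apply: (@past_fun_reg _ _ h y (fun s w => resid (h w) (y ^~ w) s)) => // t ts.
  by apply: past_fun_y; rewrite (leq_trans _ sn)// ltnW.
by apply: IH => //; rewrite (leq_trans _ sn)// ltnW.
Qed.

Lemma resid_flt n (eta : 'rV[R]_(p1 + p2)) w t : (t <= n.+1)%N ->
  resid eta (y ^~ w) t = e t w + flt (e ^~ w) n (dser eta0 eta) t.
Proof.
move=> tn; rewrite flt_conv//.
apply: (@resid_filter _ _ _ eta0 eta (y ^~ w) (e ^~ w)) => // s s1.
exact: hy.
Qed.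

(** The filter depends on the random parameter through an inverse series. Writing the value as
    g_{n+1}(eta0) - g_{n+1}(h) leaves only finite sums and products of past quantities. *)
Lemma past_fun_flt n (h : T -> 'rV[R]_(p1 + p2)) :
  (forall i, past_fun n (fun w => h w ord0 i)) ->
  past_fun n (fun w => flt (e ^~ w) n (dser eta0 (h w)) n.+1).
Proof.
move=> hh; rewrite (_ : (fun w => _) = fun w =>
   arma_reg eta0 (y ^~ w) (fun s => e s w) n.+1 -
   arma_reg (h w) (y ^~ w) (resid (h w) (y ^~ w)) n.+1).
  apply: past_funB.
    apply: (@past_fun_reg _ _ (fun=> eta0) y (fun s => e s : T -> R)) => [i|s st|s st|//].
    - exact: past_fun_cst.
    - exact: past_fun_y.
    - by apply: past_fun_var.
  apply: (@past_fun_reg _ _ h y (fun s w => resid (h w) (y ^~ w) s)) => // s st.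
    exact: past_fun_y.
  exact: past_fun_resid.
apply/funext => w; have := @resid_flt n (h w) w n.+1 (leqnn _).
by rewrite residS hy// /arma_g => hr; lra.
Qed.

End Past.

Section Combine.
Context d (T : measurableType d) (R : realType) (P : probability T R).
Variable e : nat -> {RV P >-> R}.
Hypothesis e8 : forall t, P.-integrable setT (EFin \o (fun w => e t w ^+ 8)).
Local Notation "''Ex' [ f ]" := (\int[P]_w (f w)) (format "''Ex' [ f ]").
Notation dg := (dg e).

(** With x = a - c and z = c, a^2 - c^2 = x^2 + 2 z x, and Young's inequality with weight m gives (1
    + m) x^2 + z^2 / m. The hypotheses carry m^-2 to pay for the factor 1 + m. *)
Lemma second_moment_close N (a b c : T -> R) (v A B V : R) (m : nat) : (0 < m)%N ->
  dg N 4 a -> dg N 4 b -> dg N 4 c ->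
  'Ex[fun w => (a w - b w) ^+ 2] <= A / m%:R ^+ 2 ->
  'Ex[fun w => (b w - c w) ^+ 2] <= B / m%:R ^+ 2 ->
  `|'Ex[fun w => c w ^+ 2] - v| <= V / m%:R ^+ 2 -> 0 <= A -> 0 <= B -> 0 <= V -> 0 <= v ->
  `|'Ex[fun w => a w ^+ 2] - v| <= (4 * (A + B) + v + 2 * V) / m%:R.
Proof.
move=> m0 da db dc hA hB hV A0 B0 V0 v0.
have mr : 0 < m%:R :> R by rewrite ltr0n.
have mr1 : 1 <= m%:R :> R by rewrite ler1n.
have d1 : dg N 8 (fun w => (a w - b w) ^+ 2) := dgX 2 (dgB da db).
have d2 : dg N 8 (fun w => (b w - c w) ^+ 2) := dgX 2 (dgB db dc).
have d3 : dg N 8 (fun w => c w ^+ 2) := dgX 2 dc.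
have d4 : dg N 8 (fun w => a w ^+ 2) := dgX 2 da.
pose M : R := m%:R.
have MM : 0 < M by [].
pose bnd w := (1 + M) * (2 * ((a w - b w) ^+ 2 + (b w - c w) ^+ 2)) + M^-1 * c w ^+ 2.
have key w : `|a w ^+ 2 - c w ^+ 2| <= bnd w.
  rewrite /bnd; set x := a w - c w; set z := c w.
  have hx : x ^+ 2 <= 2 * ((a w - b w) ^+ 2 + (b w - c w) ^+ 2).
    by have := sq_sum2_le (a w - b w) (b w - c w); rewrite addrA subrK.
  have -> : a w ^+ 2 - z ^+ 2 = x ^+ 2 + 2 * z * x by rewrite /x /z; ring.
  apply: (@le_trans _ _ ((1 + M) * x ^+ 2 + M^-1 * z ^+ 2)); last first.
    by rewrite lerD2r ler_wpM2l// addr_ge0// ltW.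
  have s1 : 0 <= M^-1 * (z - M * x) ^+ 2 by rewrite mulr_ge0 ?sqr_ge0// invr_ge0 ltW.
  have s2 : 0 <= M^-1 * (z + M * x) ^+ 2 by rewrite mulr_ge0 ?sqr_ge0// invr_ge0 ltW.
  have e1 : M^-1 * (z - M * x) ^+ 2 = M^-1 * z ^+ 2 - 2 * z * x + M * x ^+ 2.
    by field; rewrite gt_eqF.
  have e2 : M^-1 * (z + M * x) ^+ 2 = M^-1 * z ^+ 2 + 2 * z * x + M * x ^+ 2.
    by field; rewrite gt_eqF.
  rewrite e1 in s1; rewrite e2 in s2; have := sqr_ge0 x.
  by rewrite ler_norml => ?; apply/andP; split; lra.
have d12 := dgD d1 d2.
have db' : dg N 8 bnd by apply: dgD; [apply: dgZ; apply: dgZ|apply: dgZ].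
have Eb : 'Ex[bnd] = (1 + M) * (2 * ('Ex[fun w => (a w - b w) ^+ 2] +
    'Ex[fun w => (b w - c w) ^+ 2])) + M^-1 * 'Ex[fun w => c w ^+ 2].
  rewrite /bnd (ExD e8 (dgZ _ (dgZ _ d12)) (dgZ _ d3)) (ExZ e8 _ (dgZ _ d12)).
  by rewrite (ExZ e8 _ d12) (ExD e8 d1 d2) (ExZ e8 _ d3).
have h1 : 'Ex[fun w => a w ^+ 2] - 'Ex[fun w => c w ^+ 2] <= 'Ex[bnd].
  rewrite -(ExB e8 d4 d3); apply: (Ex_le e8 (dgB d4 d3) db') => w /=.
  exact: le_trans (ler_norm _) (key w).
have h2 : 'Ex[fun w => c w ^+ 2] - 'Ex[fun w => a w ^+ 2] <= 'Ex[bnd].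
  rewrite -(ExB e8 d3 d4); apply: (Ex_le e8 (dgB d3 d4) db') => w /=.
  by rewrite -opprB (le_trans _ (key w))// -normrN ler_norm.
have hb : 'Ex[bnd] <= (4 * (A + B) + v + V) / M.
  rewrite Eb; apply: (@le_trans _ _ ((1 + M) * (2 * (A / M ^+ 2 + B / M ^+ 2)) + M^-1 * (v + V))).
    apply: lerD.
      by apply: ler_wpM2l; [nng|rewrite ler_wpM2l// lerD].
    apply: ler_wpM2l; first by nng.
    have : V / M ^+ 2 <= V by rewrite ler_pdivrMr ?exprn_gt0// ler_peMr// exprn_ege1.
    move: hV; rewrite -/M ler_norml => /andP[_]; lra.
  rewrite (_ : (4 * (A + B) + v + V) / M = M^-1 * (2 * (1 + 1) * (A + B)) + M^-1 * (v + V)); last by ring.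
  rewrite lerD2r (_ : (1 + M) * _ = M^-1 * (2 * (M^-1 + 1) * (A + B))); last first.
    by field; rewrite gt_eqF.
  rewrite ler_wpM2l ?invr_ge0 ?(ltW MM)// ler_wpM2r ?addr_ge0// ler_wpM2l// lerD2r.
  by rewrite invf_le1.
have hV' : V / M ^+ 2 <= V / M.
  rewrite ler_wpM2l// lef_pV2 ?posrE ?exprn_gt0//.
  by rewrite expr2 ler_peMr// ltW.
rewrite -/M (_ : (4 * (A + B) + v + 2 * V) / M = (4 * (A + B) + v + V) / M + V / M); last by ring.
move: hV; rewrite -/M !ler_norml => /andP[? ?]; apply/andP; split; lra.
Qed.

End Combine.

Theorem theorem3p4 (d : measure_display) (T : measurableType d)
    (R : realType) (P : probability T R) (p1 p2 : nat)
    (hp : (1 <= p1 + p2)%N)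
    (Pi : set 'rV[R]_(p1 + p2)) (eta0 : 'rV[R]_(p1 + p2))
    (hPicompact : compact Pi)
    (heta0 : interior Pi eta0)
    (hPi : forall eta, Pi eta -> arma_admissible eta)
    (eps : nat -> {RV P >-> R}) (y : nat -> T -> R)
    (heps0 : forall w, eps 0%N w = 0)
    (hy0 : forall w, y 0%N w = 0)
    (hy : forall (t : nat) (w : T), (1 <= t)%N ->
       y t w = arma_reg eta0 (y ^~ w) (fun s => eps s w) t + eps t w)
    (hiid : iid (fun t => eps t.+1))
    (sigma : R)
    (hmean : forall t : nat, (1 <= t)%N -> ('E_P[eps t] = 0)%E)
    (hvar : forall t : nat, (1 <= t)%N ->
       ('E_P[(fun w => eps t w ^+ 2)%R] = (sigma ^+ 2)%:E)%E)
    (a1 xi M1 : R) (ha1 : 0 < a1) (hxi : 0 < xi) (hM1 : 0 < M1)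
    (hcdf : forall s1 s2 : R, 0 < s2 - s1 -> s2 - s1 <= xi ->
       (ereal_sup [set x | exists (t m : nat) (v : 'rV[R]_m),
          [/\ (1 <= m <= t)%N, enorm v = 1%R &
              x = `|lincomb_cdf eps t v s2 - lincomb_cdf eps t v s1| ]]
        <= (M1 * (s2 - s1) `^ a1)%R%:E)%E)
    (q1 : R) (hq1 : 18 < q1)
    (hmom : ('E_P[(fun w => `|eps 1%N w| `^ q1)%R] < +oo)%E)
    (etahat : nat -> T -> 'rV[R]_(p1 + p2))
    (hetahat : least_squares_estimator Pi y etahat) :
  (fun n : nat =>
     (n%:R%:E *
      ('E_P[(fun w => (y n.+1 w - arma_g (etahat n w) (y ^~ w) n.+1) ^+ 2)%R]
       - (sigma ^+ 2)%:E))%E) @ \oo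
    --> (((p1 + p2)%:R * sigma ^+ 2)%R%:E : \bar R).
Proof.
set p := (p1 + p2)%N; pose s2 : R := sigma ^+ 2.
have s20 : 0 <= s2 by exact: sqr_ge0.
have inde : mutually_independent (fun t => eps t.+1) by case: hiid.
have same t B : measurable B -> distribution P (eps 1%N) B = distribution P (eps t.+1) B.
  by move=> mB; case: hiid => _ /(_ 0%N t B mB).
have mX8 : measurable_fun [set: R] (fun x : R => x ^+ 8) by exact: measurable_funX.
have I1 : P.-integrable setT (EFin \o (fun w => eps 1%N w ^+ 8)).
  by apply: integrable_pow8 hmom; lra.
have law8 t := integrable_same_law (@same t) mX8 I1.
have eps0E : (fun w => eps 0%N w ^+ 8) = fun=> 0.
  by apply/funext => w; rewrite heps0 expr0n.
have e8 t : P.-integrable setT (EFin \o (fun w => eps t w ^+ 8)).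
  by case: t => [|t]; [rewrite eps0E; exact: integrable0|exact: (law8 t).1].
pose mu : R := \int[P]_w (eps 1%N w ^+ 8).
have mom8 t : \int[P]_w (eps t w ^+ 8) <= mu.
  case: t => [|t]; last by rewrite /mu -(law8 t).2.
  rewrite eps0E Rintegral_cst// mul0r; apply: Rintegral_ge0 => w _.
  exact: exprn_even_ge0.
have mean0 t : \int[P]_w eps t.+1 w = 0.
  by have := hmean t.+1 isT; rewrite unlock /Rintegral => ->.
have var2 t : \int[P]_w (eps t.+1 w ^+ 2) = s2.
  by have := hvar t.+1 isT; rewrite unlock /Rintegral => ->.
have Pi0 : Pi eta0 by exact: interior_subset heta0.
have [C [rho [kappa [C0 /andP[rho0 rho1] kappa0 [hd hdd hf hdl hfl]]]]] :=
  arma_filter_bounds hPicompact Pi0 hPi.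
have [M M0 hM] : exists2 M : R, 0 < M & forall eta, Pi eta -> `|eta - eta0| <= M.
  have [N [_ hN]] := compact_bounded hPicompact.
  exists (`|N| + 1 + `|eta0|); first by rewrite ltr_wpDr// ltr_wpDl.
  move=> eta he; rewrite (le_trans (ler_normB _ _))// lerD2r.
  by apply: hN he; rewrite (le_lt_trans (ler_norm N))// ltrDl.
have [delta delta0 hball] : exists2 delta : R, 0 < delta &
    forall theta, `|theta| < delta -> Pi (eta0 + theta).
  have /nbhs_ballP[delta /= delta0 hb] := heta0; exists delta => // theta ht.
  by apply: hb; rewrite -ball_normE /ball_/= opprD addrA subrr sub0r normrN.
pose f := @fser R p1 p2 eta0.
(* Absorbs the sum over the p coordinates in [fl]; the successor also ensures C <= [C1]. *)
pose C1 : R := p.+1%:R * C.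
have CC1 : C <= C1 by rewrite ler_peMl ?ler1n// ltW.
have C10 : 0 < C1 by rewrite mulr_gt0.
have fl_le theta m : `|fl f theta m| <= C1 * `|theta| * rho ^+ m.
  have rm : 0 <= rho ^+ m by rewrite exprn_ge0// ltW.
  rewrite (le_trans (ler_norm_sum _ _ _))//.
  apply: (@le_trans _ _ (\sum_(i < p) C * `|theta| * rho ^+ m)).
    apply: ler_sum => i _; rewrite normrM.
    rewrite (_ : C * `|theta| * rho ^+ m = `|theta| * (C * rho ^+ m)); last by ring.
    by apply: ler_pM => //; exact: ler_mx_norm_coef.
  rewrite sumr_const card_ord -[leLHS]mulr_natl /C1 !mulrA ler_wpM2r// ler_wpM2r//.
  by rewrite ler_wpM2r ?(ltW C0)// ler_nat.
have d_le eta m : Pi eta -> `|dser eta0 eta m| <= C1 * `|eta - eta0| * rho ^+ m.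
  move=> he; apply: (le_trans (hd _ m he)); apply: ler_wpM2r; first by nng.
  by rewrite ler_wpM2r.
have d_diff eta m : Pi eta ->
    `|dser eta0 eta m - fl f (eta - eta0) m| <= C1 * `|eta - eta0| ^+ 2 * rho ^+ m.
  move=> he; apply: (le_trans (hdd _ m he)); apply: ler_wpM2r; first by nng.
  by apply: ler_wpM2r => //; nng.
have f_le i m : `|f i m| <= C1 * rho ^+ m.
  by apply: (le_trans (hf i m)); apply: ler_wpM2r => //; nng.
have d_0 eta : dser eta0 eta 0%N = 0.
  by rewrite /dser fpsME big_ord1 /fps_of_poly coef0_sylv mul0r.
have f_0 i : f i 0%N = 0.
  by rewrite /f /fser fpsME big_ord1 /fps_of_poly coef0_sylv mul0r.
(* The prediction error g_{n+1}(eta0) - g_{n+1}(etahat). *)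
pose D n w := flt (eps ^~ w) n (dser eta0 (etahat n w)) n.+1.
have Pihat n w : (0 < n)%N -> Pi (etahat n w).
  by move=> n0; have [/(_ w)[]] := hetahat n n0.
have pD n : (0 < n)%N -> past_fun (fun t => eps t.+1) n (D n).
  move=> n0; apply: (past_fun_flt heps0 hy0 hy) => i.
  apply: (past_fun_of_past heps0 hy0 hy) => B mB.
  by have [_] := hetahat n n0; apply.
have D_le n w : (0 < n)%N -> `|D n w| <= C1 * M * past_size rho (eps ^~ w) n.
  move=> n0; apply: flt_le => m; apply: (le_trans (d_le _ m (Pihat n w n0))).
  apply: ler_wpM2r; first by nng.
  by apply: ler_wpM2l; [exact: ltW|exact: hM (Pihat n w n0)].
have dD n : (0 < n)%N -> dg eps n.+2 1 (D n).
  move=> n0; split; first exact: past_fun_measurable (pD n n0).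
  have [K K0 hK] := dg_bound (dg_past_size eps rho n).
  exists (C1 * M * K) => w; apply: (le_trans (D_le n w n0)).
  rewrite -[leRHS]mulrA; apply: ler_wpM2l; first by nng.
  exact: le_trans (ler_norm _) (hK w).
pose u n := \int[P]_w ((Num.sqrt n%:R * D n w) ^+ 2).
(* D depends only on the past, so its product with the next innovation has mean zero and the
   innovation variance cancels. *)
have riskE n : (0 < n)%N -> (n%:R%:E *
    ('E_P[(fun w => (y n.+1 w - arma_g (etahat n w) (y ^~ w) n.+1) ^+ 2)%R]
     - (sigma ^+ 2)%:E))%E = (u n)%:E.
  move=> n0; have de : dg eps n.+2 1 (eps n.+1) := dg_var eps (ltnSn _).
  have d1 : dg eps n.+2 8 (fun w => eps n.+1 w ^+ 2) := dg_le (isT : (1 * 2 <= 8)%N) (dgX 2 de).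
  have d2 : dg eps n.+2 8 (fun w => D n w * eps n.+1 w) := dg_le (isT : (1 + 1 <= 8)%N) (dgM (dD n n0) de).
  have d3 : dg eps n.+2 8 (fun w => D n w ^+ 2) := dg_le (isT : (1 * 2 <= 8)%N) (dgX 2 (dD n n0)).
  have d4 : dg eps n.+2 8 (fun w => eps n.+1 w ^+ 2 + (2 * (D n w * eps n.+1 w) + D n w ^+ 2)).
    by apply: dgD => //; apply: dgD => //; exact: dgZ.
  have -> : (fun w => (y n.+1 w - arma_g (etahat n w) (y ^~ w) n.+1) ^+ 2) =
      (fun w => eps n.+1 w ^+ 2 + (2 * (D n w * eps n.+1 w) + D n w ^+ 2)).
    apply/funext => w; rewrite -residS (resid_flt heps0 hy0 hy (n := n))//.
    by rewrite -/(D n w); ring.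
  rewrite unlock -[X in (X - _)%E]fineK; last exact: integrable_fin_num (dg_int e8 _ d4).
  rewrite -/(Rintegral P setT _) -EFinB -EFinM; congr EFin.
  rewrite (ExD e8 d1 (dgD (dgZ 2 d2) d3)) (ExD e8 (dgZ 2 d2) d3) (ExZ e8 2 d2) var2.
  rewrite (Ex_innov e8 inde mean0 (pD n n0) (ltnSn _) (dg_le _ (dD n n0)))//.
  rewrite mulr0 add0r addrAC subrr add0r /u.
  rewrite -(ExZ e8 _ d3); apply: eq_Rintegral => w _.
  by rewrite exprMn sqr_sqrtr.
suff cu : u @ \oo --> p%:R * s2.
  have -> : ((p%:R * sigma ^+ 2)%R%:E : \bar R) = (p%:R * s2)%:E by [].
  apply: cvg_EFin.
    by exists 1%N => // n /= n0; rewrite riskE.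
  apply: cvg_trans cu; apply: near_eq_cvg; exists 1%N => // n /= n0.
  by rewrite riskE.
(* If sigma = 0, every innovation has zero second moment; D is dominated by a weighted sum of them,
   hence its mean square vanishes. *)
have [s2E|s2n0] := eqVneq s2 0.
  rewrite s2E mulr0; apply: cvg_near_cst; exists 1%N => // n /= n0.
  have dq m : dg eps n.+2 8 (fun w => eps (n.+1 - m)%N w ^+ 2).
    have h : (n.+1 - m < n.+2)%N by rewrite ltnS leq_subr.
    exact: (dg_le (isT : (1 * 2 <= 8)%N) (dgX 2 (dg_var eps h))).
  have e20 m : \int[P]_w (eps m w ^+ 2) = 0.
    case: m => [|m]; last by rewrite var2.
    by under eq_Rintegral do rewrite heps0 expr0n; rewrite Rintegral_cst// mul0r.
  pose S w := \sum_(m < n.+1) rho ^+ m * eps (n.+1 - m)%N w ^+ 2.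
  have dS : dg eps n.+2 8 S by apply: dg_sum => m _; exact: dgZ.
  pose c := n%:R * (C1 * M) ^+ 2 * \sum_(m < n.+1) rho ^+ m.
  apply/eqP; rewrite eq_le; apply/andP; split; last first.
    by apply: Rintegral_ge0 => w _; exact: sqr_ge0.
  have dL : dg eps n.+2 8 (fun w => (Num.sqrt n%:R * D n w) ^+ 2).
    exact: (dg_le (isT : (1 * 2 <= 8)%N) (dgX 2 (dgZ _ (dD n n0)))).
  apply: (le_trans (Ex_le e8 dL (dgZ c dS) _)).
    move=> w /=; rewrite exprMn sqr_sqrtr//.
    rewrite (_ : c * S w = n%:R * ((C1 * M) ^+ 2 * ((\sum_(m < n.+1) rho ^+ m) * S w))); last by rewrite /c; ring.
    rewrite ler_wpM2l//; apply: (le_trans (sqr_le_norm (D_le n w n0))).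
    rewrite exprMn ler_wpM2l ?sqr_ge0//.
    have r0 (m : 'I_n.+1) : 0 <= rho ^+ m by nng.
    apply: (le_trans (sq_mean _ r0)); rewrite le_eqVlt; apply/orP; left; apply/eqP.
    by congr (_ * _); apply: eq_bigr => m _; rewrite real_normK ?num_real.
  rewrite (ExZ e8 _ dS) /S (Ex_sum e8 _ (fun m : 'I_n.+1 => dgZ (rho ^+ m) (dq m))) big1 ?mulr0// => m _.
  by rewrite (ExZ e8 _ (dq m)) e20 mulr0.
have {s2n0}s2p : 0 < s2 by rewrite lt_neqAle eq_sym s2n0.
have [C' C'0 hC'] := lse_comparison (q := p) s2p rho0 rho1 kappa0 C10 delta0
  Pi0 hball hM d_0 f_0 d_le d_diff fl_le hdl hfl.
pose A := C' * (geo_mass rho ^+ 8 * (16 * mu4 s2 mu) + geo_mass rho ^+ 8 * mu).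
pose B := trunc_const p s2 mu rho kappa C1.
pose V := var_const p s2 rho kappa C1.
have mu0 : 0 <= mu := mom8_ge0 mom8.
have G0 : 0 <= (1 - rho)^-1 by rewrite invr_ge0 subr_ge0 ltW.
have A0 : 0 <= A.
  by apply: mulr_ge0 => //; rewrite /mu4 /geo_mass; nng.
have B0 : 0 <= B by rewrite /B /trunc_const; nng.
have V0 : 0 <= V by rewrite /V /var_const; nng.
apply: (@cvg_of_rate _ _ _ (4 * (A + B) + p%:R * s2 + 2 * V)) => m m0.
(* A window of length m^2 gives the rate m^-2 required above, and n >= l^2 gives sqrt n >= m^2, so
   the comparison error has the same rate. *)
pose l := (m * m)%N.
have l0 : (0 < l)%N by rewrite muln_gt0 m0.
exists (l * l + p.*2)%N => n hn.
have lln : (l * l <= n)%N by apply: leq_trans hn; rewrite leq_addr.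
have pn : (p.*2 <= n)%N by apply: leq_trans hn; rewrite leq_addl.
have n0 : (0 < n)%N by apply: leq_trans lln; rewrite muln_gt0 l0.
have lE : l%:R = m%:R ^+ 2 :> R by rewrite /l natrM -expr2.
have da : dg eps n.+2 4 (fun w => Num.sqrt n%:R * D n w).
  exact: (dg_le (isT : (1 <= 4)%N) (dgZ _ (dD n n0))).
have db : dg eps n.+2 4 (bval eps s2 f n) := dg_le (isT : (3 <= 4)%N) (dg_bval s2 f heps0 n).
have dc : dg eps n.+2 4 (btrunc eps s2 f n l) := dg_le (isT : (3 <= 4)%N) (dg_btrunc eps s2 f n l0).
apply: (second_moment_close e8 m0 da db dc) => //.
- have dE : dg eps n.+2 8 (fun w => acov_dev s2 rho (eps ^~ w) n ^+ 3 * past_size rho (eps ^~ w) n ^+ 2).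
    exact: (dgM (dgX 3 (dg_wide (leqnSn n.+1) (dg_acov_dev eps s2 rho n))) (dgX 2 (dg_past_size eps rho n))).
  have dL : dg eps n.+2 8 (fun w => (Num.sqrt n%:R * D n w - bval eps s2 f n w) ^+ 2).
    exact: (dgX 2 (dgB da db)).
  have sl : m%:R ^+ 2 <= Num.sqrt n%:R :> R.
    rewrite -lE -(ger0_norm (ler0n R l)) -sqrtr_sqr ler_sqrt// -natrX ler_nat.
    by rewrite -mulnn.
  have m20 : 0 < m%:R ^+ 2 :> R by rewrite exprn_gt0// ltr0n.
  apply: (le_trans (Ex_le e8 dL (dgZ (C' / m%:R ^+ 2) dE) _)).
    move=> w /=; apply: (le_trans (hC' n (eps ^~ w) (etahat n w) (thetas eps s2 f n w) n0 pn (Pihat n w n0) _ _)).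
    + move=> eta he; have [/(_ w)[_ /(_ eta he)]] := hetahat n n0.
      have E zeta : \sum_(1 <= t < n.+1) (y t w - arma_g zeta (y ^~ w) t) ^+ 2 =
          \sum_(1 <= t < n.+1) (eps t w + flt (eps ^~ w) n (dser eta0 zeta) t) ^+ 2.
        rewrite !big_add1; apply: eq_big_nat => t /andP[_ tn].
        by rewrite -residS (resid_flt heps0 hy0 hy (n := n))// ltnS ltnW.
      by rewrite !E.
    + move=> theta; exact: (thetasP heps0 s2p kappa0 hfl).
    + rewrite [leRHS]mulrAC -[leRHS]mulrA; apply: ler_wpM2l => //; apply: ler_wpM2l.
        by apply: mulr_ge0; apply: exprn_ge0; [exact: acov_dev_ge0|exact: past_size_ge0].
      by rewrite lef_pV2 ?posrE// (lt_le_trans m20).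
  rewrite (ExZ e8 _ dE) /A mulrAC ler_wpM2r ?invr_ge0 ?(ltW m20)// ler_wpM2l//.
  exact: (error_moment e8 heps0 inde mean0 var2 mom8 rho0 rho1).
- rewrite -lE; exact: (bval_btrunc e8 heps0 inde mean0 mom8 s2p rho0 rho1 kappa0 (ltW C10) f_0 f_le hfl l0 lln pn).
- rewrite -lE; exact: (btrunc_var e8 heps0 inde mean0 var2 s2p rho0 rho1 kappa0 (ltW C10) f_0 f_le hfl l0 lln pn).
- by rewrite mulr_ge0.
Qed.
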